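(* Let $V:S^1\to\mathbb{R}$ be of class $C^{k-1,1}(S^1)$ for some $k\ge2$ with $\kappa'(\theta)>0$ for all $\theta$. For each $n$, let $\gamma_{n-1}>0$ be the leading coefficient of the orthonormal polynomial of degree $n-1$ with respect to the weight $\phi(\theta)=e^{-nV(\theta)}$ on the unit circle, and let $V_0=\frac{1}{2\pi}\int_{-\pi}^\pi V(\theta)d\theta$. Then there is a constant $K>0$ such that \[ \left|\gamma_{n-1}^2e^{-nV_0}-1\right|\le\frac{K\log(n)}{n^{2(k-1)}} \] for all sufficiently large $n$.
   Context: $C^{k-1,1}(S^1)$: functions on the circle whose periodic extension has $k-1$ Lipschitz continuous derivatives. For the fixed weight $\phi=e^{-nV}$, orthonormal polynomials $p_j(z)=\gamma_jz^j+\dots$ with $\gamma_j>0$ satisfy $\langle p_i,p_j\rangle_\phi=\delta_{ij}$, where $\langle f,g\rangle_\phi=\frac{1}{2\pi}\int_{-\pi}^{\pi}f(e^{i\theta})\overline{g(e^{i\theta})}\phi(\theta)d\theta$. $V_j$ the Fourier coefficients of $V$, $N(z)=\sum_{j\ge1}V_{-j}z^{-j}$, $\Omega(\theta)=2\,\mathrm{Im}\,N(e^{i\theta})$, $\kappa(\theta)=\theta+\Omega(\theta)$. *)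

(* Defs.v *)
From Stdlib Require Import Reals Lra Lia.
From Coquelicot Require Import Coquelicot.
Open Scope R_scope.

Definition eith (t : R) : C := (cos t, sin t).

Definition CRInt (f : R -> C) (a b : R) : C :=
  (RInt (fun t => Re (f t)) a b, RInt (fun t => Im (f t)) a b).

Definition CmLip (m : nat) (V : R -> R) : Prop :=
  (forall x, V (x + 2 * PI) = V x) /\
  (forall j x, (j <= m)%nat -> ex_derive_n V j x) /\
  (exists L, forall x y, Rabs (Derive_n V m x - Derive_n V m y) <= L * Rabs (x - y)).

Definition fourier (V : R -> R) (j : Z) : C :=
  Cmult (RtoC (/ (2 * PI)))
        (CRInt (fun t => Cmult (RtoC (V t)) (eith (- IZR j * t))) (- PI) PI).

(* Omega(theta) = 2 Im N(e^{i theta}),  N(z) = sum_{j>=1} V_{-j} z^{-j} *)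
Definition Omega (V : R -> R) (t : R) : R :=
  2 * Series (fun j : nat =>
    Im (Cmult (fourier V (- Z.of_nat (S j))) (eith (- INR (S j) * t)))).

Definition kappa (V : R -> R) (t : R) : R := t + Omega V t.

Fixpoint Cpow (z : C) (n : nat) : C :=
  match n with O => RtoC 1 | S m => Cmult z (Cpow z m) end.

Fixpoint peval (c : nat -> C) (d : nat) (z : C) : C :=
  match d with
  | O => c O
  | S m => Cplus (peval c m z) (Cmult (c (S m)) (Cpow z (S m)))
  end.

Definition ip (phi : R -> R) (f g : C -> C) : C :=
  Cmult (RtoC (/ (2 * PI)))
        (CRInt (fun t => Cmult (Cmult (f (eith t)) (Cconj (g (eith t)))) (RtoC (phi t)))
               (- PI) PI).

(* P j is the coefficient sequence of p_j (a polynomial of degree j, evaluated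
   as sum_{i<=j} (P j i) z^i), with leading coefficient gamma_j = P j j real > 0,
   and <p_i, p_j>_phi = delta_ij. *)
Definition orthonormal_system (phi : R -> R) (P : nat -> nat -> C) : Prop :=
  (forall j, Im (P j j) = 0 /\ 0 < Re (P j j)) /\
  (forall i j, ip phi (peval (P i) i) (peval (P j) j) =
               RtoC (if Nat.eqb i j then 1 else 0)).

Definition V0 (V : R -> R) : R := / (2 * PI) * RInt V (- PI) PI.

(* Main.v *)
Require Import Defs.
From Stdlib Require Import Reals ZArith Lra Lia.
From Coquelicot Require Import Coquelicot.
Open Scope R_scope.

(** Write V = 2 Re F on the circle with F = sum_{j >= 0} a_j z^j analytic, so that
    kappa = theta - 2 Im F and the weight is |X|^2 for the outer function X = e^{-n F}. Let p* be the
    reversed polynomial of p_{n-1} and E = 1 - gamma_{n-1} e^{-n V_0 / 2} p* X. Orthonormality gives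
    mean E = ||E||^2 = 1 - gamma_{n-1}^2 e^{-n V_0} and shows that E conj X has no frequencies
    0, ..., n - 1. Dividing by conj X gives E = conj a + e^{i n kappa} b with a, b analytic and a(0) = 0,
    hence ||E||^2 = mean (e^{i n kappa} b). Suppose that the nonpositive frequencies of e^{i n kappa} have
    L^2 norm at most eps and that the spaces of the two summands meet at an angle bounded below, so that
    ||b|| <= 2 ||E||. Then ||E||^2 <= eps ||b|| <= 2 eps ||E||, and the defect ||E||^2 is quadratic in eps.

    To reach eps = O(n^{1-k}), truncate F at a frequency proportional to n. Since sum j^{2k} |a_j|^2 is
    finite, this changes e^{i n kappa} by O(n^{1-k}) in L^2 and by o(1) uniformly. The truncated phase
    continues analytically, and moving the contour inwards by a multiple of (log n) / n bounds its
    nonpositive frequencies by n^{-k}, because kappa' is bounded below. *)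

(** * Continuous functions and means over a period *)

Definition Rcontinuous (f : R -> R) : Prop := forall t, continuous f t.
Definition Ccontinuous (f : R -> C) : Prop :=
  Rcontinuous (fun t => Re (f t)) /\ Rcontinuous (fun t => Im (f t)).

Create HintDb continuity.

Lemma Rcontinuous_ext (f g : R -> R) : (forall t, f t = g t) -> Rcontinuous f -> Rcontinuous g.
Proof. intros Heq Hf t. apply (continuous_ext f); auto. Qed.

Lemma Rcontinuous_const (c : R) : Rcontinuous (fun _ => c).
Proof. intro t. apply continuous_const. Qed.

Lemma Rcontinuous_id : Rcontinuous (fun t => t).
Proof. intro t. apply continuous_id. Qed.

Lemma Rcontinuous_plus (f g : R -> R) :
  Rcontinuous f -> Rcontinuous g -> Rcontinuous (fun t => f t + g t).
Proof. intros Hf Hg t. exact (continuous_plus f g t (Hf t) (Hg t)). Qed.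

Lemma Rcontinuous_opp (f : R -> R) : Rcontinuous f -> Rcontinuous (fun t => - f t).
Proof. intros Hf t. exact (continuous_opp f t (Hf t)). Qed.

Lemma Rcontinuous_minus (f g : R -> R) :
  Rcontinuous f -> Rcontinuous g -> Rcontinuous (fun t => f t - g t).
Proof. intros Hf Hg t. exact (continuous_minus f g t (Hf t) (Hg t)). Qed.

Lemma Rcontinuous_mult (f g : R -> R) :
  Rcontinuous f -> Rcontinuous g -> Rcontinuous (fun t => f t * g t).
Proof. intros Hf Hg t. exact (continuous_mult f g t (Hf t) (Hg t)). Qed.

Lemma Rcontinuous_div_const (f : R -> R) (c : R) : Rcontinuous f -> Rcontinuous (fun t => f t / c).
Proof. intro Hf. exact (Rcontinuous_mult f _ Hf (Rcontinuous_const (/ c))). Qed.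

Lemma Rcontinuous_comp (f g : R -> R) :
  Rcontinuous f -> Rcontinuous g -> Rcontinuous (fun t => g (f t)).
Proof. intros Hf Hg t. exact (continuous_comp f g t (Hf t) (Hg (f t))). Qed.

Lemma Rcontinuous_cos (f : R -> R) : Rcontinuous f -> Rcontinuous (fun t => cos (f t)).
Proof. intro Hf. apply (Rcontinuous_comp f cos Hf). intro t. apply continuous_cos. Qed.

Lemma Rcontinuous_sin (f : R -> R) : Rcontinuous f -> Rcontinuous (fun t => sin (f t)).
Proof. intro Hf. apply (Rcontinuous_comp f sin Hf). intro t. apply continuous_sin. Qed.

Lemma Rcontinuous_exp (f : R -> R) : Rcontinuous f -> Rcontinuous (fun t => exp (f t)).
Proof. intro Hf. apply (Rcontinuous_comp f exp Hf). intro t. apply continuous_exp. Qed.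

Lemma is_derive_Rcontinuous (f df : R -> R) :
  (forall t, is_derive f t (df t)) -> Rcontinuous f.
Proof. intros Hf t. apply (ex_derive_continuous f). now exists (df t). Qed.

Lemma ex_RInt_Rcontinuous (f : R -> R) (a b : R) : Rcontinuous f -> ex_RInt f a b.
Proof. intros Hf. apply (@ex_RInt_continuous R_CompleteNormedModule). intros; apply Hf. Qed.

#[local] Hint Resolve Rcontinuous_const Rcontinuous_id Rcontinuous_plus Rcontinuous_opp
  Rcontinuous_minus Rcontinuous_mult Rcontinuous_div_const Rcontinuous_cos Rcontinuous_sin
  Rcontinuous_exp ex_RInt_Rcontinuous : continuity.

Lemma Ccontinuous_ext (f g : R -> C) : (forall t, f t = g t) -> Ccontinuous f -> Ccontinuous g.
Proof.
  intros Heq [Hre Him]; split; [eapply Rcontinuous_ext, Hre | eapply Rcontinuous_ext, Him];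
    intro t; simpl; now rewrite Heq.
Qed.

Lemma Ccontinuous_const (c : C) : Ccontinuous (fun _ => c).
Proof. split; auto with continuity. Qed.

Lemma Ccontinuous_RtoC (f : R -> R) : Rcontinuous f -> Ccontinuous (fun t => RtoC (f t)).
Proof. split; [assumption | exact (Rcontinuous_const 0)]. Qed.

Lemma Ccontinuous_plus (f g : R -> C) :
  Ccontinuous f -> Ccontinuous g -> Ccontinuous (fun t => f t + g t)%C.
Proof. intros [] []; split; now apply Rcontinuous_plus. Qed.

Lemma Ccontinuous_opp (f : R -> C) : Ccontinuous f -> Ccontinuous (fun t => - f t)%C.
Proof. intros []; split; now apply Rcontinuous_opp. Qed.

Lemma Ccontinuous_minus (f g : R -> C) :
  Ccontinuous f -> Ccontinuous g -> Ccontinuous (fun t => f t - g t)%C.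
Proof. intros Hf Hg. apply Ccontinuous_plus; auto using Ccontinuous_opp. Qed.

Lemma Ccontinuous_mult (f g : R -> C) :
  Ccontinuous f -> Ccontinuous g -> Ccontinuous (fun t => f t * g t)%C.
Proof.
  intros [] []; split.
  - apply Rcontinuous_minus; now apply Rcontinuous_mult.
  - apply Rcontinuous_plus; now apply Rcontinuous_mult.
Qed.

Lemma Ccontinuous_conj (f : R -> C) : Ccontinuous f -> Ccontinuous (fun t => Cconj (f t)).
Proof. intros []; split; [assumption | now apply Rcontinuous_opp]. Qed.

Lemma Ccontinuous_pow (f : R -> C) (n : nat) :
  Ccontinuous f -> Ccontinuous (fun t => f t ^ n)%C.
Proof.
  intro Hf. induction n as [|n IHn]; simpl; [apply Ccontinuous_const | now apply Ccontinuous_mult].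
Qed.

Lemma Ccontinuous_eith (f : R -> R) : Rcontinuous f -> Ccontinuous (fun t => eith (f t)).
Proof. split; [now apply Rcontinuous_cos | now apply Rcontinuous_sin]. Qed.

Lemma Ccontinuous_translate (f : R -> C) (h : R) :
  Ccontinuous f -> Ccontinuous (fun t => f (t + h)).
Proof.
  assert (Hh : Rcontinuous (fun t => t + h)) by auto with continuity.
  intros [Hre Him]; split.
  - exact (Rcontinuous_comp _ _ Hh Hre).
  - exact (Rcontinuous_comp _ _ Hh Him).
Qed.

Lemma Rcontinuous_Re (f : R -> C) : Ccontinuous f -> Rcontinuous (fun t => Re (f t)).
Proof. now intros []. Qed.

Lemma Rcontinuous_Im (f : R -> C) : Ccontinuous f -> Rcontinuous (fun t => Im (f t)).
Proof. now intros []. Qed.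

Lemma Rcontinuous_Cmod_sqr (f : R -> C) : Ccontinuous f -> Rcontinuous (fun t => Cmod (f t) ^ 2).
Proof.
  intros []. apply (Rcontinuous_ext (fun t => Re (f t) * Re (f t) + Im (f t) * Im (f t))).
  - intro t. rewrite Cmod2_alt. ring.
  - auto with continuity.
Qed.

#[local] Hint Resolve Ccontinuous_const Ccontinuous_RtoC Ccontinuous_plus Ccontinuous_opp
  Ccontinuous_minus Ccontinuous_mult Ccontinuous_conj Ccontinuous_pow Ccontinuous_eith
  Ccontinuous_translate Rcontinuous_Re Rcontinuous_Im Rcontinuous_Cmod_sqr : continuity.

Definition Rmean (f : R -> R) : R := / (2 * PI) * RInt f (- PI) PI.

Lemma Rmean_ext_in (f g : R -> R) : (forall t, - PI < t < PI -> f t = g t) -> Rmean f = Rmean g.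
Proof.
  intro Heq. unfold Rmean. f_equal. apply RInt_ext. intros t Ht.
  assert (HPI := PI_RGT_0). rewrite Rmin_left, Rmax_right in Ht by lra. auto.
Qed.

Lemma Rmean_ext (f g : R -> R) : (forall t, f t = g t) -> Rmean f = Rmean g.
Proof. intro Heq. apply Rmean_ext_in. auto. Qed.

Lemma Rmean_const (c : R) : Rmean (fun _ => c) = c.
Proof.
  unfold Rmean. rewrite RInt_const. unfold scal; simpl; unfold mult; simpl. field. apply PI_neq0.
Qed.

Lemma Rmean_plus (f g : R -> R) : Rcontinuous f -> Rcontinuous g ->
  Rmean (fun t => f t + g t) = Rmean f + Rmean g.
Proof.
  intros Hf Hg. unfold Rmean. rewrite <- Rmult_plus_distr_l. f_equal.
  apply (RInt_plus f g); auto with continuity.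
Qed.

Lemma Rmean_scal (c : R) (f : R -> R) : Rcontinuous f -> Rmean (fun t => c * f t) = c * Rmean f.
Proof.
  intros Hf. unfold Rmean.
  assert (Hscal : RInt (fun t => c * f t) (- PI) PI = c * RInt f (- PI) PI)
    by (apply (RInt_scal f); auto with continuity).
  rewrite Hscal. ring.
Qed.

Lemma Rmean_opp (f : R -> R) : Rcontinuous f -> Rmean (fun t => - f t) = - Rmean f.
Proof.
  intros Hf. rewrite (Rmean_ext _ (fun t => (-1) * f t)) by (intro; ring).
  rewrite Rmean_scal by assumption. ring.
Qed.

Lemma Rmean_minus (f g : R -> R) : Rcontinuous f -> Rcontinuous g ->
  Rmean (fun t => f t - g t) = Rmean f - Rmean g.
Proof.
  intros Hf Hg. unfold Rminus. rewrite Rmean_plus, Rmean_opp by auto with continuity. reflexivity.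
Qed.

Lemma Rmean_le (f g : R -> R) : Rcontinuous f -> Rcontinuous g ->
  (forall t, f t <= g t) -> Rmean f <= Rmean g.
Proof.
  intros Hf Hg Hle. assert (HPI := PI_RGT_0). apply Rmult_le_compat_l.
  - left; apply Rinv_0_lt_compat; lra.
  - apply RInt_le; auto with continuity. lra.
Qed.

Definition Cmean (f : R -> C) : C := (RtoC (/ (2 * PI)) * CRInt f (- PI) PI)%C.

Lemma Cmean_pair (f : R -> C) : Cmean f = (Rmean (fun t => Re (f t)), Rmean (fun t => Im (f t))).
Proof. unfold Cmean, CRInt, Rmean, Cmult, RtoC. simpl. f_equal; ring. Qed.

Lemma Cmean_ext_in (f g : R -> C) : (forall t, - PI < t < PI -> f t = g t) -> Cmean f = Cmean g.
Proof.
  intro Heq. rewrite !Cmean_pair. f_equal; apply Rmean_ext_in; intros t Ht; now rewrite Heq.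
Qed.

Lemma Cmean_ext (f g : R -> C) : (forall t, f t = g t) -> Cmean f = Cmean g.
Proof. intro Heq. apply Cmean_ext_in. auto. Qed.

Lemma Cmean_const (c : C) : Cmean (fun _ => c) = c.
Proof. rewrite Cmean_pair, !Rmean_const. now destruct c. Qed.

Lemma Cmean_RtoC (f : R -> R) : Cmean (fun t => RtoC (f t)) = RtoC (Rmean f).
Proof. rewrite Cmean_pair. unfold RtoC at 3. f_equal. exact (Rmean_const 0). Qed.

Lemma Cmean_plus (f g : R -> C) : Ccontinuous f -> Ccontinuous g ->
  Cmean (fun t => f t + g t)%C = (Cmean f + Cmean g)%C.
Proof. intros [] []. rewrite !Cmean_pair. unfold Cplus; simpl. f_equal; now apply Rmean_plus. Qed.

Lemma Cmean_opp (f : R -> C) : Ccontinuous f -> Cmean (fun t => - f t)%C = (- Cmean f)%C.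
Proof. intros []. rewrite !Cmean_pair. unfold Copp; simpl. f_equal; now apply Rmean_opp. Qed.

Lemma Cmean_minus (f g : R -> C) : Ccontinuous f -> Ccontinuous g ->
  Cmean (fun t => f t - g t)%C = (Cmean f - Cmean g)%C.
Proof.
  intros Hf Hg. unfold Cminus. rewrite Cmean_plus, Cmean_opp by auto with continuity. reflexivity.
Qed.

Lemma Cmean_scal (c : C) (f : R -> C) : Ccontinuous f -> Cmean (fun t => c * f t)%C = (c * Cmean f)%C.
Proof.
  intros [Hre Him]. rewrite !Cmean_pair. unfold Cmult; simpl. f_equal.
  - rewrite Rmean_minus, !Rmean_scal by auto with continuity. reflexivity.
  - rewrite Rmean_plus, !Rmean_scal by auto with continuity. reflexivity.
Qed.

Lemma Cmean_conj (f : R -> C) : Ccontinuous f -> Cmean (fun t => Cconj (f t)) = Cconj (Cmean f).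
Proof. intros []. rewrite !Cmean_pair. unfold Cconj; simpl. f_equal. now apply Rmean_opp. Qed.

Definition sqnorm (f : R -> C) : R := Rmean (fun t => Cmod (f t) ^ 2).
Definition L2norm (f : R -> C) : R := sqrt (sqnorm f).

Lemma sqnorm_ext (f g : R -> C) : (forall t, f t = g t) -> sqnorm f = sqnorm g.
Proof. intro Heq. apply Rmean_ext. intro t. now rewrite Heq. Qed.

Lemma L2norm_ext (f g : R -> C) : (forall t, f t = g t) -> L2norm f = L2norm g.
Proof. intro Heq. unfold L2norm. f_equal. now apply sqnorm_ext. Qed.

Lemma sqnorm_ge_0 (f : R -> C) : Ccontinuous f -> 0 <= sqnorm f.
Proof.
  intro Hf. rewrite <- (Rmean_const 0). apply Rmean_le; auto with continuity.
  intro t. apply pow2_ge_0.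
Qed.

Lemma L2norm_ge_0 (f : R -> C) : 0 <= L2norm f.
Proof. apply sqrt_pos. Qed.

Lemma L2norm_sqr (f : R -> C) : Ccontinuous f -> L2norm f ^ 2 = sqnorm f.
Proof. intro Hf. apply pow2_sqrt, sqnorm_ge_0, Hf. Qed.

Lemma sqnorm_conj (f : R -> C) : sqnorm (fun t => Cconj (f t)) = sqnorm f.
Proof. apply Rmean_ext. intro t. now rewrite Cmod_conj. Qed.

Lemma L2norm_conj (f : R -> C) : L2norm (fun t => Cconj (f t)) = L2norm f.
Proof. unfold L2norm. now rewrite sqnorm_conj. Qed.

Lemma sqnorm_unimodular (u f : R -> C) :
  (forall t, Cmod (u t) = 1) -> sqnorm (fun t => u t * f t)%C = sqnorm f.
Proof. intro Hu. apply Rmean_ext. intro t. rewrite Cmod_mult, Hu. ring. Qed.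

Lemma sqnorm_plus (f g : R -> C) : Ccontinuous f -> Ccontinuous g ->
  sqnorm (fun t => f t + g t)%C =
  sqnorm f + sqnorm g + 2 * Re (Cmean (fun t => f t * Cconj (g t))%C).
Proof.
  intros Hf Hg. rewrite Cmean_pair. cbn [fst Re].
  assert (Hfg : Rcontinuous (fun t => Re (f t * Cconj (g t)))) by auto with continuity.
  rewrite <- Rmean_scal by exact Hfg. unfold sqnorm. rewrite <- !Rmean_plus by auto with continuity.
  apply Rmean_ext. intro t. rewrite !Cmod2_alt. simpl. unfold Re, Im. ring.
Qed.

Lemma sqnorm_scal (c : C) (f : R -> C) : Ccontinuous f ->
  sqnorm (fun t => c * f t)%C = Cmod c ^ 2 * sqnorm f.
Proof.
  intro Hf. unfold sqnorm. rewrite <- Rmean_scal by auto with continuity.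
  apply Rmean_ext. intro t. rewrite Cmod_mult. ring.
Qed.

Lemma sqnorm_le (f g : R -> C) : Ccontinuous f -> Ccontinuous g ->
  (forall t, Cmod (f t) <= Cmod (g t)) -> sqnorm f <= sqnorm g.
Proof.
  intros Hf Hg Hle. apply Rmean_le; auto with continuity.
  intro t. apply pow_incr. split; [apply Cmod_ge_0 | apply Hle].
Qed.

Lemma L2norm_const (c : C) : L2norm (fun _ => c) = Cmod c.
Proof. unfold L2norm, sqnorm. rewrite Rmean_const. apply sqrt_pow2, Cmod_ge_0. Qed.

Lemma L2norm_scal (c : C) (f : R -> C) : Ccontinuous f ->
  L2norm (fun t => c * f t)%C = Cmod c * L2norm f.
Proof.
  intro Hf. unfold L2norm. rewrite sqnorm_scal by assumption.
  rewrite sqrt_mult by (apply pow2_ge_0 || now apply sqnorm_ge_0).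
  f_equal. apply sqrt_pow2, Cmod_ge_0.
Qed.

Lemma L2norm_le (f g : R -> C) : Ccontinuous f -> Ccontinuous g ->
  (forall t, Cmod (f t) <= Cmod (g t)) -> L2norm f <= L2norm g.
Proof. intros Hf Hg Hle. apply sqrt_le_1_alt. now apply sqnorm_le. Qed.

Lemma Cmod_RtoC_nonneg (r : R) : 0 <= r -> Cmod (RtoC r) = r.
Proof. intro Hr. rewrite Cmod_R. now apply Rabs_pos_eq. Qed.

Lemma L2norm_le_sup (f : R -> C) (B : R) : Ccontinuous f -> 0 <= B ->
  (forall t, Cmod (f t) <= B) -> L2norm f <= B.
Proof.
  intros Hf HB Hle. rewrite <- (Cmod_RtoC_nonneg B HB) at 1. rewrite <- L2norm_const.
  apply L2norm_le; auto with continuity. intro t. now rewrite Cmod_RtoC_nonneg.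
Qed.

Lemma L2norm_mult_le (f g : R -> C) (B : R) : Ccontinuous f -> Ccontinuous g -> 0 <= B ->
  (forall t, Cmod (f t) <= B) -> L2norm (fun t => f t * g t)%C <= B * L2norm g.
Proof.
  intros Hf Hg HB Hle. rewrite <- (Cmod_RtoC_nonneg B HB) at 1. rewrite <- L2norm_scal by assumption.
  apply L2norm_le; auto with continuity. intro t. rewrite !Cmod_mult, Cmod_RtoC_nonneg by assumption.
  apply Rmult_le_compat_r; [apply Cmod_ge_0 | apply Hle].
Qed.

Lemma Cconj_RtoC (r : R) : Cconj (RtoC r) = RtoC r.
Proof. unfold Cconj, RtoC; simpl. f_equal; ring. Qed.

Lemma discriminant_le (p q s : R) : 0 <= p -> 0 <= q ->
  (forall r, 0 <= p - 2 * r * s + r ^ 2 * s * q) -> s <= p * q.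
Proof.
  intros Hp [Hq | <-] Hr.
  - specialize (Hr (/ q)). replace (p - 2 * / q * s + (/ q) ^ 2 * s * q) with (p - s / q) in Hr
      by (field; lra).
    apply Rmult_le_reg_r with (/ q); [now apply Rinv_0_lt_compat|].
    replace (p * q * / q) with p by (field; lra). unfold Rdiv in Hr. lra.
  - destruct (Rle_lt_dec s 0) as [|Hs]; [lra|].
    specialize (Hr ((p + 1) / (2 * s))).
    replace (2 * ((p + 1) / (2 * s)) * s) with (p + 1) in Hr by (field; lra). lra.
Qed.

Lemma Cauchy_Schwarz (f g : R -> C) : Ccontinuous f -> Ccontinuous g ->
  Cmod (Cmean (fun t => f t * g t)%C) <= L2norm f * L2norm g.
Proof.
  intros Hf Hg. set (w := Cmean _).
  assert (Hw : Cmod w ^ 2 <= sqnorm f * sqnorm g).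
  { apply discriminant_le; auto using sqnorm_ge_0. intro r.
    assert (Hdiff := sqnorm_ge_0 (fun t => f t + (- (r * w)) * Cconj (g t))%C
                       ltac:(auto 6 with continuity)).
    rewrite sqnorm_plus, sqnorm_scal, sqnorm_conj in Hdiff by auto with continuity.
    rewrite (Cmean_ext _ (fun t => (- (r * Cconj w)) * (f t * g t))%C) in Hdiff.
    2:{ intro t. rewrite Cmult_conj, Cconj_conj, Copp_conj, Cmult_conj.
        rewrite Cconj_RtoC. ring. }
    rewrite Cmean_scal in Hdiff by auto with continuity. fold w in Hdiff.
    rewrite Cmod_opp, Cmod_mult, Cmod_R, Rpow_mult_distr, pow2_abs in Hdiff.
    eapply Rle_trans; [exact Hdiff|]. rewrite !Cmod2_alt. right. simpl. ring. }
  unfold L2norm. rewrite <- sqrt_mult by auto using sqnorm_ge_0.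
  rewrite <- (sqrt_pow2 (Cmod w)) by apply Cmod_ge_0. now apply sqrt_le_1_alt.
Qed.

Lemma Cmod_Cmean_le_L2norm (f : R -> C) : Ccontinuous f -> Cmod (Cmean f) <= L2norm f.
Proof.
  intro Hf. assert (HCS := Cauchy_Schwarz (fun _ => RtoC 1) f ltac:(auto with continuity) Hf).
  rewrite L2norm_const, Cmod_1, Rmult_1_l in HCS.
  now rewrite (Cmean_ext _ f) in HCS by (intro; ring).
Qed.

Lemma Cmod_Cmean_le_sup (f : R -> C) (B : R) : Ccontinuous f -> 0 <= B ->
  (forall t, Cmod (f t) <= B) -> Cmod (Cmean f) <= B.
Proof.
  intros Hf HB Hle. eapply Rle_trans; [now apply Cmod_Cmean_le_L2norm | now apply L2norm_le_sup].
Qed.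

Lemma L2norm_triangle (f g : R -> C) : Ccontinuous f -> Ccontinuous g ->
  L2norm (fun t => f t + g t)%C <= L2norm f + L2norm g.
Proof.
  intros Hf Hg. assert (Hf0 := L2norm_ge_0 f). assert (Hg0 := L2norm_ge_0 g).
  apply Rsqr_incr_0_var; [|lra]. rewrite !Rsqr_pow2, L2norm_sqr, sqnorm_plus by auto with continuity.
  assert (HCS := Cauchy_Schwarz f _ Hf (Ccontinuous_conj _ Hg)). rewrite L2norm_conj in HCS.
  assert (Hre := Rle_trans _ _ _ (Rle_abs _) (re_le_Cmod (Cmean (fun t => f t * Cconj (g t))%C))).
  rewrite <- !L2norm_sqr by assumption. nra.
Qed.

(* Both sides are continuous in [f] for the uniform norm. *)
Lemma Cmean_bound_uniform_limit (w f : R -> C) (K : R) : Ccontinuous w -> Ccontinuous f -> 0 <= K ->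
  (forall d, 0 < d -> exists g, Ccontinuous g /\ (forall t, Cmod (f t - g t) <= d) /\
     Cmod (Cmean (fun t => w t * g t)%C) <= K * L2norm g) ->
  Cmod (Cmean (fun t => w t * f t)%C) <= K * L2norm f.
Proof.
  intros Hw Hf HK Happrox. assert (Hw0 := L2norm_ge_0 w). apply le_epsilon. intros eps Heps.
  set (d := eps / (K + L2norm w + 1)).
  assert (Hd : 0 < d) by (apply Rdiv_lt_0_compat; lra).
  assert (Hdeps : (K + L2norm w) * d <= eps).
  { apply Rle_trans with ((K + L2norm w + 1) * d); [nra|]. right. unfold d. field. lra. }
  destruct (Happrox d Hd) as (g & Hg & Hfg & Hgbound).
  assert (Hdiff : L2norm (fun t => f t - g t)%C <= d)
    by (apply L2norm_le_sup; auto with continuity; lra).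
  assert (Hgf : L2norm g <= L2norm f + d).
  { rewrite (L2norm_ext g (fun t => f t + - (f t - g t))%C) by (intro; ring).
    eapply Rle_trans; [apply L2norm_triangle; auto with continuity|]. apply Rplus_le_compat_l.
    apply L2norm_le_sup; auto with continuity; [lra|]. intro t. now rewrite Cmod_opp. }
  assert (HCS := Cauchy_Schwarz w (fun t => f t - g t)%C Hw ltac:(auto with continuity)).
  rewrite (Cmean_ext _ (fun t => w t * g t + w t * (f t - g t))%C) by (intro; ring).
  rewrite Cmean_plus by auto with continuity.
  eapply Rle_trans; [apply Cmod_triangle|]. nra.
Qed.

(** * The complex exponential *)

Definition cexp (s : C) : C := (exp (Re s) * cos (Im s), exp (Re s) * sin (Im s)).

Lemma eith_cexp (t : R) : eith t = cexp (0, t).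
Proof. unfold eith, cexp, Re, Im; simpl. rewrite exp_0. f_equal; ring. Qed.

Lemma cexp_plus (s t : C) : cexp (s + t) = (cexp s * cexp t)%C.
Proof.
  unfold cexp, Cmult, Cplus, Re, Im; simpl. rewrite exp_plus, cos_plus, sin_plus. f_equal; ring.
Qed.

Lemma cexp_0 : cexp 0 = 1.
Proof. unfold cexp; simpl. rewrite exp_0, cos_0, sin_0. unfold RtoC. f_equal; ring. Qed.

Lemma cexp_opp_l (s : C) : (cexp (- s) * cexp s)%C = 1.
Proof. rewrite <- cexp_plus, Cplus_comm, Cplus_opp_r. apply cexp_0. Qed.

Lemma cexp_conj (s : C) : Cconj (cexp s) = cexp (Cconj s).
Proof. unfold cexp, Cconj, Re, Im; simpl. rewrite cos_neg, sin_neg. f_equal; ring. Qed.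

Lemma cexp_INR_mult (n : nat) (s : C) : cexp (RtoC (INR n) * s) = (cexp s ^ n)%C.
Proof.
  induction n as [|n IHn].
  - simpl. now rewrite Cmult_0_l, cexp_0.
  - rewrite S_INR, RtoC_plus, Cpow_S, <- IHn, <- cexp_plus. f_equal. ring.
Qed.

Lemma cexp_RtoC (x : R) : cexp (RtoC x) = RtoC (exp x).
Proof. unfold cexp, RtoC, Re, Im; simpl. rewrite cos_0, sin_0. f_equal; ring. Qed.

Lemma Cmod_eith (t : R) : Cmod (eith t) = 1.
Proof.
  apply Rsqr_inj; [apply Cmod_ge_0 | lra|]. rewrite Rsqr_pow2, Cmod2_alt. unfold eith; simpl.
  rewrite <- (sin2_cos2 t). unfold Rsqr. ring.
Qed.

Lemma cexp_polar (s : C) : cexp s = (RtoC (exp (Re s)) * eith (Im s))%C.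
Proof. unfold cexp, eith, RtoC, Cmult, Re, Im; simpl. f_equal; ring. Qed.

Lemma Cmod_cexp (s : C) : Cmod (cexp s) = exp (Re s).
Proof.
  rewrite cexp_polar, Cmod_mult, Cmod_eith, Cmod_RtoC_nonneg by (left; apply exp_pos). ring.
Qed.

Lemma eith_plus (s t : R) : eith (s + t) = (eith s * eith t)%C.
Proof. unfold eith, Cmult; simpl. rewrite cos_plus, sin_plus. f_equal; ring. Qed.

Lemma eith_conj (t : R) : Cconj (eith t) = eith (- t).
Proof. unfold eith, Cconj; simpl. now rewrite cos_neg, sin_neg. Qed.

Lemma eith_0 : eith 0 = 1.
Proof. unfold eith. now rewrite cos_0, sin_0. Qed.

Lemma eith_conj_mult (t : R) : (Cconj (eith t) * eith t)%C = 1.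
Proof. rewrite eith_conj, <- eith_plus. replace (- t + t) with 0 by ring. apply eith_0. Qed.

Lemma eith_neq_0 (t : R) : eith t <> 0.
Proof. apply Cmod_gt_0. rewrite Cmod_eith. lra. Qed.

Lemma eith_inv (t : R) : (/ eith t)%C = Cconj (eith t).
Proof.
  rewrite <- (Cmult_1_l (/ eith t)%C), <- (eith_conj_mult t). field. apply eith_neq_0.
Qed.

Lemma eith_pow (t : R) (n : nat) : (eith t ^ n)%C = eith (INR n * t).
Proof.
  induction n as [|n IHn].
  - simpl. now rewrite Rmult_0_l, eith_0.
  - rewrite Cpow_S, IHn, <- eith_plus, S_INR. f_equal. ring.
Qed.

Lemma Cmod_eith_pow (t : R) (n : nat) : Cmod (eith t ^ n) = 1.
Proof. rewrite eith_pow. apply Cmod_eith. Qed.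

Lemma eith_2PI : eith (2 * PI) = 1.
Proof. unfold eith. now rewrite cos_2PI, sin_2PI. Qed.

Lemma eith_periodic (t : R) : eith (t + 2 * PI) = eith t.
Proof. rewrite eith_plus, eith_2PI. ring. Qed.

Lemma Ccontinuous_cexp (f : R -> C) : Ccontinuous f -> Ccontinuous (fun t => cexp (f t)).
Proof. intros []; split; simpl; auto with continuity. Qed.

#[local] Hint Resolve Ccontinuous_cexp : continuity.

Lemma exp_le (x y : R) : x <= y -> exp x <= exp y.
Proof. intros [Hlt | ->]; [left; now apply exp_increasing | lra]. Qed.

Lemma exp_INR_mult (n : nat) (x : R) : exp (INR n * x) = exp x ^ n.
Proof.
  induction n as [|n IHn].
  - simpl. now rewrite Rmult_0_l, exp_0.
  - rewrite S_INR, Rmult_plus_distr_r, exp_plus, IHn, Rmult_1_l. simpl. ring.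
Qed.

Lemma im_le_Cmod (z : C) : Rabs (Im z) <= Cmod z.
Proof. eapply Rle_trans; [apply Rmax_r | apply Rmax_Cmod]. Qed.

Lemma Cmod_le_re_im (z : C) : Cmod z <= Rabs (Re z) + Rabs (Im z).
Proof.
  assert (Hre := Rabs_pos (Re z)). assert (Him := Rabs_pos (Im z)).
  apply Rsqr_incr_0_var; [|lra].
  rewrite !Rsqr_pow2, Cmod2_alt, <- (pow2_abs (Re z)), <- (pow2_abs (Im z)).
  nra.
Qed.

Lemma Cmod_cexp_le (s : C) : Cmod (cexp s) <= exp (Cmod s).
Proof. rewrite Cmod_cexp. apply exp_le. eapply Rle_trans; [apply Rle_abs | apply re_le_Cmod]. Qed.

Definition is_Cderive (f : R -> C) (t : R) (d : C) : Prop :=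
  is_derive (fun x => Re (f x)) t (Re d) /\ is_derive (fun x => Im (f x)) t (Im d).

Lemma is_Cderive_ext (f g : R -> C) (t : R) (d : C) :
  (forall x, f x = g x) -> is_Cderive f t d -> is_Cderive g t d.
Proof.
  intros Heq [Hre Him].
  split; [eapply is_derive_ext, Hre | eapply is_derive_ext, Him]; intro x; simpl; now rewrite Heq.
Qed.

Lemma is_Cderive_plus (f g : R -> C) (t : R) (df dg : C) :
  is_Cderive f t df -> is_Cderive g t dg -> is_Cderive (fun x => f x + g x)%C t (df + dg)%C.
Proof.
  intros [Hfre Hfim] [Hgre Hgim]. split.
  - exact (is_derive_plus _ _ t _ _ Hfre Hgre).
  - exact (is_derive_plus _ _ t _ _ Hfim Hgim).
Qed.

Lemma is_Cderive_scal (c : C) (f : R -> C) (t : R) (d : C) :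
  is_Cderive f t d -> is_Cderive (fun x => c * f x)%C t (c * d)%C.
Proof.
  intros [Hre Him]. split.
  - exact (is_derive_minus _ _ t _ _ (is_derive_scal _ t _ _ Hre) (is_derive_scal _ t _ _ Him)).
  - exact (is_derive_plus _ _ t _ _ (is_derive_scal _ t _ _ Him) (is_derive_scal _ t _ _ Hre)).
Qed.

Lemma is_derive_Re (f : R -> C) (t : R) (d : C) :
  is_Cderive f t d -> is_derive (fun x => Re (f x)) t (Re d).
Proof. now intros []. Qed.

Lemma Cmod_increment_le (f df : R -> C) (a b K : R) :
  (forall x, Rmin a b <= x <= Rmax a b -> is_Cderive f x (df x) /\ Cmod (df x) <= K) ->
  Cmod (f b - f a) <= K * Rabs (b - a).
Proof.
  intro Hdf. set (D := (f b - f a)%C).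
  assert (HDf : forall x, Rmin a b <= x <= Rmax a b ->
            is_derive (fun x => Re (Cconj D * f x)) x (Re (Cconj D * df x)))
    by (intros x Hx; now apply is_derive_Re, is_Cderive_scal, Hdf).
  destruct (MVT_gen (fun x => Re (Cconj D * f x)) a b (fun x => Re (Cconj D * df x)))
    as (c & Hc & Hmvt).
  - intros x Hx. apply HDf. lra.
  - intros x Hx. apply continuity_pt_filterlim.
    exact (ex_derive_continuous _ x (ex_intro _ _ (HDf x Hx))).
  - assert (HD : Cmod D ^ 2 = Re (Cconj D * df c) * (b - a)).
    { rewrite <- Hmvt, Cmod2_alt. unfold D. simpl. unfold Re, Im. ring. }
    assert (HK := proj2 (Hdf c Hc)). assert (HD0 := Cmod_ge_0 D). assert (Hab := Rabs_pos (b - a)).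
    assert (Hsqr : Cmod D ^ 2 <= Cmod D * (K * Rabs (b - a))).
    { rewrite HD. eapply Rle_trans; [apply Rle_abs|]. rewrite Rabs_mult, <- Rmult_assoc.
      apply Rmult_le_compat_r; [assumption|]. eapply Rle_trans; [apply re_le_Cmod|].
      rewrite Cmod_mult, Cmod_conj. now apply Rmult_le_compat_l. }
    destruct HD0 as [HD0 | HD0]; [|rewrite <- HD0; assert (HK0 := Cmod_ge_0 (df c)); nra].
    apply Rmult_le_reg_l with (Cmod D); [assumption | simpl in Hsqr; nra].
Qed.

Lemma is_Cderive_eith_mult (x t : R) :
  is_Cderive (fun t => eith (x * t)) t (RtoC x * Ci * eith (x * t))%C.
Proof. split; simpl; auto_derive; auto; unfold Re, Im; simpl; ring. Qed.

Lemma eith_lipschitz (x y : R) : Cmod (eith x - eith y) <= Rabs (x - y).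
Proof.
  rewrite <- (Rmult_1_l (Rabs (x - y))), <- (Rmult_1_l x), <- (Rmult_1_l y) at 1.
  apply (Cmod_increment_le (fun t => eith (1 * t)) (fun t => RtoC 1 * Ci * eith (1 * t))%C y x 1).
  intros t _. split; [apply is_Cderive_eith_mult|].
  rewrite !Cmod_mult, Cmod_1, Cmod_Ci, Cmod_eith. lra.
Qed.

Lemma is_Cderive_cexp_scal (s : C) (x : R) :
  is_Cderive (fun x => cexp (RtoC x * s)) x (s * cexp (RtoC x * s))%C.
Proof. split; unfold Re, Im; simpl; auto_derive; auto; unfold Rminus; ring. Qed.

Lemma cexp_minus_1_le (s : C) : Cmod (cexp s - 1) <= Cmod s * exp (Cmod s).
Proof.
  assert (Hmvt := Cmod_increment_le (fun x => cexp (RtoC x * s)) (fun x => s * cexp (RtoC x * s))%C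
            0 1 (Cmod s * exp (Cmod s))).
  cbv beta in Hmvt. rewrite Cmult_0_l, Cmult_1_l, cexp_0, Rminus_0_r, Rabs_R1, Rmult_1_r in Hmvt.
  apply Hmvt. intros x Hx. rewrite Rmin_left, Rmax_right in Hx by lra.
  split; [apply is_Cderive_cexp_scal|]. rewrite Cmod_mult. apply Rmult_le_compat_l; [apply Cmod_ge_0|].
  eapply Rle_trans; [apply Cmod_cexp_le|]. apply exp_le. rewrite Cmod_mult, Cmod_RtoC_nonneg by lra.
  assert (Hs := Cmod_ge_0 s). nra.
Qed.

Lemma cexp_taylor_le (s : C) : Cmod (cexp s - 1 - s) <= Cmod s ^ 2 * exp (Cmod s).
Proof.
  assert (Hs := Cmod_ge_0 s).
  assert (Hmvt := Cmod_increment_le (fun x => cexp (RtoC x * s) - RtoC x * s)%C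
            (fun x => s * (cexp (RtoC x * s) - 1))%C 0 1 (Cmod s ^ 2 * exp (Cmod s))).
  cbv beta in Hmvt. rewrite Cmult_0_l, Cmult_1_l, cexp_0, Rminus_0_r, Rabs_R1, Rmult_1_r in Hmvt.
  replace (cexp s - 1 - s)%C with (cexp s - s - (1 - 0))%C by ring. apply Hmvt.
  intros x Hx. rewrite Rmin_left, Rmax_right in Hx by lra. split.
  - split; unfold Re, Im; simpl; auto_derive; auto; unfold Rminus; ring.
  - rewrite Cmod_mult. simpl. rewrite Rmult_1_r, Rmult_assoc. apply Rmult_le_compat_l; [assumption|].
    eapply Rle_trans; [apply cexp_minus_1_le|]. rewrite Cmod_mult, Cmod_RtoC_nonneg by lra.
    apply Rmult_le_compat; [nra | left; apply exp_pos | nra | apply exp_le; nra].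
Qed.

Lemma Cmod_pow_diff_le (a b : C) (M : R) (n : nat) : 1 <= M -> Cmod a <= M -> Cmod b <= M ->
  Cmod (a ^ n - b ^ n) <= INR n * Cmod (a - b) * M ^ n.
Proof.
  intros HM Ha Hb. induction n as [|n IHn].
  - simpl. replace (1 - 1)%C with (RtoC 0) by ring. rewrite Cmod_0. lra.
  - rewrite !Cpow_S.
    replace (a * a ^ n - b * b ^ n)%C with (a * (a ^ n - b ^ n) + (a - b) * b ^ n)%C by ring.
    eapply Rle_trans; [apply Cmod_triangle|]. rewrite !Cmod_mult, Cmod_pow, S_INR.
    assert (Hbn : Cmod b ^ n <= M ^ n) by (apply pow_incr; split; auto using Cmod_ge_0).
    assert (HMn : 0 <= M ^ n) by (apply pow_le; lra). assert (Hab := Cmod_ge_0 (a - b)).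
    apply Rle_trans with (M * (INR n * Cmod (a - b) * M ^ n) + Cmod (a - b) * (M * M ^ n)).
    + apply Rplus_le_compat; [apply Rmult_le_compat; auto using Cmod_ge_0|].
      apply Rmult_le_compat_l; nra.
    + simpl. lra.
Qed.

Definition euler (N : nat) (w : C) : C := ((1 + RtoC (/ INR N) * w) ^ N)%C.

Lemma cexp_minus_euler_le (N : nat) (w : C) : (1 <= N)%nat ->
  Cmod (cexp w - euler N w) <= Cmod w ^ 2 * exp (2 * Cmod w) / INR N.
Proof.
  intro HN. assert (HN1 : 1 <= INR N) by (apply le_INR in HN; exact HN).
  set (v := (RtoC (/ INR N) * w)%C).
  assert (Hv : Cmod v = Cmod w / INR N).
  { unfold v. rewrite Cmod_mult, Cmod_RtoC_nonneg; [lra|]. left. apply Rinv_0_lt_compat. lra. }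
  assert (Hvw : Cmod v <= Cmod w).
  { rewrite Hv. apply Rle_div_l; [lra|]. assert (Hw := Cmod_ge_0 w). nra. }
  assert (HNv : INR N * Cmod v = Cmod w) by (rewrite Hv; field; lra).
  replace (cexp w) with (cexp v ^ N)%C.
  2:{ rewrite <- cexp_INR_mult. f_equal. unfold v. rewrite Cmult_assoc, <- RtoC_mult, Rinv_r by lra.
      ring. }
  unfold euler. fold v. eapply Rle_trans; [apply (Cmod_pow_diff_le _ _ (exp (Cmod v)))|].
  - rewrite <- exp_0. apply exp_le, Cmod_ge_0.
  - apply Cmod_cexp_le.
  - eapply Rle_trans; [apply Cmod_triangle|]. rewrite Cmod_1. apply exp_ineq1_le.
  - rewrite <- exp_INR_mult, HNv.
    replace (cexp v - (1 + v))%C with (cexp v - 1 - v)%C by ring.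
    apply Rle_trans with (INR N * (Cmod v ^ 2 * exp (Cmod v)) * exp (Cmod w)).
    + apply Rmult_le_compat_r; [left; apply exp_pos|].
      apply Rmult_le_compat_l; [lra | apply cexp_taylor_le].
    + replace (2 * Cmod w) with (Cmod w + Cmod w) by ring. rewrite exp_plus.
      replace (INR N * (Cmod v ^ 2 * exp (Cmod v)) * exp (Cmod w))
        with (Cmod w ^ 2 / INR N * exp (Cmod w) * exp (Cmod v)) by (rewrite <- HNv; field; lra).
      replace (Cmod w ^ 2 * (exp (Cmod w) * exp (Cmod w)) / INR N)
        with (Cmod w ^ 2 / INR N * exp (Cmod w) * exp (Cmod w)) by (field; lra).
      apply Rmult_le_compat_l; [|now apply exp_le]. apply Rmult_le_pos; [|left; apply exp_pos].
      apply Rdiv_le_0_compat; [apply pow2_ge_0 | lra].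
Qed.

Lemma euler_uniform_limit (B eps : R) : 0 < eps ->
  exists N, forall w, Cmod w <= B -> Cmod (cexp w - euler N w) <= eps.
Proof.
  intro Heps. set (K := B ^ 2 * exp (2 * B)).
  assert (HK : 0 <= K) by (apply Rmult_le_pos; [apply pow2_ge_0 | left; apply exp_pos]).
  destruct (nfloor_ex (K / eps)) as (N & _ & HN); [now apply Rdiv_le_0_compat|].
  exists (S N). intros w Hw. eapply Rle_trans; [apply cexp_minus_euler_le; lia|].
  rewrite <- S_INR in HN. apply Rle_div_l; [apply lt_0_INR; lia|].
  apply Rle_trans with K.
  - assert (Hw0 := Cmod_ge_0 w). apply Rmult_le_compat.
    + apply pow2_ge_0.
    + left; apply exp_pos.
    + now apply pow_incr.
    + apply exp_le. lra.
  - apply Rlt_div_l in HN; [lra | assumption].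
Qed.

(** * Polynomials and Laurent polynomials *)

Inductive polynomial : (C -> C) -> Prop :=
| polynomial_of_const (c : C) (f : C -> C) : (forall z, f z = c) -> polynomial f
| polynomial_of_horner (c : C) (g f : C -> C) :
    polynomial g -> (forall z, f z = c + z * g z)%C -> polynomial f.

Lemma polynomial_const (c : C) : polynomial (fun _ => c).
Proof. now apply (polynomial_of_const c). Qed.

Lemma polynomial_ext (f g : C -> C) : (forall z, f z = g z) -> polynomial f -> polynomial g.
Proof.
  intros Heq Hf. destruct Hf as [c f Hc | c h f Hh Hf].
  - apply (polynomial_of_const c). intro z. now rewrite <- Heq.
  - apply (polynomial_of_horner c h); [assumption|]. intro z. now rewrite <- Heq.
Qed.

Lemma polynomial_div_z (f : C -> C) : polynomial f ->
  exists g, polynomial g /\ forall z, (f z = f 0 + z * g z)%C.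
Proof.
  intros [c h Hc | c g h Hg Hh].
  - exists (fun _ => RtoC 0). split; [apply polynomial_const|]. intro z. rewrite !Hc. ring.
  - exists g. split; [assumption|]. intro z. rewrite (Hh 0), (Hh z). ring.
Qed.

Lemma polynomial_mult_z (f : C -> C) : polynomial f -> polynomial (fun z => z * f z)%C.
Proof. intro Hf. apply (polynomial_of_horner 0 f); [assumption|]. intro z. ring. Qed.

Lemma polynomial_plus (f g : C -> C) :
  polynomial f -> polynomial g -> polynomial (fun z => f z + g z)%C.
Proof.
  intros Hf. revert g. induction Hf as [c f Hc | c h f Hh IHh Hf]; intros g Hg.
  - destruct (polynomial_div_z g Hg) as (k & Hk & Hgk).
    apply (polynomial_of_horner (c + g 0) k); [assumption|]. intro z. rewrite Hc, (Hgk z). ring.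
  - destruct (polynomial_div_z g Hg) as (k & Hk & Hgk).
    apply (polynomial_of_horner (c + g 0) (fun z => h z + k z)%C); [now apply IHh|].
    intro z. rewrite Hf, (Hgk z). ring.
Qed.

Lemma polynomial_scal (c : C) (f : C -> C) : polynomial f -> polynomial (fun z => c * f z)%C.
Proof.
  induction 1 as [d f Hd | d h f Hh IHh Hf].
  - apply (polynomial_of_const (c * d)). intro z. now rewrite Hd.
  - apply (polynomial_of_horner (c * d) (fun z => c * h z)%C); [assumption|].
    intro z. rewrite Hf. ring.
Qed.

Lemma polynomial_mult (f g : C -> C) :
  polynomial f -> polynomial g -> polynomial (fun z => f z * g z)%C.
Proof.
  intros Hf Hg. induction Hf as [c f Hc | c h f Hh IHh Hf].
  - apply (polynomial_ext (fun z => c * g z)%C); [intro z; now rewrite Hc | now apply polynomial_scal].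
  - apply (polynomial_ext (fun z => c * g z + z * (h z * g z))%C); [intro z; rewrite Hf; ring|].
    apply polynomial_plus; [now apply polynomial_scal | now apply polynomial_mult_z].
Qed.

Lemma polynomial_pow (f : C -> C) (n : nat) : polynomial f -> polynomial (fun z => f z ^ n)%C.
Proof.
  intro Hf. induction n as [|n IHn]; [exact (polynomial_const 1) | exact (polynomial_mult f _ Hf IHn)].
Qed.

Lemma polynomial_id : polynomial (fun z => z).
Proof.
  apply (polynomial_of_horner 0 (fun _ => RtoC 1)); [apply polynomial_const | intro z; ring].
Qed.

Lemma polynomial_monomial (n : nat) : polynomial (fun z => z ^ n)%C.
Proof. exact (polynomial_pow (fun z => z) n polynomial_id). Qed.

Lemma polynomial_conj (f : C -> C) : polynomial f -> polynomial (fun z => Cconj (f (Cconj z))).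
Proof.
  induction 1 as [c f Hc | c h f Hh IHh Hf].
  - apply (polynomial_of_const (Cconj c)). intro z. now rewrite Hc.
  - apply (polynomial_of_horner (Cconj c) (fun z => Cconj (h (Cconj z)))); [assumption|].
    intro z. now rewrite Hf, Cplus_conj, Cmult_conj, Cconj_conj.
Qed.

Lemma polynomial_peval (c : nat -> C) (d : nat) : polynomial (peval c d).
Proof.
  induction d as [|d IHd]; [exact (polynomial_const (c 0%nat))|].
  exact (polynomial_plus _ _ IHd (polynomial_scal _ _ (polynomial_monomial (S d)))).
Qed.

Lemma peval_S (c : nat -> C) (d : nat) (z : C) :
  peval c (S d) z = (peval c d z + c (S d) * z ^ S d)%C.
Proof. reflexivity. Qed.

Lemma peval_horner (c : nat -> C) (d : nat) (z : C) :
  peval c (S d) z = (c 0%nat + z * peval (fun j => c (S j)) d z)%C.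
Proof.
  induction d as [|d IHd]; [simpl; ring|].
  rewrite (peval_S c (S d)), IHd, (peval_S (fun j => c (S j)) d), (Cpow_S z (S d)). ring.
Qed.

Lemma peval_ext (b c : nat -> C) (d : nat) (z : C) :
  (forall j, (j <= d)%nat -> b j = c j) -> peval b d z = peval c d z.
Proof.
  induction d as [|d IHd]; intro Heq; [now apply Heq|].
  rewrite !peval_S, IHd, Heq; auto.
Qed.

Lemma peval_plus (b c : nat -> C) (d : nat) (z : C) :
  peval (fun j => b j + c j)%C d z = (peval b d z + peval c d z)%C.
Proof. induction d as [|d IHd]; [reflexivity | rewrite !peval_S, IHd; ring]. Qed.

Lemma peval_scal (a : C) (c : nat -> C) (d : nat) (z : C) :
  peval (fun j => a * c j)%C d z = (a * peval c d z)%C.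
Proof. induction d as [|d IHd]; [reflexivity | rewrite !peval_S, IHd; ring]. Qed.

Lemma peval_dilate (r : C) (c : nat -> C) (d : nat) (z : C) :
  peval c d (r * z) = peval (fun j => r ^ j * c j)%C d z.
Proof.
  induction d as [|d IHd]; [simpl; ring|].
  rewrite !peval_S, IHd, Cpow_mult_l. ring.
Qed.

Lemma Cmod_peval_le (c : nat -> C) (d : nat) (t : R) :
  Cmod (peval c d (eith t)) <= sum_f_R0 (fun j => Cmod (c j)) d.
Proof.
  induction d as [|d IHd]; [simpl; lra|].
  rewrite peval_S, tech5. eapply Rle_trans; [apply Cmod_triangle|].
  rewrite Cmod_mult, Cmod_eith_pow. lra.
Qed.

Lemma polynomial_split (f : C -> C) (d : nat) : polynomial f ->
  exists c g, polynomial g /\ forall z, (f z = peval c d z + z ^ S d * g z)%C.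
Proof.
  intro Hf. induction d as [|d IHd].
  - destruct (polynomial_div_z f Hf) as (g & Hg & Hfg). exists (fun _ => f 0), g.
    split; [assumption|]. intro z. rewrite (Hfg z). simpl. ring.
  - destruct IHd as (c & g & Hg & Hfg). destruct (polynomial_div_z g Hg) as (h & Hh & Hgh).
    exists (fun j => if Nat.eqb j (S d) then g 0 else c j), h. split; [assumption|].
    intro z. rewrite peval_S, Nat.eqb_refl, (peval_ext _ c).
    + rewrite Hfg, (Hgh z), !(Cpow_S z). ring.
    + intros j Hj. destruct (Nat.eqb_spec j (S d)); [lia | reflexivity].
Qed.

Lemma eith_pow_mult_conj_peval (c : nat -> C) (d : nat) (t : R) :
  (eith t ^ d * Cconj (peval c d (eith t)))%C =
  peval (fun j => Cconj (c (d - j)%nat)) d (eith t).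
Proof.
  induction d as [|d IHd]; [simpl; ring|].
  rewrite (peval_S c), (peval_horner (fun j => Cconj (c (S d - j)%nat))).
  rewrite Cplus_conj, Cmult_conj, Cpow_conj. cbn [Nat.sub].
  rewrite <- IHd, Cmult_plus_distr_l, Cpow_S.
  replace (eith t * eith t ^ d * (Cconj (c (S d)) * Cconj (eith t) ^ S d))%C
    with (Cconj (c (S d)) * (Cconj (eith t) * eith t) ^ S d)%C
    by (rewrite Cpow_mult_l, !Cpow_S; ring).
  rewrite eith_conj_mult, Cpow_1_l. ring.
Qed.

Definition laurent (f : C -> C) : Prop :=
  exists p q, polynomial p /\ polynomial q /\ forall z : C, z <> 0 -> (f z = p z + q (/ z))%C.

Lemma laurent_polynomial (f : C -> C) : polynomial f -> laurent f.
Proof.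
  intro Hf. exists f, (fun _ => RtoC 0). split; [assumption|]. split; [apply polynomial_const|].
  intros z _. ring.
Qed.

Lemma laurent_polynomial_inv (f : C -> C) : polynomial f -> laurent (fun z => f (/ z)%C).
Proof.
  intro Hf. exists (fun _ => RtoC 0), f. split; [apply polynomial_const|]. split; [assumption|].
  intros z _. ring.
Qed.

Lemma laurent_ext (f g : C -> C) : (forall z : C, z <> 0 -> f z = g z) -> laurent f -> laurent g.
Proof.
  intros Heq (p & q & Hp & Hq & Hf). exists p, q. split; [assumption|]. split; [assumption|].
  intros z Hz. now rewrite <- Heq, Hf.
Qed.

Lemma laurent_plus (f g : C -> C) : laurent f -> laurent g -> laurent (fun z => f z + g z)%C.
Proof.
  intros (p & q & Hp & Hq & Hf) (p' & q' & Hp' & Hq' & Hg).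
  exists (fun z => p z + p' z)%C, (fun z => q z + q' z)%C.
  split; [now apply polynomial_plus|]. split; [now apply polynomial_plus|].
  intros z Hz. rewrite Hf, Hg by assumption. ring.
Qed.

Lemma laurent_polynomial_mult_inv (f g : C -> C) : polynomial f -> polynomial g ->
  laurent (fun z => f z * g (/ z))%C.
Proof.
  intro Hf. revert g. induction Hf as [c f Hc | c h f Hh IHh Hf]; intros g Hg.
  - apply (laurent_ext (fun z => c * g (/ z))%C); [intros z _; now rewrite Hc|].
    exact (laurent_polynomial_inv _ (polynomial_scal c g Hg)).
  - destruct (polynomial_div_z g Hg) as (k & Hk & Hgk).
    apply (laurent_ext (fun z => c * g (/ z) + (g 0 * (z * h z) + h z * k (/ z)))%C).
    + intros z Hz. rewrite Hf, (Hgk (/ z)%C). field. assumption.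
    + apply laurent_plus; [exact (laurent_polynomial_inv _ (polynomial_scal c g Hg))|].
      apply laurent_plus; [|now apply IHh].
      now apply laurent_polynomial, polynomial_scal, polynomial_mult_z.
Qed.

Lemma laurent_mult (f g : C -> C) : laurent f -> laurent g -> laurent (fun z => f z * g z)%C.
Proof.
  intros (p & q & Hp & Hq & Hf) (p' & q' & Hp' & Hq' & Hg).
  apply (laurent_ext (fun z => p z * p' z + p z * q' (/ z) + (p' z * q (/ z) + q (/ z) * q' (/ z)))%C).
  - intros z Hz. rewrite Hf, Hg by assumption. ring.
  - apply laurent_plus; apply laurent_plus.
    + now apply laurent_polynomial, polynomial_mult.
    + now apply laurent_polynomial_mult_inv.
    + now apply laurent_polynomial_mult_inv.
    + exact (laurent_polynomial_inv _ (polynomial_mult q q' Hq Hq')).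
Qed.

Lemma laurent_pow (f : C -> C) (n : nat) : laurent f -> laurent (fun z => f z ^ n)%C.
Proof.
  intro Hf. induction n as [|n IHn]; [|exact (laurent_mult f _ Hf IHn)].
  exact (laurent_polynomial _ (polynomial_const 1)).
Qed.

Lemma polynomial_mult_conj_split (p q : C -> C) : polynomial p -> polynomial q ->
  exists a b, polynomial a /\ polynomial b /\
  forall t, (p (eith t) * Cconj (q (eith t)) = Cconj (eith t * a (eith t)) + b (eith t))%C.
Proof.
  intros Hp Hq.
  destruct (laurent_polynomial_mult_inv p _ Hp (polynomial_conj q Hq)) as (b & r & Hb & Hr & Heq).
  destruct (polynomial_div_z r Hr) as (a & Ha & Hra).
  exists (fun z => Cconj (a (Cconj z))), (fun z => r 0 + b z)%C. split; [now apply polynomial_conj|].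
  split.
  - now apply polynomial_plus; [apply polynomial_const|].
  - intro t. specialize (Heq (eith t) (eith_neq_0 t)). rewrite eith_inv, Cconj_conj in Heq.
    rewrite Heq, (Hra (Cconj (eith t))), Cmult_conj, Cconj_conj. ring.
Qed.

(** * Means of polynomials over circles *)

Lemma Ccontinuous_polynomial (f : C -> C) (u : R -> C) :
  polynomial f -> Ccontinuous u -> Ccontinuous (fun t => f (u t)).
Proof.
  intros Hf Hu. induction Hf as [c f Hc | c h f Hh IHh Hf].
  - apply (Ccontinuous_ext (fun _ => c)); [intro t; now rewrite Hc | auto with continuity].
  - apply (Ccontinuous_ext (fun t => c + u t * h (u t))%C);
      [intro t; now rewrite Hf | auto with continuity].
Qed.

Lemma Ccontinuous_polynomial_circle (f : C -> C) (r : R) :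
  polynomial f -> Ccontinuous (fun t => f (RtoC r * eith t)%C).
Proof. intro Hf. apply (Ccontinuous_polynomial f _ Hf). auto with continuity. Qed.

Lemma Ccontinuous_polynomial_eith (f : C -> C) :
  polynomial f -> Ccontinuous (fun t => f (eith t)).
Proof. intro Hf. apply (Ccontinuous_polynomial f _ Hf). auto with continuity. Qed.

#[local] Hint Resolve Ccontinuous_polynomial_circle Ccontinuous_polynomial_eith polynomial_peval
  : continuity.

Lemma Cmean_eith (x : R) : x <> 0 -> sin (x * PI) = 0 -> Cmean (fun t => eith (x * t)) = 0.
Proof.
  intros Hx Hsin. rewrite Cmean_pair. unfold Rmean, RtoC. f_equal; apply Rmult_eq_0_compat_l; simpl.
  - rewrite (is_RInt_unique _ _ _ (minus (sin (x * PI) / x) (sin (x * - PI) / x))).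
    + rewrite <- Ropp_mult_distr_r, sin_neg, Hsin. unfold minus, plus, opp; simpl. field. assumption.
    + apply (is_RInt_derive (fun t => sin (x * t) / x)).
      * intros t _. auto_derive; auto. field. assumption.
      * intros t _. apply Rcontinuous_cos. auto with continuity.
  - rewrite (is_RInt_unique _ _ _ (minus (- cos (x * PI) / x) (- cos (x * - PI) / x))).
    + rewrite <- Ropp_mult_distr_r, cos_neg. unfold minus, plus, opp; simpl. field. assumption.
    + apply (is_RInt_derive (fun t => - cos (x * t) / x)).
      * intros t _. auto_derive; auto. field. assumption.
      * intros t _. apply Rcontinuous_sin. auto with continuity.
Qed.

Lemma sin_INR_PI (n : nat) : sin (INR n * PI) = 0.
Proof. apply sin_eq_0_1. exists (Z.of_nat n). now rewrite INR_IZR_INZ. Qed.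

Lemma Cmean_circle_pow (r : R) (n : nat) : Cmean (fun t => (RtoC r * eith t) ^ n)%C = (0 ^ n)%C.
Proof.
  destruct n as [|n]; [exact (Cmean_const 1)|].
  rewrite (Cmean_ext _ (fun t => RtoC r ^ S n * eith (INR (S n) * t))%C)
    by (intro t; now rewrite Cpow_mult_l, eith_pow).
  rewrite Cmean_scal, Cmean_eith by auto using not_0_INR, sin_INR_PI with continuity.
  rewrite (Cpow_S 0). ring.
Qed.

Lemma Cmean_circle_polynomial (f : C -> C) (r : R) :
  polynomial f -> Cmean (fun t => f (RtoC r * eith t)%C) = f 0.
Proof.
  intro Hf.
  enough (Hpow : forall n,
    Cmean (fun t => (RtoC r * eith t) ^ n * f (RtoC r * eith t))%C = (0 ^ n * f 0)%C).
  { specialize (Hpow 0%nat). simpl in Hpow. rewrite Cmult_1_l in Hpow. rewrite <- Hpow.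
    apply Cmean_ext. intro t. ring. }
  induction Hf as [c f Hc | c h f Hh IHh Hf]; intro n.
  - rewrite (Cmean_ext _ (fun t => c * (RtoC r * eith t) ^ n)%C) by (intro t; rewrite Hc; ring).
    rewrite Cmean_scal, Cmean_circle_pow, Hc by auto with continuity. ring.
  - rewrite (Cmean_ext _ (fun t => c * (RtoC r * eith t) ^ n
                             + (RtoC r * eith t) ^ S n * h (RtoC r * eith t))%C).
    2:{ intro t. rewrite Hf, Cpow_S. ring. }
    rewrite Cmean_plus, Cmean_scal, Cmean_circle_pow, IHh, Hf, Cpow_S by auto 6 with continuity. ring.
Qed.

Lemma Cmean_polynomial (f : C -> C) : polynomial f -> Cmean (fun t => f (eith t)) = f 0.
Proof.
  intro Hf. rewrite <- (Cmean_circle_polynomial f 1 Hf). apply Cmean_ext. intro t.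
  now rewrite Cmult_1_l.
Qed.

Lemma circle_neq_0 (r t : R) : r <> 0 -> (RtoC r * eith t)%C <> 0.
Proof.
  intros Hr. apply Cmult_neq_0; [|apply eith_neq_0]. intro Hr0. now apply RtoC_inj in Hr0.
Qed.

Lemma circle_inv (r t : R) : r <> 0 -> (/ (RtoC r * eith t))%C = Cconj (RtoC (/ r) * eith t).
Proof.
  intro Hr. rewrite Cmult_conj, Cconj_RtoC, <- eith_inv, RtoC_inv by assumption.
  field. split; [apply eith_neq_0 | intro Hr0; now apply RtoC_inj in Hr0].
Qed.

Lemma laurent_circle (f : C -> C) : laurent f -> exists p q, polynomial p /\ polynomial q /\
  forall r t, r <> 0 -> f (RtoC r * eith t)%C =
    (p (RtoC r * eith t) + Cconj (q (RtoC (/ r) * eith t)))%C.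
Proof.
  intros (p & q & Hp & Hq & Hf). exists p, (fun z => Cconj (q (Cconj z))).
  split; [assumption|]. split; [now apply polynomial_conj|]. intros r t Hr.
  now rewrite Hf, circle_inv, Cconj_conj by auto using circle_neq_0.
Qed.

Lemma Ccontinuous_laurent (f : C -> C) (r : R) : r <> 0 -> laurent f ->
  Ccontinuous (fun t => f (RtoC r * eith t)%C).
Proof.
  intros Hr Hf. destruct (laurent_circle f Hf) as (p & q & Hp & Hq & Hpq).
  apply (Ccontinuous_ext _ _ (fun t => eq_sym (Hpq r t Hr))). auto with continuity.
Qed.

Lemma Cmean_circle_laurent (f : C -> C) (r : R) : r <> 0 -> laurent f ->
  Cmean (fun t => f (RtoC r * eith t)%C) = Cmean (fun t => f (eith t)).
Proof.
  intros Hr Hf. destruct (laurent_circle f Hf) as (p & q & Hp & Hq & Hpq).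
  assert (Hvalue : forall s, s <> 0 -> Cmean (fun t => f (RtoC s * eith t)%C) = (p 0 + Cconj (q 0))%C).
  { intros s Hs. rewrite (Cmean_ext _ _ (fun t => Hpq s t Hs)).
    now rewrite Cmean_plus, Cmean_conj, !Cmean_circle_polynomial by auto with continuity. }
  rewrite Hvalue, <- (Hvalue 1) by (assumption || lra). apply Cmean_ext. intro t. now rewrite Cmult_1_l.
Qed.

Lemma sqnorm_circle_horner (c : C) (g : C -> C) (r : R) : polynomial g ->
  sqnorm (fun t => c + (RtoC r * eith t) * g (RtoC r * eith t))%C =
  Cmod c ^ 2 + r ^ 2 * sqnorm (fun t => g (RtoC r * eith t)%C).
Proof.
  intro Hg. rewrite sqnorm_plus by auto with continuity.
  assert (Hzg := polynomial_mult_z g Hg).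
  rewrite Cmean_scal, Cmean_conj by auto with continuity.
  rewrite (Cmean_circle_polynomial (fun z => z * g z)%C r Hzg), Cmult_0_l, Cconj_RtoC, Cmult_0_r.
  rewrite (sqnorm_ext (fun t => _ * _)%C (fun t => RtoC r * (eith t * g (RtoC r * eith t)))%C)
    by (intro; ring).
  rewrite sqnorm_scal, sqnorm_unimodular by auto using Cmod_eith with continuity.
  unfold sqnorm at 1. rewrite Rmean_const, Cmod_R, pow2_abs. simpl. ring.
Qed.

Lemma L2norm_circle_le (f : C -> C) (r : R) : polynomial f -> 0 <= r <= 1 ->
  L2norm (fun t => f (RtoC r * eith t)%C) <= L2norm (fun t => f (eith t)).
Proof.
  intros Hf Hr. apply sqrt_le_1_alt.
  rewrite (sqnorm_ext (fun t => f (eith t)) (fun t => f (RtoC 1 * eith t)%C))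
    by (intro t; now rewrite Cmult_1_l).
  induction Hf as [c f Hc | c h f Hh IHh Hf].
  - right. apply Rmean_ext. intro t. now rewrite !Hc.
  - rewrite !(sqnorm_ext _ _ (fun t => Hf _)), !sqnorm_circle_horner by assumption.
    assert (Hh0 : 0 <= sqnorm (fun t => h (RtoC r * eith t)%C))
      by (apply sqnorm_ge_0; auto with continuity).
    assert (Hr2 : r ^ 2 <= 1) by nra. nra.
Qed.

Lemma sqnorm_peval (c : nat -> C) (d : nat) :
  sqnorm (fun t => peval c d (eith t)) = sum_f_R0 (fun j => Cmod (c j) ^ 2) d.
Proof.
  revert c. induction d as [|d IHd]; intro c; [exact (Rmean_const (Cmod (c 0%nat) ^ 2))|].
  rewrite decomp_sum by lia. cbn [pred]. rewrite <- IHd.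
  rewrite (sqnorm_ext _ (fun t => c 0%nat
             + (RtoC 1 * eith t) * peval (fun j => c (S j)) d (RtoC 1 * eith t))%C)
    by (intro t; now rewrite peval_horner, Cmult_1_l).
  rewrite sqnorm_circle_horner by apply polynomial_peval.
  rewrite (sqnorm_ext _ (fun t => peval (fun j => c (S j)) d (eith t)))
    by (intro t; now rewrite Cmult_1_l).
  ring.
Qed.

(** * The contour shift *)

Definition Cbounded (f : R -> C) : Prop := exists B, forall t, Cmod (f t) <= B.

Lemma Cbounded_polynomial_circle (f : C -> C) (r : R) :
  polynomial f -> Cbounded (fun t => f (RtoC r * eith t)%C).
Proof.
  induction 1 as [c f Hc | c h f Hh [B HB] Hf].
  - exists (Cmod c). intro t. rewrite Hc. lra.
  - exists (Cmod c + Rabs r * B). intro t. rewrite Hf. eapply Rle_trans; [apply Cmod_triangle|].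
    rewrite !Cmod_mult, Cmod_R, Cmod_eith, Rmult_1_r. apply Rplus_le_compat_l, Rmult_le_compat_l, HB.
    apply Rabs_pos.
Qed.

Lemma Cbounded_polynomial (f : C -> C) : polynomial f -> Cbounded (fun t => f (eith t)).
Proof.
  intro Hf. destruct (Cbounded_polynomial_circle f 1 Hf) as [B HB].
  exists B. intro t. rewrite <- (Cmult_1_l (eith t)). apply HB.
Qed.

Lemma Cbounded_laurent (f : C -> C) (r : R) : r <> 0 -> laurent f ->
  Cbounded (fun t => f (RtoC r * eith t)%C).
Proof.
  intros Hr Hf. destruct (laurent_circle f Hf) as (p & q & Hp & Hq & Hpq).
  destruct (Cbounded_polynomial_circle p r Hp) as [B HB].
  destruct (Cbounded_polynomial_circle q (/ r) Hq) as [D HD].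
  exists (B + D). intro t. rewrite Hpq by assumption.
  eapply Rle_trans; [apply Cmod_triangle|]. rewrite Cmod_conj. specialize (HB t). specialize (HD t).
  lra.
Qed.

Lemma Ceq_of_Cmod_minus_le (a b : C) (K : R) :
  (forall eps, 0 < eps -> Cmod (a - b) <= K * eps) -> a = b.
Proof.
  intro Hle. replace a with (a - b + b)%C by ring. rewrite (Cmod_eq_0 (a - b)); [ring|].
  apply Rle_antisym; [|apply Cmod_ge_0]. apply le_epsilon. intros eps Heps. rewrite Rplus_0_l.
  assert (HK := Rabs_pos K). assert (HK' := Rle_abs K).
  eapply Rle_trans; [apply (Hle (eps / (Rabs K + 1))); apply Rdiv_lt_0_compat; lra|].
  assert (Hd : 0 < eps / (Rabs K + 1)) by (apply Rdiv_lt_0_compat; lra).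
  apply Rle_trans with ((Rabs K + 1) * (eps / (Rabs K + 1))); [nra | right; field; lra].
Qed.

Lemma Cmod_Cmean_cexp_minus_euler_le (W h : R -> C) (N : nat) (D eps : R) :
  Ccontinuous W -> Ccontinuous h -> (forall t, Cmod (h t) <= D) ->
  (forall t, Cmod (cexp (W t) - euler N (W t)) <= eps) ->
  Cmod (Cmean (fun t => cexp (W t) * h t)%C - Cmean (fun t => euler N (W t) * h t)%C) <= eps * D.
Proof.
  intros HW Hh HD Heps. unfold euler in *.
  rewrite <- Cmean_minus by auto 6 with continuity.
  assert (Hle : forall t, Cmod (cexp (W t) * h t - (1 + RtoC (/ INR N) * W t) ^ N * h t) <= eps * D).
  { intro t.
    replace (cexp (W t) * h t - (1 + RtoC (/ INR N) * W t) ^ N * h t)%C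
      with ((cexp (W t) - (1 + RtoC (/ INR N) * W t) ^ N) * h t)%C by ring.
    rewrite Cmod_mult. apply Rmult_le_compat; auto using Cmod_ge_0. }
  apply Cmod_Cmean_le_sup; [auto 7 with continuity | | exact Hle].
  eapply Rle_trans; [apply Cmod_ge_0 | apply (Hle 0)].
Qed.

(* Both sides are limits of means of the Laurent polynomials [euler N W * h]. *)
Lemma Cmean_circle_cexp_laurent (W h : C -> C) (r : R) : r <> 0 -> laurent W -> laurent h ->
  Cmean (fun t => cexp (W (RtoC r * eith t)) * h (RtoC r * eith t))%C =
  Cmean (fun t => cexp (W (eith t)) * h (eith t))%C.
Proof.
  intros Hr HW Hh.
  rewrite (Cmean_ext (fun t => cexp (W (eith t)) * h (eith t))%C
             (fun t => cexp (W (RtoC 1 * eith t)) * h (RtoC 1 * eith t))%C)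
    by (intro t; now rewrite Cmult_1_l).
  destruct (Cbounded_laurent W r Hr HW) as [Br HBr].
  destruct (Cbounded_laurent W 1 R1_neq_R0 HW) as [B1 HB1].
  destruct (Cbounded_laurent h r Hr Hh) as [Dr HDr].
  destruct (Cbounded_laurent h 1 R1_neq_R0 Hh) as [D1 HD1].
  apply (Ceq_of_Cmod_minus_le _ _ (Dr + D1)). intros eps Heps.
  destruct (euler_uniform_limit (Rmax Br B1) eps Heps) as [N HN].
  assert (Hlaurent : laurent (fun z => euler N (W z) * h z)%C).
  { apply laurent_mult; [|assumption]. apply (laurent_pow (fun z => 1 + RtoC (/ INR N) * W z)%C).
    apply laurent_plus; [apply laurent_polynomial, polynomial_const|].
    exact (laurent_mult _ _ (laurent_polynomial _ (polynomial_const (RtoC (/ INR N)))) HW). }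
  assert (Hdr := Cmod_Cmean_cexp_minus_euler_le _ _ N Dr eps
            (Ccontinuous_laurent W r Hr HW) (Ccontinuous_laurent h r Hr Hh) HDr
            (fun t => HN _ (Rle_trans _ _ _ (HBr t) (Rmax_l _ _)))).
  assert (Hd1 := Cmod_Cmean_cexp_minus_euler_le _ _ N D1 eps
            (Ccontinuous_laurent W 1 R1_neq_R0 HW) (Ccontinuous_laurent h 1 R1_neq_R0 Hh) HD1
            (fun t => HN _ (Rle_trans _ _ _ (HB1 t) (Rmax_r _ _)))).
  cbv beta in Hdr, Hd1.
  rewrite (Cmean_circle_laurent _ r Hr Hlaurent) in Hdr.
  rewrite (Cmean_circle_laurent _ 1 R1_neq_R0 Hlaurent) in Hd1.
  set (m := Cmean (fun t => euler N (W (eith t)) * h (eith t))%C) in *.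
  match goal with |- Cmod (?a - ?b) <= _ => replace (a - b)%C with (a - m + - (b - m))%C by ring end.
  eapply Rle_trans; [apply Cmod_triangle|]. rewrite Cmod_opp. lra.
Qed.

(** * The disc algebra *)

(* Boundary values of the functions that are continuous on the closed disc and analytic inside. *)
Definition disc_algebra (f : R -> C) : Prop := forall eps, 0 < eps ->
  exists p, polynomial p /\ forall t, Cmod (f t - p (eith t)) <= eps.

Lemma Rcontinuous_uniform_limit (f : R -> R) :
  (forall eps, 0 < eps -> exists g, Rcontinuous g /\ forall t, Rabs (f t - g t) <= eps) ->
  Rcontinuous f.
Proof.
  intros Hlim t. apply filterlim_locally. intro eps. assert (Heps := cond_pos eps).
  destruct (Hlim (eps / 4) ltac:(lra)) as (g & Hg & Hfg).
  assert (Heps4 : 0 < eps / 4) by lra.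
  apply (filter_imp (fun y => Rabs (g y - g t) < eps / 4)).
  - intros y Hy. change (Rabs (f y - f t) < eps).
    replace (f y - f t) with ((f y - g y) + (g y - g t) + - (f t - g t)) by ring.
    eapply Rle_lt_trans; [apply Rabs_triang|].
    eapply Rle_lt_trans; [apply Rplus_le_compat_r, Rabs_triang|]. rewrite Rabs_Ropp.
    assert (Hy' := Hfg y). assert (Ht := Hfg t). lra.
  - exact (proj1 (filterlim_locally g (g t)) (Hg t) (mkposreal _ Heps4)).
Qed.

Lemma disc_algebra_Ccontinuous (f : R -> C) : disc_algebra f -> Ccontinuous f.
Proof.
  intro Hf. split; apply Rcontinuous_uniform_limit; intros eps Heps;
    destruct (Hf eps Heps) as (p & Hp & Hfp).
  - exists (fun t => Re (p (eith t))). split; [auto with continuity|]. intro t.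
    eapply Rle_trans; [|apply (Hfp t)]. exact (re_le_Cmod (f t - p (eith t))).
  - exists (fun t => Im (p (eith t))). split; [auto with continuity|]. intro t.
    eapply Rle_trans; [|apply (Hfp t)]. exact (im_le_Cmod (f t - p (eith t))).
Qed.

#[local] Hint Resolve disc_algebra_Ccontinuous : continuity.

Lemma disc_algebra_Cbounded (f : R -> C) : disc_algebra f -> Cbounded f.
Proof.
  intro Hf. destruct (Hf 1 Rlt_0_1) as (p & Hp & Hfp).
  destruct (Cbounded_polynomial p Hp) as [B HB]. exists (1 + B). intro t.
  replace (f t) with (f t - p (eith t) + p (eith t))%C by ring.
  eapply Rle_trans; [apply Cmod_triangle|]. now apply Rplus_le_compat.
Qed.

Lemma disc_algebra_ext (f g : R -> C) : (forall t, f t = g t) -> disc_algebra f -> disc_algebra g.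
Proof.
  intros Heq Hf eps Heps. destruct (Hf eps Heps) as (p & Hp & Hfp).
  exists p. split; [assumption|]. intro t. now rewrite <- Heq.
Qed.

Lemma disc_algebra_uniform_limit (f : R -> C) :
  (forall eps, 0 < eps -> exists g, disc_algebra g /\ forall t, Cmod (f t - g t) <= eps) ->
  disc_algebra f.
Proof.
  intros Hlim eps Heps. destruct (Hlim (eps / 2) ltac:(lra)) as (g & Hg & Hfg).
  destruct (Hg (eps / 2) ltac:(lra)) as (p & Hp & Hgp). exists p. split; [assumption|]. intro t.
  replace (f t - p (eith t))%C with (f t - g t + (g t - p (eith t)))%C by ring.
  eapply Rle_trans; [apply Cmod_triangle|]. specialize (Hfg t). specialize (Hgp t). lra.
Qed.

Lemma disc_algebra_polynomial (p : C -> C) : polynomial p -> disc_algebra (fun t => p (eith t)).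
Proof.
  intros Hp eps Heps. exists p. split; [assumption|]. intro t.
  replace (p (eith t) - p (eith t))%C with (RtoC 0) by ring. rewrite Cmod_0. lra.
Qed.

Lemma disc_algebra_const (c : C) : disc_algebra (fun _ => c).
Proof. exact (disc_algebra_polynomial _ (polynomial_const c)). Qed.

Lemma disc_algebra_plus (f g : R -> C) :
  disc_algebra f -> disc_algebra g -> disc_algebra (fun t => f t + g t)%C.
Proof.
  intros Hf Hg eps Heps. destruct (Hf (eps / 2) ltac:(lra)) as (p & Hp & Hfp).
  destruct (Hg (eps / 2) ltac:(lra)) as (q & Hq & Hgq).
  exists (fun z => p z + q z)%C. split; [now apply polynomial_plus|]. intro t.
  replace (f t + g t - (p (eith t) + q (eith t)))%C
    with (f t - p (eith t) + (g t - q (eith t)))%C by ring.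
  eapply Rle_trans; [apply Cmod_triangle|]. specialize (Hfp t). specialize (Hgq t). lra.
Qed.

Lemma Cmod_mult_minus_le (a b a' b' : C) (A B d : R) :
  Cmod a <= A -> Cmod b <= B -> d <= 1 -> Cmod (a - a') <= d -> Cmod (b - b') <= d ->
  Cmod (a * b - a' * b') <= (A + B + 1) * d.
Proof.
  intros HA HB Hd Ha Hb.
  replace (a * b - a' * b')%C with (a * (b - b') + b * (a - a') + - ((a - a') * (b - b')))%C by ring.
  eapply Rle_trans; [apply Cmod_triangle|]. rewrite Cmod_opp, Cmod_mult.
  eapply Rle_trans; [apply Rplus_le_compat_r, Cmod_triangle|]. rewrite !Cmod_mult.
  assert (Ha0 := Cmod_ge_0 a). assert (Hb0 := Cmod_ge_0 b).
  assert (Hda0 := Cmod_ge_0 (a - a')). assert (Hdb0 := Cmod_ge_0 (b - b')).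
  assert (Hab : Cmod a * Cmod (b - b') <= A * d) by (apply Rmult_le_compat; lra).
  assert (Hba : Cmod b * Cmod (a - a') <= B * d) by (apply Rmult_le_compat; lra).
  assert (Hdd : Cmod (a - a') * Cmod (b - b') <= 1 * d) by (apply Rmult_le_compat; lra).
  lra.
Qed.

Lemma disc_algebra_approx_mult (f g : R -> C) (eps : R) : disc_algebra f -> disc_algebra g -> 0 < eps ->
  exists p q, polynomial p /\ polynomial q /\
  (forall t, Cmod (f t - p (eith t)) <= eps) /\ (forall t, Cmod (g t - q (eith t)) <= eps) /\
  (forall t, Cmod (f t * g t - p (eith t) * q (eith t)) <= eps) /\
  (forall t, Cmod (f t * Cconj (g t) - p (eith t) * Cconj (q (eith t))) <= eps).
Proof.
  intros Hf Hg Heps.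
  destruct (disc_algebra_Cbounded f Hf) as [A HA]. destruct (disc_algebra_Cbounded g Hg) as [B HB].
  assert (HA0 := Rle_trans _ _ _ (Cmod_ge_0 _) (HA 0)).
  assert (HB0 := Rle_trans _ _ _ (Cmod_ge_0 _) (HB 0)).
  set (d := Rmin 1 (eps / (A + B + 1))).
  assert (Hd : 0 < d) by (apply Rmin_pos; [lra | apply Rdiv_lt_0_compat; lra]).
  assert (Hd1 : d <= 1) by apply Rmin_l.
  assert (Hdeps : (A + B + 1) * d <= eps).
  { apply Rle_trans with ((A + B + 1) * (eps / (A + B + 1))); [|right; field; lra].
    apply Rmult_le_compat_l; [lra | apply Rmin_r]. }
  destruct (Hf d Hd) as (p & Hp & Hfp). destruct (Hg d Hd) as (q & Hq & Hgq).
  assert (Hde : d <= eps) by nra.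
  exists p, q. split; [assumption|]. split; [assumption|]. split; [|split; [|split]]; intro t.
  - now apply Rle_trans with d.
  - now apply Rle_trans with d.
  - eapply Rle_trans; [now apply (Cmod_mult_minus_le _ _ _ _ A B d) | assumption].
  - eapply Rle_trans; [|exact Hdeps].
    apply Cmod_mult_minus_le; try rewrite <- Cminus_conj; rewrite ?Cmod_conj; auto.
Qed.

Lemma disc_algebra_mult (f g : R -> C) :
  disc_algebra f -> disc_algebra g -> disc_algebra (fun t => f t * g t)%C.
Proof.
  intros Hf Hg eps Heps.
  destruct (disc_algebra_approx_mult f g eps Hf Hg Heps) as (p & q & Hp & Hq & _ & _ & Hpq & _).
  exists (fun z => p z * q z)%C. split; [now apply polynomial_mult | exact Hpq].
Qed.

Lemma disc_algebra_scal (c : C) (f : R -> C) : disc_algebra f -> disc_algebra (fun t => c * f t)%C.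
Proof. intro Hf. exact (disc_algebra_mult _ f (disc_algebra_const c) Hf). Qed.

Lemma Cmean_disc_algebra_mult (f g : R -> C) : disc_algebra f -> disc_algebra g ->
  Cmean (fun t => f t * g t)%C = (Cmean f * Cmean g)%C.
Proof.
  intros Hf Hg. set (A := Cmod (Cmean f)). set (B := Cmod (Cmean g)).
  apply (Ceq_of_Cmod_minus_le _ _ (A + B + 2)). intros eps' Heps'.
  set (eps := Rmin 1 eps'). assert (Heps : 0 < eps) by (apply Rmin_pos; lra).
  assert (HA := Cmod_ge_0 (Cmean f) : 0 <= A). assert (HB := Cmod_ge_0 (Cmean g) : 0 <= B).
  apply Rle_trans with ((A + B + 2) * eps); [|apply Rmult_le_compat_l; [lra | apply Rmin_r]].
  destruct (disc_algebra_approx_mult f g eps Hf Hg Heps) as (p & q & Hp & Hq & Hfp & Hgq & Hpq & _).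
  assert (Hlim : forall u r, Ccontinuous u -> polynomial r ->
            (forall t, Cmod (u t - r (eith t)) <= eps) -> Cmod (Cmean u - r 0) <= eps).
  { intros u r Hu Hr Hur. rewrite <- (Cmean_polynomial r Hr), <- Cmean_minus by auto with continuity.
    apply Cmod_Cmean_le_sup; auto with continuity. lra. }
  assert (Hmean := Hlim (fun t => f t * g t)%C (fun z => p z * q z)%C
            ltac:(auto with continuity) (polynomial_mult p q Hp Hq) Hpq).
  assert (Hprod := Cmod_mult_minus_le (Cmean f) (Cmean g) (p 0) (q 0) A B eps
            (Rle_refl _) (Rle_refl _) (Rmin_l _ _)
            (Hlim f p ltac:(auto with continuity) Hp Hfp)
            (Hlim g q ltac:(auto with continuity) Hq Hgq)).
  replace (Cmean (fun t => f t * g t)%C - Cmean f * Cmean g)%C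
    with (Cmean (fun t => f t * g t)%C - p 0 * q 0 + - (Cmean f * Cmean g - p 0 * q 0))%C by ring.
  eapply Rle_trans; [apply Cmod_triangle|]. rewrite Cmod_opp. lra.
Qed.

Lemma disc_algebra_pow (f : R -> C) (n : nat) : disc_algebra f -> disc_algebra (fun t => f t ^ n)%C.
Proof.
  intro Hf. induction n as [|n IHn];
    [exact (disc_algebra_const 1) | exact (disc_algebra_mult f _ Hf IHn)].
Qed.

Lemma Cmean_disc_algebra_pow (f : R -> C) (n : nat) : disc_algebra f ->
  Cmean (fun t => f t ^ n)%C = (Cmean f ^ n)%C.
Proof.
  intro Hf. induction n as [|n IHn]; [exact (Cmean_const 1)|].
  rewrite Cpow_S, <- IHn. exact (Cmean_disc_algebra_mult f _ Hf (disc_algebra_pow f n Hf)).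
Qed.

Lemma disc_algebra_euler (f : R -> C) (N : nat) :
  disc_algebra f -> disc_algebra (fun t => euler N (f t)).
Proof.
  intro Hf. apply disc_algebra_pow, disc_algebra_plus; [apply disc_algebra_const|].
  now apply disc_algebra_scal.
Qed.

Lemma Cmean_disc_algebra_euler (f : R -> C) (N : nat) : disc_algebra f ->
  Cmean (fun t => euler N (f t)) = euler N (Cmean f).
Proof.
  intro Hf. unfold euler. rewrite Cmean_disc_algebra_pow.
  - now rewrite Cmean_plus, Cmean_const, Cmean_scal by auto with continuity.
  - apply disc_algebra_plus; [apply disc_algebra_const | now apply disc_algebra_scal].
Qed.

Lemma disc_algebra_cexp (f : R -> C) : disc_algebra f -> disc_algebra (fun t => cexp (f t)).
Proof.
  intro Hf. destruct (disc_algebra_Cbounded f Hf) as [B HB].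
  apply disc_algebra_uniform_limit. intros eps Heps.
  destruct (euler_uniform_limit B eps Heps) as [N HN].
  exists (fun t => euler N (f t)). split; [now apply disc_algebra_euler|]. intro t. now apply HN.
Qed.

Lemma Cmean_disc_algebra_cexp (f : R -> C) : disc_algebra f ->
  Cmean (fun t => cexp (f t)) = cexp (Cmean f).
Proof.
  intro Hf. destruct (disc_algebra_Cbounded f Hf) as [B HB].
  apply (Ceq_of_Cmod_minus_le _ _ 2). intros eps Heps.
  destruct (euler_uniform_limit B eps Heps) as [N HN].
  assert (HB0 := Rle_trans _ _ _ (Cmod_ge_0 _) (HB 0)).
  assert (Hmean : Cmod (Cmean f) <= B) by (apply Cmod_Cmean_le_sup; auto with continuity).
  assert (Heuler := disc_algebra_euler f N Hf).
  assert (Hdiff : Cmod (Cmean (fun t => cexp (f t)) - Cmean (fun t => euler N (f t))) <= eps).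
  { rewrite <- Cmean_minus by auto with continuity.
    apply Cmod_Cmean_le_sup; [auto with continuity | lra | intro t; now apply HN]. }
  rewrite Cmean_disc_algebra_euler in Hdiff by assumption.
  replace (Cmean (fun t => cexp (f t)) - cexp (Cmean f))%C
    with (Cmean (fun t => cexp (f t)) - euler N (Cmean f) + - (cexp (Cmean f) - euler N (Cmean f)))%C
      by ring.
  eapply Rle_trans; [apply Cmod_triangle|]. rewrite Cmod_opp. specialize (HN _ Hmean). lra.
Qed.

Lemma disc_algebra_eith_pow (n : nat) : disc_algebra (fun t => eith t ^ n)%C.
Proof. exact (disc_algebra_polynomial _ (polynomial_monomial n)). Qed.

Lemma Cmean_eith_pow_mult (f : R -> C) (n : nat) : disc_algebra f ->
  Cmean (fun t => eith t ^ n * f t)%C = (0 ^ n * Cmean f)%C.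
Proof.
  intro Hf. rewrite Cmean_disc_algebra_mult by auto using disc_algebra_eith_pow.
  f_equal. exact (Cmean_polynomial _ (polynomial_monomial n)).
Qed.

Lemma disc_algebra_bound (w f : R -> C) (K : R) : Ccontinuous w -> 0 <= K -> disc_algebra f ->
  (forall p, polynomial p ->
     Cmod (Cmean (fun t => w t * p (eith t))%C) <= K * L2norm (fun t => p (eith t))) ->
  Cmod (Cmean (fun t => w t * f t)%C) <= K * L2norm f.
Proof.
  intros Hw HK Hf Hpoly. apply Cmean_bound_uniform_limit; auto with continuity.
  intros d Hd. destruct (Hf d Hd) as (p & Hp & Hfp).
  exists (fun t => p (eith t)). auto with continuity.
Qed.

(** * Nonpositive frequencies of a unimodular function *)

(* With P_- the projection onto the nonpositive frequencies, [hankel_le u d] bounds the norm of the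
   Hankel operator f |-> P_- (u f) on the Hardy space, and [nonpositive_le u e] the L^2 norm of P_- u. *)
Definition hankel_le (u : R -> C) (d : R) : Prop := forall f g, polynomial f -> polynomial g ->
  Cmod (Cmean (fun t => u t * (f (eith t) * g (eith t)))%C) <=
  d * (L2norm (fun t => f (eith t)) * L2norm (fun t => g (eith t))).
Definition nonpositive_le (u : R -> C) (e : R) : Prop := forall f, polynomial f ->
  Cmod (Cmean (fun t => u t * f (eith t))%C) <= e * L2norm (fun t => f (eith t)).

Lemma hankel_le_nonpositive_le (u : R -> C) (d : R) : hankel_le u d -> nonpositive_le u d.
Proof.
  intros Hu f Hf. assert (Hle := Hu f _ Hf (polynomial_const 1)). cbv beta in Hle.
  rewrite L2norm_const, Cmod_1, Rmult_1_r in Hle.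
  now rewrite (Cmean_ext _ (fun t => u t * f (eith t))%C) in Hle by (intro; ring).
Qed.

Lemma hankel_le_perturb (u v : R -> C) (d tau : R) : Ccontinuous u -> Ccontinuous v -> 0 <= tau ->
  hankel_le v d -> (forall t, Cmod (u t - v t) <= tau) -> hankel_le u (d + tau).
Proof.
  intros Hu Hv Htau Hd Huv f g Hf Hg.
  rewrite (Cmean_ext _ (fun t => v t * (f (eith t) * g (eith t))
             + (u t - v t) * f (eith t) * g (eith t))%C)
    by (intro; ring).
  rewrite Cmean_plus by auto with continuity. eapply Rle_trans; [apply Cmod_triangle|].
  rewrite Rmult_plus_distr_r. apply Rplus_le_compat; [now apply Hd|].
  eapply Rle_trans;
    [apply (Cauchy_Schwarz (fun t => (u t - v t) * f (eith t))%C); auto with continuity|].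
  rewrite <- Rmult_assoc. apply Rmult_le_compat_r; [apply L2norm_ge_0|].
  apply (L2norm_mult_le (fun t => u t - v t)%C); auto with continuity.
Qed.

Lemma nonpositive_le_perturb (u v : R -> C) (e sigma : R) : Ccontinuous u -> Ccontinuous v ->
  nonpositive_le v e -> L2norm (fun t => u t - v t)%C <= sigma -> nonpositive_le u (e + sigma).
Proof.
  intros Hu Hv He Huv f Hf.
  rewrite (Cmean_ext _ (fun t => v t * f (eith t) + (u t - v t) * f (eith t))%C) by (intro; ring).
  rewrite Cmean_plus by auto with continuity. eapply Rle_trans; [apply Cmod_triangle|].
  rewrite Rmult_plus_distr_r. apply Rplus_le_compat; [now apply He|].
  eapply Rle_trans; [apply (Cauchy_Schwarz (fun t => u t - v t)%C); auto with continuity|].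
  apply Rmult_le_compat_r; [apply L2norm_ge_0 | assumption].
Qed.

Lemma hankel_le_disc_algebra (u : R -> C) (d : R) (f g : R -> C) : Ccontinuous u -> 0 <= d ->
  hankel_le u d -> disc_algebra f -> disc_algebra g ->
  Cmod (Cmean (fun t => u t * (f t * g t))%C) <= d * (L2norm f * L2norm g).
Proof.
  intros Hu Hd Hankel Hf Hg.
  rewrite (Cmean_ext _ (fun t => u t * f t * g t)%C) by (intro; ring). rewrite <- Rmult_assoc.
  apply (disc_algebra_bound (fun t => u t * f t)%C);
    auto using Rmult_le_pos, L2norm_ge_0 with continuity.
  intros q Hq. rewrite (Cmean_ext _ (fun t => u t * q (eith t) * f t)%C) by (intro; ring).
  replace (d * L2norm f * L2norm (fun t => q (eith t)))
    with (d * L2norm (fun t => q (eith t)) * L2norm f) by ring.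
  apply (disc_algebra_bound (fun t => u t * q (eith t))%C);
    auto using Rmult_le_pos, L2norm_ge_0 with continuity.
  intros p Hp. rewrite (Cmean_ext _ (fun t => u t * (p (eith t) * q (eith t)))%C) by (intro; ring).
  eapply Rle_trans; [now apply Hankel | right; ring].
Qed.

Section TwistedHardySum.

Variables (u : R -> C) (eps : R).
Hypothesis u_continuous : Ccontinuous u.
Hypothesis u_unimodular : forall t, Cmod (u t) = 1.
Hypothesis u_hankel : hankel_le u (/ 2).
Hypothesis u_nonpositive : nonpositive_le u eps.
Hypothesis eps_ge_0 : 0 <= eps.

(* The spaces conj(z H^2) and u H^2 meet at an angle whose cosine is at most 1/2. *)
Lemma L2norm_le_twisted_sum (a b : R -> C) : disc_algebra a -> disc_algebra b ->
  L2norm b <= 2 * L2norm (fun t => Cconj (a t) + u t * b t)%C.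
Proof.
  intros Ha Hb. set (N := L2norm (fun t => Cconj (a t) + u t * b t)%C).
  assert (Hcross := hankel_le_disc_algebra u (/ 2) b a u_continuous ltac:(lra) u_hankel Hb Ha).
  assert (HN : N ^ 2 = L2norm a ^ 2 + L2norm b ^ 2
                 + 2 * Re (Cmean (fun t => u t * (b t * a t))%C)).
  { unfold N. rewrite !L2norm_sqr, sqnorm_plus by auto with continuity.
    rewrite sqnorm_conj, sqnorm_unimodular by assumption.
    rewrite (Cmean_ext _ (fun t => Cconj (u t * (b t * a t)))%C)
      by (intro t; rewrite !Cmult_conj; ring).
    now rewrite Cmean_conj, re_conj by auto with continuity. }
  assert (Hre := re_le_Cmod (Cmean (fun t => u t * (b t * a t))%C)). apply Rabs_le_between in Hre.
  assert (HN0 := L2norm_ge_0 _ : 0 <= N).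
  apply Rsqr_incr_0_var; [|lra]. unfold Rsqr.
  assert (Hsqr := pow2_ge_0 (L2norm a - / 2 * L2norm b)). nra.
Qed.

Lemma Cmod_Cmean_twisted_sum_le (a b : R -> C) : disc_algebra a -> Cmean a = 0 -> disc_algebra b ->
  Cmod (Cmean (fun t => Cconj (a t) + u t * b t)%C) <=
  2 * eps * L2norm (fun t => Cconj (a t) + u t * b t)%C.
Proof.
  intros Ha Ha0 Hb. rewrite Cmean_plus, Cmean_conj, Ha0, Cconj_RtoC, Cplus_0_l by auto with continuity.
  eapply Rle_trans; [exact (disc_algebra_bound u b eps u_continuous eps_ge_0 Hb u_nonpositive)|].
  assert (Hangle := L2norm_le_twisted_sum a b Ha Hb). nra.
Qed.

End TwistedHardySum.

Definition coef (f : R -> C) (j : nat) : C := Cmean (fun t => f t * Cconj (eith t ^ j))%C.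

Lemma coef_plus (f g : R -> C) (j : nat) : Ccontinuous f -> Ccontinuous g ->
  coef (fun t => f t + g t)%C j = (coef f j + coef g j)%C.
Proof.
  intros Hf Hg. unfold coef. rewrite <- Cmean_plus by auto with continuity.
  apply Cmean_ext. intro t. ring.
Qed.

Lemma coef_scal (c : C) (f : R -> C) (j : nat) : Ccontinuous f ->
  coef (fun t => c * f t)%C j = (c * coef f j)%C.
Proof.
  intro Hf. unfold coef. rewrite <- Cmean_scal by auto with continuity.
  apply Cmean_ext. intro t. ring.
Qed.

Lemma eith_pow_mult_conj_pow (t : R) (i j : nat) : (j <= i)%nat ->
  (eith t ^ i * Cconj (eith t ^ j))%C = (eith t ^ (i - j))%C.
Proof.
  intro Hij. rewrite Cpow_conj, !eith_conj, !eith_pow, <- eith_plus, minus_INR by assumption.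
  f_equal. ring.
Qed.

Lemma coef_eith_pow (i j : nat) : coef (fun t => eith t ^ i)%C j = if Nat.eqb i j then 1 else 0.
Proof.
  unfold coef. destruct (Compare_dec.le_lt_dec j i) as [Hji | Hij].
  - rewrite (Cmean_ext _ (fun t => eith t ^ (i - j))%C) by (intro t; now apply eith_pow_mult_conj_pow).
    rewrite (Cmean_polynomial _ (polynomial_monomial (i - j))).
    destruct (Nat.eqb_spec i j) as [-> | Hneq]; [now rewrite Nat.sub_diag|].
    replace (i - j)%nat with (S (i - j - 1)) by lia. rewrite Cpow_S. ring.
  - rewrite (Cmean_ext _ (fun t => Cconj (eith t ^ (j - i)))%C).
    2:{ intro t. rewrite <- eith_pow_mult_conj_pow, Cmult_conj, Cconj_conj by lia. ring. }
    rewrite Cmean_conj by auto with continuity.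
    rewrite (Cmean_polynomial _ (polynomial_monomial (j - i))).
    replace (j - i)%nat with (S (j - i - 1)) by lia. rewrite Cpow_S, Cmult_0_l, Cconj_RtoC.
    destruct (Nat.eqb_spec i j); [lia | reflexivity].
Qed.

Lemma coef_peval (c : nat -> C) (d j : nat) :
  coef (fun t => peval c d (eith t)) j = if Nat.leb j d then c j else 0.
Proof.
  induction d as [|d IHd].
  - transitivity (coef (fun t => c 0%nat * eith t ^ 0)%C j).
    + apply Cmean_ext. intro t. simpl. ring.
    + rewrite coef_scal, coef_eith_pow by auto with continuity. destruct j; simpl; ring.
  - assert (Hd := coef_plus (fun t => peval c d (eith t)) (fun t => c (S d) * eith t ^ S d)%C j
              ltac:(auto with continuity) ltac:(auto with continuity)).
    rewrite IHd, coef_scal, coef_eith_pow in Hd by auto with continuity.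
    transitivity ((if Nat.leb j d then c j else 0) + c (S d) * (if Nat.eqb (S d) j then 1 else 0))%C.
    + exact Hd.
    + destruct (Nat.leb_spec j d), (Nat.eqb_spec (S d) j), (Nat.leb_spec j (S d)); try lia; subst; ring.
Qed.

Lemma coef_conj_eith_mult (f : R -> C) (j : nat) : disc_algebra f ->
  coef (fun t => Cconj (eith t * f t)) j = 0.
Proof.
  intro Hf. unfold coef.
  rewrite (Cmean_ext _ (fun t => Cconj (eith t ^ S j * f t))%C)
    by (intro t; rewrite Cpow_S, !Cmult_conj; ring).
  rewrite Cmean_conj, Cmean_eith_pow_mult, Cpow_S by auto with continuity.
  replace (0 * 0 ^ j * Cmean f)%C with (RtoC 0) by ring. apply Cconj_RtoC.
Qed.

Lemma coef_eith_pow_mult (f : R -> C) (n j : nat) : disc_algebra f -> (j < n)%nat ->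
  coef (fun t => eith t ^ n * f t)%C j = 0.
Proof.
  intros Hf Hj. unfold coef.
  rewrite (Cmean_ext _ (fun t => eith t ^ (n - j) * f t)%C)
    by (intro t; rewrite <- eith_pow_mult_conj_pow by lia; ring).
  rewrite Cmean_eith_pow_mult by assumption.
  replace (n - j)%nat with (S (n - j - 1)) by lia. rewrite Cpow_S. ring.
Qed.

Lemma Cmod_coef_le_sup (f : R -> C) (j : nat) (B : R) : Ccontinuous f -> 0 <= B ->
  (forall t, Cmod (f t) <= B) -> Cmod (coef f j) <= B.
Proof.
  intros Hf HB Hle. apply Cmod_Cmean_le_sup; auto with continuity.
  intro t. now rewrite Cmod_mult, Cmod_conj, Cmod_eith_pow, Rmult_1_r.
Qed.

Lemma coef_low_frequencies (a b : R -> C) (c : nat -> C) (d j : nat) :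
  disc_algebra a -> disc_algebra b -> (j <= d)%nat ->
  coef (fun t => Cconj (eith t * a t) + (peval c d (eith t) + eith t ^ S d * b t))%C j = c j.
Proof.
  intros Ha Hb Hj. rewrite !coef_plus by auto 6 using Ccontinuous_eith with continuity.
  rewrite coef_conj_eith_mult, coef_peval, coef_eith_pow_mult by auto with arith.
  destruct (Nat.leb_spec j d); [ring | lia].
Qed.

Lemma Cmod_coef_minus_le (f g : R -> C) (j : nat) (B : R) : Ccontinuous f -> Ccontinuous g -> 0 <= B ->
  (forall t, Cmod (f t - g t) <= B) -> Cmod (coef f j - coef g j) <= B.
Proof.
  intros Hf Hg HB Hle.
  replace (coef f j - coef g j)%C with (coef (fun t => f t - g t)%C j).
  - apply Cmod_coef_le_sup; auto with continuity.
  - unfold coef. rewrite <- Cmean_minus by auto with continuity. apply Cmean_ext. intro t. ring.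
Qed.

Lemma frequency_gap_approx (f g : R -> C) (d : nat) (eps : R) :
  disc_algebra f -> disc_algebra g -> 0 < eps ->
  (forall j, (j <= d)%nat -> coef (fun t => f t * Cconj (g t))%C j = 0) ->
  exists a b, polynomial a /\ polynomial b /\ forall t,
  Cmod (f t * Cconj (g t) - (Cconj (eith t * a (eith t)) + eith t ^ S d * b (eith t))) <= eps.
Proof.
  intros Hf Hg Heps Hgap. assert (Hd := pos_INR d).
  set (del := eps / (INR d + 2)). assert (Hdel : 0 < del) by (apply Rdiv_lt_0_compat; lra).
  destruct (disc_algebra_approx_mult f g del Hf Hg Hdel) as (p & q & Hp & Hq & _ & _ & _ & Hfg).
  destruct (polynomial_mult_conj_split p q Hp Hq) as (a & r & Ha & Hr & Hpq).
  destruct (polynomial_split r d Hr) as (c & b & Hb & Hrb).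
  exists a, b. split; [assumption|]. split; [assumption|].
  assert (Hsmall : forall j, (j <= d)%nat -> Cmod (c j) <= del).
  { intros j Hj. rewrite <- (coef_low_frequencies (fun t => a (eith t)) (fun t => b (eith t)) c d j)
      by auto using disc_algebra_polynomial.
    rewrite <- Cmod_opp, <- (Cplus_0_l (- _)%C), <- (Hgap j Hj).
    apply Cmod_coef_minus_le;
      [auto with continuity | auto 6 using Ccontinuous_eith with continuity | lra|].
    intro t. rewrite <- Hrb, <- Hpq. apply Hfg. }
  intro t. replace (f t * Cconj (g t) - (Cconj (eith t * a (eith t)) + eith t ^ S d * b (eith t)))%C
    with (f t * Cconj (g t) - p (eith t) * Cconj (q (eith t)) + peval c d (eith t))%C
    by (rewrite Hpq, (Hrb (eith t)); ring).
  eapply Rle_trans; [apply Cmod_triangle|].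
  apply Rle_trans with (del + del * INR (S d)).
  - apply Rplus_le_compat; [apply Hfg|]. eapply Rle_trans; [apply Cmod_peval_le|].
    rewrite <- sum_cte. now apply sum_Rle.
  - right. unfold del. rewrite S_INR. field. lra.
Qed.

Lemma Cmod_Cmean_frequency_gap_le (u v f g : R -> C) (d : nat) (eps : R) :
  Ccontinuous u -> (forall t, Cmod (u t) = 1) ->
  hankel_le u (/ 2) -> nonpositive_le u eps -> 0 <= eps ->
  disc_algebra v -> disc_algebra f -> disc_algebra g ->
  (forall t, eith t ^ S d * Cconj (v t) = u t * v t)%C ->
  (forall j, (j <= d)%nat -> coef (fun t => f t * Cconj (g t))%C j = 0) ->
  Cmod (Cmean (fun t => Cconj (v t) * (f t * Cconj (g t)))%C) <=
  2 * eps * L2norm (fun t => Cconj (v t) * (f t * Cconj (g t)))%C.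
Proof.
  intros Hu Hu1 Hhankel Hnonpos Heps Hv Hf Hg Huv Hgap.
  destruct (disc_algebra_Cbounded v Hv) as [B HB].
  assert (HB0 := Rle_trans _ _ _ (Cmod_ge_0 _) (HB 0)).
  rewrite (Cmean_ext _ (fun t => 1 * (Cconj (v t) * (f t * Cconj (g t))))%C) by (intro; ring).
  apply (Cmean_bound_uniform_limit (fun _ => RtoC 1)); [auto with continuity.. | lra |].
  intros del Hdel.
  destruct (frequency_gap_approx f g d (del / (B + 1)) Hf Hg) as (a & b & Ha & Hb & Hab);
    [apply Rdiv_lt_0_compat; lra | assumption |].
  assert (Hza := disc_algebra_polynomial _ (polynomial_mult_z a Ha)).
  assert (Hda := disc_algebra_mult v _ Hv Hza).
  assert (Hdb := disc_algebra_mult v _ Hv (disc_algebra_polynomial b Hb)).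
  exists (fun t => Cconj (v t * (eith t * a (eith t))) + u t * (v t * b (eith t)))%C.
  split; [auto 7 with continuity|]. split.
  - intro t.
    replace (u t * (v t * b (eith t)))%C with (eith t ^ S d * Cconj (v t) * b (eith t))%C
      by (rewrite Huv; ring).
    rewrite Cmult_conj.
    match goal with |- Cmod ?w <= _ => replace w with (Cconj (v t) * (f t * Cconj (g t)
      - (Cconj (eith t * a (eith t)) + eith t ^ S d * b (eith t))))%C by ring end.
    rewrite Cmod_mult, Cmod_conj.
    apply Rle_trans with ((B + 1) * (del / (B + 1))); [|right; field; lra].
    apply Rmult_le_compat; auto using Cmod_ge_0. specialize (HB t). lra.
  - rewrite (Cmean_ext _ _ (fun t => Cmult_1_l _)).
    apply Cmod_Cmean_twisted_sum_le; auto.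
    rewrite Cmean_disc_algebra_mult by assumption.
    rewrite (Cmean_polynomial _ (polynomial_mult_z a Ha)). ring.
Qed.

(** * The leading coefficient *)

Lemma Cmean_mult_peval (u : R -> C) (c : nat -> C) (d : nat) : Ccontinuous u ->
  (forall i, (i < d)%nat -> Cmean (fun t => u t * eith t ^ i)%C = 0) ->
  Cmean (fun t => u t * peval c d (eith t))%C = (c d * Cmean (fun t => u t * eith t ^ d))%C.
Proof.
  intros Hu. induction d as [|d IHd]; intro Hvanish.
  - rewrite <- Cmean_scal by auto with continuity. apply Cmean_ext. intro t. simpl. ring.
  - rewrite (Cmean_ext _ (fun t => u t * peval c d (eith t) + c (S d) * (u t * eith t ^ S d))%C)
      by (intro; rewrite peval_S; ring).
    rewrite Cmean_plus, Cmean_scal, IHd, Hvanish by auto with continuity. ring.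
Qed.

Lemma ip_Cmean (phi : R -> R) (f g : C -> C) :
  ip phi f g = Cmean (fun t => f (eith t) * Cconj (g (eith t)) * RtoC (phi t))%C.
Proof. reflexivity. Qed.

Lemma orthonormal_leading_coef (phi : R -> R) (P : nat -> nat -> C) (d : nat) :
  orthonormal_system phi P -> P d d = RtoC (Re (P d d)) /\ P d d <> 0.
Proof.
  intros [Hlead _]. destruct (Hlead d) as [Him Hre]. assert (Hreal : P d d = RtoC (Re (P d d))).
  { destruct (P d d) as [x y]. simpl in Him. now rewrite Him. }
  split; [assumption|]. rewrite Hreal. intro Hzero. apply RtoC_inj in Hzero. lra.
Qed.

Lemma orthonormal_monomial (phi : R -> R) (P : nat -> nat -> C) (d j : nat) : Rcontinuous phi ->
  orthonormal_system phi P -> (j <= d)%nat ->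
  Cmean (fun t => Cconj (peval (P d) d (eith t)) * RtoC (phi t) * eith t ^ j)%C =
  if Nat.eqb j d then (/ P d d)%C else 0.
Proof.
  intros Hphi HP Hj. set (u := fun t => (Cconj (peval (P d) d (eith t)) * RtoC (phi t))%C).
  assert (Hu : Ccontinuous u) by (unfold u; auto with continuity).
  change (Cmean (fun t => u t * eith t ^ j)%C = if Nat.eqb j d then (/ P d d)%C else 0).
  induction j as [j IHj] using (well_founded_induction Wf_nat.lt_wf).
  assert (Hip : (P j j * Cmean (fun t => u t * eith t ^ j))%C = RtoC (if Nat.eqb j d then 1 else 0)).
  { rewrite <- Cmean_mult_peval, <- (proj2 HP j d), ip_Cmean.
    - apply Cmean_ext. intro t. unfold u. ring.
    - assumption.
    - intros i Hi. rewrite IHj by lia. destruct (Nat.eqb_spec i d); [lia | reflexivity]. }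
  destruct (orthonormal_leading_coef phi P j HP) as [_ Hnz].
  rewrite <- (Cmult_1_l (Cmean _)), <- (Cinv_l (P j j) Hnz), <- Cmult_assoc, Hip.
  destruct (Nat.eqb_spec j d) as [<- |]; ring.
Qed.

(* For the outer function D = exp (- f) this is z^m conj D / D on the unit circle; the theorem has
   f = - n F and m = n, whose phase is exp (i n kappa). *)
Definition phase (m : nat) (f : R -> C) (t : R) : C := (eith t ^ m * eith (2 * Im (f t)))%C.

Lemma Ccontinuous_phase (m : nat) (f : R -> C) : Ccontinuous f -> Ccontinuous (phase m f).
Proof. intro Hf. apply Ccontinuous_mult; auto with continuity. Qed.

Lemma Cmod_phase (m : nat) (f : R -> C) (t : R) : Cmod (phase m f t) = 1.
Proof. unfold phase. rewrite Cmod_mult, Cmod_eith_pow, Cmod_eith. ring. Qed.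

Lemma phase_mult_cexp_opp (m : nat) (f : R -> C) (t : R) :
  (eith t ^ m * Cconj (cexp (- f t)))%C = (phase m f t * cexp (- f t))%C.
Proof.
  unfold phase. rewrite <- Cmult_assoc. f_equal. rewrite cexp_conj, eith_cexp, <- cexp_plus. f_equal.
  destruct (f t) as [x y]. unfold Cconj, Copp, Cplus; simpl. f_equal; ring.
Qed.

Section LeadingCoefficient.

Variables (phi : R -> R) (P : nat -> nat -> C) (f : R -> C) (d : nat).
Hypothesis P_orthonormal : orthonormal_system phi P.
Hypothesis f_disc : disc_algebra f.
Hypothesis phi_factor : forall t, phi t = exp (2 * Re (f t)).

Let gamma := Re (P d d).
Let X := fun t => cexp (f t).
Let q := fun t => (eith t ^ d * Cconj (peval (P d) d (eith t)) * X t)%C.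
Let mu := Cmean f.

Lemma weight_eq_outer_mult_conj (t : R) : (X t * Cconj (X t))%C = RtoC (phi t).
Proof.
  rewrite <- Cmod2_conj. f_equal. unfold X. rewrite Cmod_cexp, phi_factor, <- exp_INR_mult.
  f_equal.
Qed.

Lemma weight_Rcontinuous : Rcontinuous phi.
Proof.
  apply (Rcontinuous_ext (fun t => exp (2 * Re (f t)))); [intro t; now rewrite phi_factor|].
  auto with continuity.
Qed.

Lemma outer_disc_algebra : disc_algebra X.
Proof. now apply disc_algebra_cexp. Qed.

Lemma reversed_eq (t : R) : q t = (peval (fun j => Cconj (P d (d - j)%nat)) d (eith t) * X t)%C.
Proof. unfold q. now rewrite eith_pow_mult_conj_peval. Qed.

Lemma reversed_disc_algebra : disc_algebra q.
Proof.
  apply (disc_algebra_ext _ _ (fun t => eq_sym (reversed_eq t))).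
  apply disc_algebra_mult; [apply disc_algebra_polynomial, polynomial_peval | apply outer_disc_algebra].
Qed.

Lemma Cmean_reversed : Cmean q = (RtoC gamma * cexp mu)%C.
Proof.
  rewrite (Cmean_ext _ _ reversed_eq), Cmean_disc_algebra_mult
    by auto using disc_algebra_polynomial, polynomial_peval, outer_disc_algebra.
  unfold X. rewrite Cmean_disc_algebra_cexp, (Cmean_polynomial _ (polynomial_peval _ d)) by assumption.
  f_equal. destruct (orthonormal_leading_coef phi P d P_orthonormal) as [Hreal _].
  transitivity (Cconj (P d d)).
  - clear. destruct d as [|m]; [reflexivity|]. rewrite peval_horner, Nat.sub_0_r. ring.
  - rewrite Hreal. apply Cconj_RtoC.
Qed.

Lemma sqnorm_reversed : sqnorm q = 1.
Proof.
  apply RtoC_inj. unfold sqnorm. rewrite <- Cmean_RtoC.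
  transitivity (ip phi (peval (P d) d) (peval (P d) d)).
  - rewrite ip_Cmean. apply Cmean_ext. intro t. rewrite Cmod2_conj, <- weight_eq_outer_mult_conj.
    unfold q. rewrite !Cmult_conj, Cconj_conj.
    transitivity (eith t ^ d * Cconj (eith t ^ d) * (peval (P d) d (eith t)
      * Cconj (peval (P d) d (eith t)) * (X t * Cconj (X t))))%C; [ring|].
    rewrite eith_pow_mult_conj_pow, Nat.sub_diag by lia. ring.
  - rewrite (proj2 P_orthonormal d d), Nat.eqb_refl. reflexivity.
Qed.

(* The error 1 - c q for the scalar c that minimizes its norm. *)
Let E := fun t => (1 + - (RtoC gamma * Cconj (cexp mu)) * q t)%C.
Let defect := 1 - gamma ^ 2 * exp (2 * Re mu).

Lemma Cmod_cexp_sqr : Cmod (cexp mu) ^ 2 = exp (2 * Re mu).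
Proof. rewrite Cmod_cexp, <- exp_INR_mult. reflexivity. Qed.

Lemma error_disc_algebra : disc_algebra E.
Proof.
  apply disc_algebra_plus; [apply disc_algebra_const|].
  apply disc_algebra_scal, reversed_disc_algebra.
Qed.

Lemma Cmean_error : Cmean E = RtoC defect.
Proof.
  assert (Hq := disc_algebra_Ccontinuous q reversed_disc_algebra).
  unfold E. rewrite Cmean_plus, Cmean_const, Cmean_scal, Cmean_reversed by auto with continuity.
  unfold defect. rewrite <- Cmod_cexp_sqr, RtoC_minus, RtoC_mult, Cmod2_conj, RtoC_pow. ring.
Qed.

Lemma sqnorm_error : sqnorm E = defect.
Proof.
  assert (Hq := disc_algebra_Ccontinuous q reversed_disc_algebra).
  unfold E. rewrite sqnorm_plus, sqnorm_scal, sqnorm_reversed by auto with continuity.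
  rewrite (Cmean_ext _ (fun t => Cconj (- (RtoC gamma * Cconj (cexp mu)) * q t))%C) by (intro; ring).
  rewrite Cmean_conj, Cmean_scal, Cmean_reversed, re_conj by auto with continuity.
  unfold sqnorm. rewrite Rmean_const, Cmod_1, Cmod_opp, Cmod_mult, Cmod_conj, Cmod_R.
  rewrite Rpow_mult_distr, pow2_abs.
  replace (- (RtoC gamma * Cconj (cexp mu)) * (RtoC gamma * cexp mu))%C
    with (RtoC (- (gamma ^ 2 * Cmod (cexp mu) ^ 2)))
    by (rewrite RtoC_opp, RtoC_mult, Cmod2_conj, RtoC_pow; ring).
  unfold defect. rewrite <- Cmod_cexp_sqr. simpl. ring.
Qed.

Lemma error_frequency_gap (j : nat) : (j <= d)%nat -> coef (fun t => E t * Cconj (X t))%C j = 0.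
Proof.
  intro Hj. destruct (orthonormal_leading_coef phi P d P_orthonormal) as [Hreal Hnz].
  assert (HX := disc_algebra_Ccontinuous X outer_disc_algebra). assert (Hphi := weight_Rcontinuous).
  unfold coef.
  rewrite (Cmean_ext _ (fun t => Cconj (eith t ^ j * X t) + - (P d d * Cconj (cexp mu))
    * (Cconj (peval (P d) d (eith t)) * RtoC (phi t) * eith t ^ (d - j)))%C).
  2:{ intro t. rewrite <- eith_pow_mult_conj_pow, <- weight_eq_outer_mult_conj, Hreal by assumption.
      unfold E, q. fold gamma. rewrite !Cmult_conj. ring. }
  rewrite Cmean_plus, Cmean_conj, Cmean_scal by auto 6 with continuity.
  rewrite (orthonormal_monomial phi P d) by (assumption || lia).
  rewrite Cmean_eith_pow_mult by apply outer_disc_algebra.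
  unfold X. rewrite Cmean_disc_algebra_cexp by assumption. fold mu.
  destruct (Nat.eqb_spec (d - j) d) as [Heq | Hneq].
  - destruct j as [|j]; [|lia]. simpl. rewrite Cmult_1_l. field. assumption.
  - destruct j as [|j]; [lia|]. rewrite Cpow_S, Cmult_conj, Cmult_conj, Cconj_RtoC. ring.
Qed.

Lemma leading_coefficient_defect (eps : R) :
  hankel_le (phase (S d) f) (/ 2) -> nonpositive_le (phase (S d) f) eps -> 0 <= eps ->
  0 <= 1 - Re (P d d) ^ 2 * exp (2 * Re (Cmean f)) <= 4 * eps ^ 2.
Proof.
  intros Hhankel Hnonpos Heps. fold gamma mu. fold defect. rewrite <- sqnorm_error.
  assert (HE := disc_algebra_Ccontinuous E error_disc_algebra).
  assert (HE0 := sqnorm_ge_0 E HE). split; [assumption|].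
  assert (Hv : disc_algebra (fun t => cexp (- f t))).
  { apply disc_algebra_cexp, (disc_algebra_ext (fun t => - (1) * f t)%C); [intro; ring|].
    now apply disc_algebra_scal. }
  assert (Hcancel : forall t, (Cconj (cexp (- f t)) * (E t * Cconj (X t)))%C = E t).
  { intro t. transitivity (E t * Cconj (cexp (- f t) * X t))%C; [rewrite Cmult_conj; ring|].
    unfold X. rewrite cexp_opp_l, Cconj_RtoC. ring. }
  assert (Hgap := Cmod_Cmean_frequency_gap_le (phase (S d) f) _ E X d eps
    (Ccontinuous_phase _ _ (disc_algebra_Ccontinuous f f_disc)) (Cmod_phase (S d) f)
    Hhankel Hnonpos Heps Hv error_disc_algebra outer_disc_algebra
    (phase_mult_cexp_opp (S d) f) error_frequency_gap).
  cbv beta in Hgap. rewrite (Cmean_ext _ _ Hcancel), (L2norm_ext _ _ Hcancel) in Hgap.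
  rewrite Cmean_error, <- sqnorm_error in Hgap.
  rewrite Cmod_RtoC_nonneg, <- L2norm_sqr in Hgap by assumption.
  rewrite <- L2norm_sqr by assumption.
  assert (Hnorm : L2norm E <= 2 * eps) by nra. nra.
Qed.

End LeadingCoefficient.

(** * Fourier coefficients *)

Lemma Cmean_mult_conj_peval (f : R -> C) (c : nat -> C) (d : nat) : Ccontinuous f ->
  (forall j, (j <= d)%nat -> c j = coef f j) ->
  Cmean (fun t => f t * Cconj (peval c d (eith t)))%C = RtoC (sqnorm (fun t => peval c d (eith t))).
Proof.
  intros Hf Hc. rewrite sqnorm_peval. induction d as [|d IHd].
  - cbn [sum_f_R0 peval]. rewrite Cmod2_conj, (Hc 0%nat) at 1 by lia. rewrite Cmult_comm. unfold coef.
    rewrite <- Cmean_scal by auto with continuity.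
    apply Cmean_ext. intro t. simpl. rewrite Cconj_RtoC. ring.
  - rewrite tech5, RtoC_plus, <- IHd, Cmod2_conj by auto. rewrite (Hc (S d)) at 1 by lia.
    rewrite Cmult_comm. unfold coef at 1.
    rewrite <- Cmean_scal, <- Cmean_plus by auto 6 with continuity.
    apply Cmean_ext. intro t. rewrite peval_S, Cplus_conj, Cmult_conj. ring.
Qed.

Lemma Bessel (f : R -> C) (N : nat) : Ccontinuous f ->
  sum_f_R0 (fun j => Cmod (coef f j) ^ 2) N <= sqnorm f.
Proof.
  intro Hf. rewrite <- sqnorm_peval. set (T := fun t => peval (coef f) N (eith t)).
  assert (HT : Ccontinuous T) by (unfold T; auto with continuity).
  assert (Hpair : Cmean (fun t => f t * Cconj (T t))%C = RtoC (sqnorm T))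
    by now apply Cmean_mult_conj_peval.
  assert (Hdiff := sqnorm_ge_0 (fun t => f t + RtoC (-1) * T t)%C ltac:(auto with continuity)).
  rewrite sqnorm_plus, sqnorm_scal, Cmod_R in Hdiff by auto with continuity.
  rewrite (Cmean_ext _ (fun t => RtoC (-1) * (f t * Cconj (T t)))%C) in Hdiff
    by (intro t; rewrite Cmult_conj, Cconj_RtoC; ring).
  rewrite Cmean_scal, Hpair, <- RtoC_mult, re_RtoC, pow2_abs in Hdiff by auto with continuity.
  lra.
Qed.

Lemma ex_series_of_bounded_partial_sums (a : nat -> R) (K : R) : (forall j, 0 <= a j) ->
  (forall N, sum_f_R0 a N <= K) -> ex_series a.
Proof.
  intros Ha HK.
  destruct (ex_finite_lim_seq_incr (sum_f_R0 a) K) as [l Hl].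
  - intro N. rewrite tech5. specialize (Ha (S N)). lra.
  - assumption.
  - exists l. apply is_series_Reals. now apply is_lim_seq_Reals.
Qed.

Lemma Riemann_Lebesgue (f : R -> C) : Ccontinuous f -> is_lim_seq (fun j => Cmod (coef f j)) 0.
Proof.
  intro Hf.
  assert (Hsqr : is_lim_seq (fun j => Cmod (coef f j) ^ 2) 0).
  { apply ex_series_lim_0, (ex_series_of_bounded_partial_sums _ (sqnorm f)).
    - intro j. apply pow2_ge_0.
    - intro N. now apply Bessel. }
  apply (is_lim_seq_ext (fun j => sqrt (Cmod (coef f j) ^ 2))).
  - intro j. apply sqrt_pow2, Cmod_ge_0.
  - rewrite <- sqrt_0. apply (is_lim_seq_continuous sqrt); [apply continuity_pt_sqrt; lra | assumption].
Qed.

Definition periodic {T : Type} (f : R -> T) : Prop := forall t, f (t + 2 * PI) = f t.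

Lemma Rmean_translate (g : R -> R) (h : R) : Rcontinuous g -> periodic g ->
  Rmean (fun t => g (t + h)) = Rmean g.
Proof.
  intros Hg Hper. unfold Rmean. f_equal.
  assert (Hshift : forall a b v, RInt (fun y => g (y + v)) a b = RInt g (a + v) (b + v)).
  { intros a b v. assert (Hlin := RInt_comp_lin g 1 v a b (ex_RInt_Rcontinuous g _ _ Hg)).
    rewrite !Rmult_1_l in Hlin. rewrite <- Hlin. apply RInt_ext. intros x _.
    unfold scal; simpl; unfold mult; simpl. now rewrite !Rmult_1_l. }
  assert (Hend : RInt g PI (PI + h) = RInt g (- PI) (- PI + h)).
  { replace PI with (- PI + 2 * PI) at 1 by ring.
    replace (PI + h) with (- PI + h + 2 * PI) by ring.
    rewrite <- Hshift. apply RInt_ext. intros x _. apply Hper. }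
  assert (Chasles : forall a b c, RInt g a b + RInt g b c = RInt g a c)
    by (intros a b c; apply (RInt_Chasles g); auto with continuity).
  assert (Hleft := Chasles (- PI) (- PI + h) (PI + h)). assert (Hright := Chasles (- PI) PI (PI + h)).
  rewrite Hshift. lra.
Qed.

Lemma Cmean_translate (f : R -> C) (h : R) : Ccontinuous f -> periodic f ->
  Cmean (fun t => f (t + h)) = Cmean f.
Proof.
  intros [Hre Him] Hper. rewrite !Cmean_pair. f_equal.
  - apply (Rmean_translate (fun t => Re (f t))); [assumption|]. intro t. now rewrite Hper.
  - apply (Rmean_translate (fun t => Im (f t))); [assumption|]. intro t. now rewrite Hper.
Qed.

Lemma coef_translate (f : R -> C) (h : R) (j : nat) : Ccontinuous f -> periodic f ->
  coef (fun t => f (t + h)) j = (eith h ^ j * coef f j)%C.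
Proof.
  intros Hf Hper. unfold coef.
  rewrite <- (Cmean_translate (fun t => f t * Cconj (eith t ^ j))%C h), <- Cmean_scal.
  - apply Cmean_ext. intro t. rewrite eith_plus, Cpow_mult_l, Cmult_conj.
    transitivity (f (t + h)%R * Cconj (eith t ^ j) * (eith h ^ j * Cconj (eith h ^ j)))%C; [|ring].
    rewrite eith_pow_mult_conj_pow, Nat.sub_diag by lia. ring.
  - apply (Ccontinuous_translate (fun t => f t * Cconj (eith t ^ j))%C h). auto with continuity.
  - auto with continuity.
  - intro t. now rewrite Hper, eith_periodic.
Qed.

Lemma eith_minus_1_ge (x : R) : 0 <= x <= 1 / 2 -> x / 2 <= Cmod (eith x - 1).
Proof.
  intro Hx.
  assert (Htaylor : Cmod (eith x - 1 - RtoC x * Ci) <= x * Rabs (x - 0)).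
  { replace (eith x - 1 - RtoC x * Ci)%C
      with (eith (1 * x) - RtoC x * Ci - (eith (1 * 0) - RtoC 0 * Ci))%C
      by (rewrite Rmult_1_l, Rmult_0_r, eith_0; ring).
    apply (Cmod_increment_le (fun y => eith (1 * y) - RtoC y * Ci)%C
             (fun y => Ci * (eith (1 * y) - 1))%C).
    intros y Hy. rewrite Rmin_left, Rmax_right in Hy by lra. split.
    - split; unfold Re, Im; simpl; auto_derive; auto; unfold Rminus; ring.
    - rewrite Cmod_mult, Cmod_Ci, <- eith_0, Rmult_1_l, Rmult_1_l.
      eapply Rle_trans; [apply eith_lipschitz|]. rewrite Rabs_pos_eq; lra. }
  assert (Htri : Cmod (RtoC x * Ci) <= Cmod (eith x - 1) + Cmod (eith x - 1 - RtoC x * Ci)).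
  { replace (RtoC x * Ci)%C with (eith x - 1 + - (eith x - 1 - RtoC x * Ci))%C at 1 by ring.
    eapply Rle_trans; [apply Cmod_triangle|]. rewrite Cmod_opp. lra. }
  rewrite Cmod_mult, Cmod_Ci, Cmod_RtoC_nonneg in Htri by lra.
  rewrite Rminus_0_r, Rabs_pos_eq in Htaylor by lra. nra.
Qed.

(* Bessel's inequality for the increment f (t + h) - f t, whose coefficient of index [j <= N]
   has modulus at least [j h / 2] times that of [f] when [h = 1 / (2 N)]. *)
Lemma lipschitz_coef_sum_le (f : R -> C) (L : R) (N : nat) : Ccontinuous f -> periodic f -> 0 <= L ->
  (forall x y, Cmod (f x - f y) <= L * Rabs (x - y)) ->
  sum_f_R0 (fun j => (INR j * Cmod (coef f j)) ^ 2) N <= 4 * L ^ 2.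
Proof.
  intros Hf Hper HL0 HL. set (h := / (2 * INR (S N))).
  assert (HN : 0 < INR (S N)) by (apply lt_0_INR; lia).
  assert (Hh : 0 < h) by (apply Rinv_0_lt_compat; lra).
  set (g := fun t => (f (t + h)%R + (-(1)) * f t)%C).
  assert (Hg : Ccontinuous g) by (unfold g; auto with continuity).
  assert (Hgnorm : sqnorm g <= (L * h) ^ 2).
  { rewrite <- L2norm_sqr by assumption. apply pow_incr. split; [apply L2norm_ge_0|].
    apply L2norm_le_sup; [assumption | nra|]. intro t. unfold g.
    replace (f (t + h)%R + (-(1)) * f t)%C with (f (t + h)%R - f t)%C by ring.
    eapply Rle_trans; [apply HL|]. replace (t + h - t) with h by ring. rewrite Rabs_pos_eq; lra. }
  assert (Hcoef : forall j, coef g j = ((eith (INR j * h) - 1) * coef f j)%C).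
  { intro j. unfold g. rewrite coef_plus, coef_scal, coef_translate, eith_pow by auto with continuity.
    ring. }
  assert (Hterm : forall j, (j <= N)%nat ->
            (INR j * Cmod (coef f j)) ^ 2 * (h / 2) ^ 2 <= Cmod (coef g j) ^ 2).
  { intros j Hj. rewrite <- Rpow_mult_distr. apply pow_incr. assert (Hj0 := pos_INR j).
    assert (Hc := Cmod_ge_0 (coef f j)). split; [apply Rmult_le_pos; nra|].
    rewrite Hcoef, Cmod_mult. replace (INR j * Cmod (coef f j) * (h / 2))
      with (INR j * h / 2 * Cmod (coef f j)) by field.
    apply Rmult_le_compat_r; [assumption|]. apply eith_minus_1_ge. split; [nra|].
    apply le_INR in Hj. rewrite S_INR in HN. unfold h. rewrite S_INR.
    apply Rle_div_l; [lra | nra]. }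
  assert (Hsum : sum_f_R0 (fun j => (INR j * Cmod (coef f j)) ^ 2) N * (h / 2) ^ 2 <= (L * h) ^ 2).
  { rewrite Rmult_comm, scal_sum. eapply Rle_trans; [apply sum_Rle, Hterm|].
    eapply Rle_trans; [now apply Bessel | assumption]. }
  apply Rmult_le_reg_r with ((h / 2) ^ 2); [nra|]. nra.
Qed.

Lemma Cmean_derive (f df : R -> C) : (forall t, is_Cderive f t (df t)) -> Ccontinuous df ->
  f PI = f (- PI) -> Cmean df = 0.
Proof.
  intros Hf [Hre Him] Hper.
  assert (Hzero : forall g dg : R -> R, (forall t, is_derive g t (dg t)) -> Rcontinuous dg ->
            g PI = g (- PI) -> Rmean dg = 0).
  { intros g dg Hg Hdg Hend. unfold Rmean.
    rewrite (is_RInt_unique dg (- PI) PI (minus (g PI) (g (- PI)))).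
    - unfold minus, plus, opp; simpl. rewrite Hend. ring.
    - apply (is_RInt_derive g dg); auto. }
  rewrite Cmean_pair. unfold RtoC. f_equal.
  - apply (Hzero (fun t => Re (f t))); [intro t; apply Hf | assumption | now rewrite Hper].
  - apply (Hzero (fun t => Im (f t))); [intro t; apply Hf | assumption | now rewrite Hper].
Qed.

Lemma periodic_PI {T : Type} (f : R -> T) : periodic f -> f PI = f (- PI).
Proof. intro Hper. rewrite <- (Hper (- PI)). f_equal. ring. Qed.

Lemma eith_pow_conj (t : R) (j : nat) : Cconj (eith t ^ j) = eith (- INR j * t).
Proof. rewrite eith_pow, eith_conj. f_equal. ring. Qed.

Lemma is_Cderive_RtoC_mult_eith (f : R -> R) (x t d : R) : is_derive f t d ->
  is_Cderive (fun t => RtoC (f t) * eith (x * t))%C t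
    (RtoC d * eith (x * t) + RtoC x * Ci * (RtoC (f t) * eith (x * t)))%C.
Proof.
  intro Hf. split; unfold Re, Im; simpl; auto_derive; try now exists d.
  all: rewrite (is_derive_unique (fun x : R => f x) t d Hf); ring.
Qed.

Lemma coef_derive (f df : R -> R) (j : nat) : (forall t, is_derive f t (df t)) -> Rcontinuous df ->
  periodic f -> coef (fun t => RtoC (df t)) j = (RtoC (INR j) * Ci * coef (fun t => RtoC (f t)) j)%C.
Proof.
  intros Hf Hdf Hper. assert (Hfc := is_derive_Rcontinuous f df Hf). unfold coef.
  rewrite (Cmean_ext _ (fun t => RtoC (df t) * eith (- INR j * t))%C)
    by (intro t; now rewrite eith_pow_conj).
  rewrite (Cmean_ext (fun t => RtoC (f t) * _)%C (fun t => RtoC (f t) * eith (- INR j * t))%C)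
    by (intro t; now rewrite eith_pow_conj).
  assert (Hzero := Cmean_derive _ _ (fun t => is_Cderive_RtoC_mult_eith f (- INR j) t (df t) (Hf t))
            ltac:(auto 7 with continuity)).
  rewrite Cmean_plus, Cmean_scal, RtoC_opp in Hzero by auto 6 with continuity.
  rewrite <- (Cplus_0_l (_ * Ci * _)%C), <- Hzero; [ring|].
  apply (periodic_PI (fun t => RtoC (f t) * eith (- INR j * t))%C).
  intro t. now rewrite Hper, <- !eith_pow_conj, eith_periodic.
Qed.

Lemma Derive_n_periodic (V : R -> R) (i : nat) : periodic V -> periodic (Derive_n V i).
Proof. intros Hper x. rewrite <- Derive_n_comp_trans. now apply Derive_n_ext. Qed.

Lemma lipschitz_Rcontinuous (f : R -> R) (L : R) :
  (forall x y, Rabs (f x - f y) <= L * Rabs (x - y)) -> Rcontinuous f.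
Proof.
  intros HL t. apply filterlim_locally. intro eps.
  assert (HL0 := Rabs_pos L). assert (Heps := cond_pos eps).
  assert (Hdel : 0 < eps / (Rabs L + 1)) by (apply Rdiv_lt_0_compat; lra).
  exists (mkposreal _ Hdel). intros y Hy. change (Rabs (y - t) < eps / (Rabs L + 1)) in Hy.
  change (Rabs (f y - f t) < eps). eapply Rle_lt_trans; [apply HL|].
  apply Rlt_div_r in Hy; [|lra]. assert (Hyt := Rabs_pos (y - t)). assert (Habs := Rle_abs L). nra.
Qed.

Lemma CmLip_Rcontinuous (m : nat) (V : R -> R) (i : nat) : CmLip m V -> (i <= m)%nat ->
  Rcontinuous (Derive_n V i).
Proof.
  intros (_ & Hd & L & HL) Hi. destruct (Nat.eq_dec i m) as [-> | Hneq].
  - now apply (lipschitz_Rcontinuous _ L).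
  - apply (is_derive_Rcontinuous _ (Derive_n V (S i))). intro t. apply Derive_correct.
    apply (Hd (S i) t). lia.
Qed.

Lemma CmLip_Cmod_coef (m : nat) (V : R -> R) (i j : nat) : CmLip m V -> (i <= m)%nat ->
  Cmod (coef (fun t => RtoC (Derive_n V i t)) j) = INR j ^ i * Cmod (coef (fun t => RtoC (V t)) j).
Proof.
  intros HV. induction i as [|i IHi]; intro Hi.
  - simpl. ring.
  - rewrite (coef_derive (Derive_n V i) (Derive_n V (S i))).
    + rewrite !Cmod_mult, IHi, Cmod_Ci, Cmod_RtoC_nonneg by (apply pos_INR || lia). simpl. ring.
    + intro t. apply Derive_correct. apply (proj1 (proj2 HV) (S i) t). lia.
    + now apply (CmLip_Rcontinuous m).
    + apply Derive_n_periodic. exact (proj1 HV).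
Qed.

Definition sobolev_le (k : nat) (a : nat -> C) (A : R) : Prop :=
  forall N, sum_f_R0 (fun j => (INR j ^ k * Cmod (a j)) ^ 2) N <= A.

Lemma CmLip_sobolev (m : nat) (V : R -> R) : CmLip m V ->
  exists A, sobolev_le (S m) (coef (fun t => RtoC (V t))) A.
Proof.
  intro HV. destruct (proj2 (proj2 HV)) as [L HL]. exists (4 * Rabs L ^ 2). intro N.
  rewrite (sum_eq _ (fun j => (INR j * Cmod (coef (fun t => RtoC (Derive_n V m t)) j)) ^ 2)).
  - apply lipschitz_coef_sum_le.
    + apply Ccontinuous_RtoC. now apply (CmLip_Rcontinuous m).
    + intro t. now rewrite (Derive_n_periodic V m (proj1 HV)).
    + apply Rabs_pos.
    + intros x y. rewrite <- RtoC_minus, Cmod_R. eapply Rle_trans; [apply HL|].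
      apply Rmult_le_compat_r; [apply Rabs_pos | apply Rle_abs].
  - intros j _. rewrite (CmLip_Cmod_coef m) by auto. simpl. ring.
Qed.

(** * Power series on the unit circle *)

Definition summable (b : nat -> C) : Prop := ex_series (fun j => Cmod (b j)).

Definition circle_series (b : nat -> C) (t : R) : C :=
  (Series (fun j => Re (b j * eith t ^ j)), Series (fun j => Im (b j * eith t ^ j))).

Definition tail (b : nat -> C) (M : nat) : R := Series (fun j => Cmod (b (S M + j)%nat)).

Lemma is_lim_seq_sum_f_R0 (a : nat -> R) : ex_series a -> is_lim_seq (sum_f_R0 a) (Series a).
Proof.
  intro Ha. apply (is_lim_seq_ext (sum_n a));
    [intro N; apply sum_n_Reals | exact (Series_correct a Ha)].
Qed.

Lemma tail_eq (b : nat -> C) (M : nat) : summable b ->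
  tail b M = Series (fun j => Cmod (b j)) - sum_f_R0 (fun j => Cmod (b j)) M.
Proof. intro Hb. rewrite (Series_incr_n _ (S M)) by (assumption || lia). unfold tail. simpl. ring. Qed.

Lemma is_lim_seq_tail (b : nat -> C) : summable b -> is_lim_seq (tail b) 0.
Proof.
  intro Hb. set (l := Series (fun j => Cmod (b j))).
  apply (is_lim_seq_ext (fun M => l - sum_f_R0 (fun j => Cmod (b j)) M)).
  - intro M. symmetry. now apply tail_eq.
  - replace (Finite 0) with (Finite (l - l)) by (f_equal; ring).
    apply is_lim_seq_minus'; [apply is_lim_seq_const | now apply is_lim_seq_sum_f_R0].
Qed.

Lemma tail_ge_0 (b : nat -> C) (M : nat) : summable b -> 0 <= tail b M.
Proof.
  intro Hb. rewrite tail_eq by assumption.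
  assert (Hle := is_lim_seq_incr_compare _ _ (is_lim_seq_sum_f_R0 _ Hb)).
  enough (sum_f_R0 (fun j => Cmod (b j)) M <= Series (fun j => Cmod (b j))) by lra.
  apply Hle. intro N. rewrite tech5. assert (HN := Cmod_ge_0 (b (S N))). lra.
Qed.

Lemma ex_series_circle_part (part : C -> R) (b : nat -> C) (t : R) :
  (forall z, Rabs (part z) <= Cmod z) -> summable b -> ex_series (fun j => part (b j * eith t ^ j)%C).
Proof.
  intros Hpart Hb. apply (@ex_series_le R_AbsRing R_CompleteNormedModule _ (fun j => Cmod (b j)));
    [|exact Hb].
  intro j. eapply Rle_trans; [apply Hpart|]. rewrite Cmod_mult, Cmod_eith_pow. lra.
Qed.

Lemma Re_peval (b : nat -> C) (M : nat) (z : C) :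
  Re (peval b M z) = sum_f_R0 (fun j => Re (b j * z ^ j)) M.
Proof.
  induction M as [|M IHM]; [cbn; unfold Re; simpl; ring|]. now rewrite peval_S, re_plus, IHM, tech5.
Qed.

Lemma Im_peval (b : nat -> C) (M : nat) (z : C) :
  Im (peval b M z) = sum_f_R0 (fun j => Im (b j * z ^ j)) M.
Proof.
  induction M as [|M IHM]; [cbn; unfold Im; simpl; ring|]. now rewrite peval_S, im_plus, IHM, tech5.
Qed.

Lemma is_lim_seq_Re_peval (b : nat -> C) (t : R) : summable b ->
  is_lim_seq (fun M => Re (peval b M (eith t))) (Re (circle_series b t)).
Proof.
  intro Hb. apply (is_lim_seq_ext (sum_f_R0 (fun j => Re (b j * eith t ^ j)))).
  - intro M. symmetry. apply Re_peval.
  - apply is_lim_seq_sum_f_R0, ex_series_circle_part; [apply re_le_Cmod | assumption].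
Qed.

Lemma is_lim_seq_Im_peval (b : nat -> C) (t : R) : summable b ->
  is_lim_seq (fun M => Im (peval b M (eith t))) (Im (circle_series b t)).
Proof.
  intro Hb. apply (is_lim_seq_ext (sum_f_R0 (fun j => Im (b j * eith t ^ j)))).
  - intro M. symmetry. apply Im_peval.
  - apply is_lim_seq_sum_f_R0, ex_series_circle_part; [apply im_le_Cmod | assumption].
Qed.

Lemma Cmod_peval_minus_le_tail (b : nat -> C) (M N : nat) (t : R) : summable b -> (M <= N)%nat ->
  Cmod (peval b N (eith t) - peval b M (eith t)) <= tail b M.
Proof.
  intros Hb HMN. apply Rle_trans with (tail b M - tail b N); [|assert (HN := tail_ge_0 b N Hb); lra].
  rewrite !tail_eq by assumption.
  induction HMN as [|N HMN IHN].
  - replace (peval b M (eith t) - peval b M (eith t))%C with (RtoC 0) by ring. rewrite Cmod_0. lra.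
  - rewrite peval_S, tech5.
    replace (peval b N (eith t) + b (S N) * eith t ^ S N - peval b M (eith t))%C
      with (peval b N (eith t) - peval b M (eith t) + b (S N) * eith t ^ S N)%C by ring.
    eapply Rle_trans; [apply Cmod_triangle|]. rewrite Cmod_mult, Cmod_eith_pow. lra.
Qed.

Lemma Cmod_circle_series_minus_peval_le (b : nat -> C) (M : nat) (t : R) : summable b ->
  Cmod (circle_series b t - peval b M (eith t)) <= tail b M.
Proof.
  intro Hb. apply le_epsilon. intros eps Heps. assert (Heps2 : 0 < eps / 2) by lra.
  assert (HRe := proj2 (is_lim_seq_spec _ _) (is_lim_seq_Re_peval b t Hb) (mkposreal _ Heps2)).
  assert (HIm := proj2 (is_lim_seq_spec _ _) (is_lim_seq_Im_peval b t Hb) (mkposreal _ Heps2)).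
  destruct (filter_and _ _ HRe HIm) as [N0 HN0]. destruct (HN0 (max M N0) ltac:(lia)) as [HNre HNim].
  set (N := max M N0) in *.
  assert (HMN := Cmod_peval_minus_le_tail b M N t Hb ltac:(lia)).
  assert (Hlim : Cmod (peval b N (eith t) - circle_series b t) <= eps).
  { eapply Rle_trans; [apply Cmod_le_re_im|].
    change (Rabs (Re (peval b N (eith t)) - Re (circle_series b t)) < eps / 2) in HNre.
    change (Rabs (Im (peval b N (eith t)) - Im (circle_series b t)) < eps / 2) in HNim.
    change (Rabs (Re (peval b N (eith t)) - Re (circle_series b t))
      + Rabs (Im (peval b N (eith t)) - Im (circle_series b t)) <= eps). lra. }
  replace (circle_series b t - peval b M (eith t))%C with (peval b N (eith t) - peval b M (eith t)
    + - (peval b N (eith t) - circle_series b t))%C by ring.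
  eapply Rle_trans; [apply Cmod_triangle|]. rewrite Cmod_opp. lra.
Qed.

Lemma eventually_tail_le (b : nat -> C) (eps : R) : summable b -> 0 < eps ->
  eventually (fun M => tail b M <= eps).
Proof.
  intros Hb Heps.
  apply (filter_imp (fun M => Rabs (tail b M - 0) < eps));
    [|exact (proj2 (is_lim_seq_spec _ _) (is_lim_seq_tail b Hb) (mkposreal _ Heps))].
  intros M HM. assert (Habs := Rle_abs (tail b M - 0)). lra.
Qed.

Lemma disc_algebra_circle_series (b : nat -> C) : summable b -> disc_algebra (circle_series b).
Proof.
  intros Hb eps Heps. destruct (eventually_tail_le b eps Hb Heps) as [M HM].
  exists (peval b M). split; [apply polynomial_peval|]. intro t.
  eapply Rle_trans; [now apply Cmod_circle_series_minus_peval_le | apply HM; lia].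
Qed.

Lemma Cmean_circle_series (b : nat -> C) : summable b -> Cmean (circle_series b) = b 0%nat.
Proof.
  intro Hb. apply (Ceq_of_Cmod_minus_le _ _ 1). intros eps Heps. rewrite Rmult_1_l.
  destruct (eventually_tail_le b eps Hb Heps) as [M HM].
  replace (b 0%nat) with (Cmean (fun t => peval b M (eith t))).
  - assert (HF := disc_algebra_circle_series b Hb).
    rewrite <- Cmean_minus by auto with continuity.
    apply Cmod_Cmean_le_sup; [auto with continuity | lra|]. intro t.
    eapply Rle_trans; [now apply Cmod_circle_series_minus_peval_le | apply HM; lia].
  - rewrite (Cmean_polynomial _ (polynomial_peval b M)).
    destruct M as [|M]; [reflexivity|]. rewrite peval_horner. ring.
Qed.

Definition derived_coef (b : nat -> C) (j : nat) : C := (RtoC (INR j) * b j)%C.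

Lemma summable_of_derived_coef (b : nat -> C) : summable (derived_coef b) -> summable b.
Proof.
  intro Hb. unfold summable, derived_coef in *. apply ex_series_incr_1.
  apply (@ex_series_le R_AbsRing R_CompleteNormedModule _ (fun j => Cmod (RtoC (INR (S j)) * b (S j)))).
  - intro j. change (Rabs (Cmod (b (S j))) <= Cmod (RtoC (INR (S j)) * b (S j))).
    assert (Hj := pos_INR j). assert (HbSj := Cmod_ge_0 (b (S j))).
    rewrite Rabs_pos_eq, Cmod_mult, Cmod_RtoC_nonneg, S_INR by (assumption || apply pos_INR). nra.
  - now apply (ex_series_incr_1 (fun j => Cmod (RtoC (INR j) * b j))).
Qed.

Lemma is_Cderive_peval (b : nat -> C) (M : nat) (t : R) :
  is_Cderive (fun t => peval b M (eith t)) t (Ci * peval (derived_coef b) M (eith t))%C.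
Proof.
  unfold derived_coef. induction M as [|M IHM].
  - simpl. rewrite Cmult_0_l, Cmult_0_r. split; apply (is_derive_const (V := R_NormedModule)).
  - rewrite peval_S, Cmult_plus_distr_l.
    apply (is_Cderive_plus (fun t => peval b M (eith t)) (fun t => b (S M) * eith t ^ S M)%C);
      [exact IHM|].
    replace (Ci * (RtoC (INR (S M)) * b (S M) * eith t ^ S M))%C
      with (b (S M) * (RtoC (INR (S M)) * Ci * eith (INR (S M) * t)))%C by (rewrite eith_pow; ring).
    apply (is_Cderive_ext (fun t => b (S M) * eith (INR (S M) * t))%C);
      [intro x; now rewrite eith_pow|].
    apply is_Cderive_scal, is_Cderive_eith_mult.
Qed.

Lemma CVU_dom_circle_series (b : nat -> C) (part : C -> R) : summable b ->
  (forall z w, Rabs (part z - part w) <= Cmod (z - w)) ->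
  (forall t, is_lim_seq (fun M => part (peval b M (eith t))) (part (circle_series b t))) ->
  CVU_dom (fun M t => part (peval b M (eith t))) (fun _ => True).
Proof.
  intros Hb Hpart Hlim eps. assert (Heps := cond_pos eps).
  destruct (eventually_tail_le b (eps / 2) Hb ltac:(lra)) as [M0 HM0].
  exists M0. intros M HM t _. rewrite (is_lim_seq_unique _ _ (Hlim t)). simpl.
  rewrite Rabs_minus_sym. eapply Rle_lt_trans; [apply Hpart|].
  eapply Rle_lt_trans; [now apply Cmod_circle_series_minus_peval_le|].
  specialize (HM0 M HM). lra.
Qed.

Lemma Rabs_Re_minus_le (z w : C) : Rabs (Re z - Re w) <= Cmod (z - w).
Proof. exact (re_le_Cmod (z - w)). Qed.

Lemma Rabs_Im_minus_le (z w : C) : Rabs (Im z - Im w) <= Cmod (z - w).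
Proof. exact (im_le_Cmod (z - w)). Qed.

Lemma is_derive_Im_circle_series (b : nat -> C) (t : R) :
  summable (derived_coef b) ->
  is_derive (fun t => Im (circle_series b t)) t (Re (circle_series (derived_coef b) t)).
Proof.
  intro Hb'. assert (Hb := summable_of_derived_coef b Hb'). set (b' := derived_coef b) in *.
  assert (Hderive : forall M t,
            is_derive (fun t => Im (peval b M (eith t))) t (Re (peval b' M (eith t)))).
  { intros M x. destruct (is_Cderive_peval b M x) as [_ Him]. fold b' in Him.
    rewrite im_mult in Him. simpl in Him. now rewrite Rmult_0_l, Rplus_0_l, Rmult_1_l in Him. }
  assert (HDerive : forall M t, Derive (fun t => Im (peval b M (eith t))) t = Re (peval b' M (eith t)))
    by (intros M x; apply is_derive_unique, Hderive).
  assert (HCVU := CVU_Derive (fun M t => Im (peval b M (eith t))) (fun _ => True) open_true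
            (fun _ _ _ _ _ _ => I)).
  assert (Hderiv_uniform := CVU_dom_circle_series b' Re Hb' Rabs_Re_minus_le
            (fun t => is_lim_seq_Re_peval b' t Hb')).
  apply (is_derive_ext (fun y => real (Lim_seq (fun M => Im (peval b M (eith y)))))).
  - intro y. now rewrite (is_lim_seq_unique _ _ (is_lim_seq_Im_peval b y Hb)).
  - replace (Re (circle_series b' t))
      with (real (Lim_seq (fun M => Derive (fun t => Im (peval b M (eith t))) t))).
    + apply HCVU; auto.
      * apply (CVU_dom_circle_series b Im Hb Rabs_Im_minus_le). intro x. now apply is_lim_seq_Im_peval.
      * intros M x _. eexists. apply Hderive.
      * intros M x _. apply (continuity_pt_ext (fun t => Re (peval b' M (eith t)))); [now intro|].
        apply continuity_pt_filterlim. apply (Rcontinuous_Re (fun t => peval b' M (eith t))).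
        auto with continuity.
      * intro eps. destruct (Hderiv_uniform eps) as [M0 HM0]. exists M0.
        intros M HM x Hx. rewrite HDerive.
        rewrite (Lim_seq_ext _ (fun M => Re (peval b' M (eith x)))) by (intro; apply HDerive).
        now apply HM0.
    + rewrite (Lim_seq_ext _ (fun M => Re (peval b' M (eith t)))) by (intro; apply HDerive).
      now rewrite (is_lim_seq_unique _ _ (is_lim_seq_Re_peval b' t Hb')).
Qed.

Lemma circle_series_periodic (b : nat -> C) : periodic (circle_series b).
Proof.
  intro t. unfold circle_series. f_equal; apply Series_ext; intro j; now rewrite eith_periodic.
Qed.

Lemma periodic_IZR (f : R -> R) (z : Z) (t : R) : periodic f -> f (t + IZR z * (2 * PI)) = f t.
Proof.
  intro Hper. revert t.
  assert (Hnat : forall n t, f (t + INR n * (2 * PI)) = f t).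
  { induction n as [|n IHn]; intro t; [f_equal; simpl; ring|].
    rewrite S_INR. replace (t + (INR n + 1) * (2 * PI)) with (t + INR n * (2 * PI) + 2 * PI) by ring.
    now rewrite Hper, IHn. }
  intro t. destruct (Z.le_gt_cases 0 z) as [Hz | Hz].
  - rewrite <- (Z2Nat.id z), <- INR_IZR_INZ by lia. apply Hnat.
  - rewrite <- (Hnat (Z.to_nat (- z)) (t + _)). f_equal.
    rewrite INR_IZR_INZ, Z2Nat.id, opp_IZR by lia. ring.
Qed.

Lemma periodic_positive_bounded_below (f : R -> R) : Rcontinuous f -> periodic f ->
  (forall t, 0 < f t) -> exists c, 0 < c /\ forall t, c <= f t.
Proof.
  intros Hf Hper Hpos. assert (HPI := PI_RGT_0).
  destruct (continuity_ab_min f (- PI) PI) as (t0 & Hmin & _); [lra | |].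
  - intros t _. apply continuity_pt_filterlim, Hf.
  - exists (f t0). split; [apply Hpos|]. intro t.
    destruct (archimed ((t - PI) / (2 * PI))) as [Hup1 Hup2]. set (z := up _) in *.
    assert (Hdiv : (t - PI) / (2 * PI) * (2 * PI) = t - PI) by (field; lra).
    rewrite <- (periodic_IZR f (- z) t Hper). apply Hmin. rewrite opp_IZR. split; nra.
Qed.

(** * The Fourier series of a differentiable function *)

Definition slope_at_0 (f : R -> R) (l t : R) : R := if Req_dec_T t 0 then l else f t / t.

Lemma slope_at_0_Rcontinuous (f : R -> R) (l : R) : Rcontinuous f -> f 0 = 0 -> is_derive f 0 l ->
  Rcontinuous (slope_at_0 f l).
Proof.
  intros Hf Hf0 Hl t. destruct (Req_dec_T t 0) as [-> | Ht].
  - apply continuity_pt_filterlim. intros eps Heps.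
    apply is_derive_Reals in Hl. destruct (Hl eps Heps) as (del & Hdel).
    exists del. split; [apply cond_pos|]. intros y [[_ Hy0] Hy]. simpl in *. unfold Rdist in *.
    unfold slope_at_0. destruct (Req_dec_T 0 0) as [_ |]; [|lra].
    destruct (Req_dec_T y 0) as [-> | Hy']; [now exfalso|].
    rewrite Rminus_0_r in Hy. specialize (Hdel y Hy' Hy).
    now rewrite Rplus_0_l, Hf0, Rminus_0_r in Hdel.
  - apply (continuous_ext_loc _ (fun t => f t * / t)).
    + exists (mkposreal _ (Rabs_pos_lt t Ht)). intros y Hy. change (Rabs (y - t) < Rabs t) in Hy.
      unfold slope_at_0. destruct (Req_dec_T y 0) as [-> |]; [|reflexivity].
      rewrite Rminus_0_l, Rabs_Ropp in Hy. lra.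
    + apply (continuous_mult f (fun t => / t)); [apply Hf | now apply continuous_Rinv].
Qed.

Lemma sin_half_neq_0 (t : R) : t <> 0 -> - PI <= t <= PI -> sin (t / 2) <> 0.
Proof.
  intros Ht Hbound. destruct (Rlt_le_dec 0 t) as [Hpos | Hneg].
  - apply Rgt_not_eq, sin_gt_0; lra.
  - apply Rlt_not_eq, Ropp_lt_cancel. rewrite Ropp_0, <- sin_neg. apply sin_gt_0; lra.
Qed.

Lemma divide_by_sin_half (f : R -> R) : Rcontinuous f -> f 0 = 0 -> ex_derive f 0 ->
  exists rho, Rcontinuous rho /\ forall t, - PI < t < PI -> f t = rho t * sin (t / 2).
Proof.
  intros Hf Hf0 [l Hl]. set (s := fun t => sin (t / 2)).
  assert (Hs : Rcontinuous s) by (unfold s; auto with continuity).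
  assert (Hs0 : s 0 = 0) by (unfold s; rewrite Rdiv_0_l; apply sin_0).
  assert (Hsl : is_derive s 0 (1 / 2)).
  { unfold s. auto_derive; auto. rewrite Rmult_0_l, cos_0. field. }
  assert (Hneq : forall t, - PI <= t <= PI -> slope_at_0 s (1 / 2) t <> 0).
  { intros t Ht. unfold slope_at_0. destruct (Req_dec_T t 0) as [| Hneq]; [lra|].
    apply Rmult_integral_contrapositive.
    split; [now apply sin_half_neq_0 | now apply Rinv_neq_0_compat]. }
  destruct (prolongement_C0 (fun t => slope_at_0 f l t / slope_at_0 s (1 / 2) t) (- PI) PI)
    as (rho & Hrho & Heq).
  - assert (HPI := PI_RGT_0). lra.
  - intros t Ht. apply continuity_pt_div; [| |now apply Hneq];
      apply continuity_pt_filterlim; now apply slope_at_0_Rcontinuous.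
  - exists rho. split; [intro t; apply continuity_pt_filterlim, Hrho|]. intros t Ht.
    rewrite Heq by lra. specialize (Hneq t ltac:(lra)). unfold slope_at_0 in *.
    destruct (Req_dec_T t 0) as [-> | Ht0].
    + rewrite Rdiv_0_l, sin_0, Hf0. ring.
    + unfold s in *. field. split; [assumption | apply sin_half_neq_0; lra].
Qed.

Lemma divide_by_eith_minus_1 (f : R -> R) : Rcontinuous f -> f 0 = 0 -> ex_derive f 0 ->
  exists g, Ccontinuous g /\ forall t, - PI < t < PI ->
  RtoC (f t) = ((eith t - 1) * g t)%C /\ Re ((eith t + 1) * g t) = 0.
Proof.
  intros Hf Hf0 Hd. destruct (divide_by_sin_half f Hf Hf0 Hd) as (rho & Hrho & Heq).
  exists (fun t => (- Ci / 2) * (RtoC (rho t) * Cconj (eith (t / 2))))%C.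
  split; [auto 6 with continuity|]. intros t Ht.
  assert (Hhalf := eith_conj_mult (t / 2)).
  replace (eith t) with (eith (t / 2) * eith (t / 2))%C by (rewrite <- eith_plus; f_equal; field).
  set (e := eith (t / 2)) in *. split.
  - transitivity ((- Ci / 2) * RtoC (rho t) * (e * (Cconj e * e) - Cconj e))%C; [|ring].
    rewrite Hhalf, Heq by assumption.
    unfold e, eith, Cconj, Ci, RtoC, Cdiv, Cinv, Cmult, Cminus, Copp, Cplus.
    simpl. f_equal; field.
  - replace ((e * e + 1) * (- Ci / 2 * (RtoC (rho t) * Cconj e)))%C
      with ((- Ci / 2) * RtoC (rho t) * (e * (Cconj e * e) + Cconj e))%C by ring.
    rewrite Hhalf. unfold e, eith, Cconj, Ci, RtoC, Cdiv, Cinv, Cmult, Cminus, Copp, Cplus. simpl.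
    field.
Qed.

(* The coefficients a_j of the Szego function exp (sum a_j z^j), whose modulus on the circle is
   exp (V / 2). *)
Definition szego_coef (V : R -> R) (j : nat) : C :=
  match j with O => RtoC (V0 V / 2) | S _ => coef (fun t => RtoC (V t)) j end.

Lemma coef_increment (V : R -> R) (x : R) (j : nat) : Rcontinuous V -> periodic V ->
  coef (fun t => RtoC (V (t + x) - V x)) (S j) = (eith x ^ S j * coef (fun t => RtoC (V t)) (S j))%C.
Proof.
  intros HV Hper. rewrite <- coef_translate by (auto with continuity || (intro t; now rewrite Hper)).
  assert (HVx := Ccontinuous_translate _ x (Ccontinuous_RtoC V HV)). cbv beta in HVx.
  transitivity (coef (fun t => RtoC (V (t + x)%R) + - RtoC (V x) * eith t ^ 0)%C (S j)).
  - apply Cmean_ext. intro t. rewrite RtoC_minus. change (eith t ^ 0)%C with (RtoC 1). ring.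
  - rewrite coef_plus, coef_scal, coef_eith_pow by auto with continuity. cbn [Nat.eqb]. ring.
Qed.

(* Chernoff's argument: dividing V (t + x) - V x by e^{it} - 1 makes the partial sums telescope. *)
Lemma Re_peval_szego_coef (V : R -> R) (x : R) (g : R -> C) (m : nat) : Rcontinuous V -> periodic V ->
  Ccontinuous g -> (forall t, - PI < t < PI ->
    RtoC (V (t + x) - V x) = ((eith t - 1) * g t)%C /\ Re ((eith t + 1) * g t) = 0) ->
  2 * Re (peval (szego_coef V) m (eith x)) - V x = - 2 * Re (coef g m).
Proof.
  intros HV Hper Hg Hquot.
  assert (HVx : Rcontinuous (fun t => V (t + x)))
    by (apply (Rcontinuous_comp (fun t => t + x) V); auto with continuity).
  induction m as [|m IHm].
  - assert (Hsum : Rmean (fun t => Re (eith t * g t)) + Rmean (fun t => Re (g t)) = 0).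
    { rewrite <- Rmean_plus, <- (Rmean_const 0) by auto with continuity.
      apply Rmean_ext_in. intros t Ht. rewrite <- re_plus, <- (proj2 (Hquot t Ht)). f_equal. ring. }
    assert (Hdiff : V0 V - V x = Rmean (fun t => Re (eith t * g t)) - Rmean (fun t => Re (g t))).
    { change (V0 V) with (Rmean V). rewrite <- (Rmean_translate V x HV Hper), <- (Rmean_const (V x)).
      rewrite <- !Rmean_minus by auto with continuity.
      apply Rmean_ext_in. intros t Ht. destruct (Hquot t Ht) as [Hfg _].
      apply (f_equal Re) in Hfg. rewrite re_RtoC in Hfg. rewrite Hfg. simpl. unfold Re, Im. ring. }
    unfold coef. rewrite (Cmean_ext _ g) by (intro t; simpl; rewrite Cconj_RtoC; ring).
    rewrite Cmean_pair. simpl. lra.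
  - assert (Hterm : (szego_coef V (S m) * eith x ^ S m)%C = (coef g m - coef g (S m))%C).
    { simpl szego_coef. rewrite Cmult_comm, <- coef_increment by assumption.
      unfold coef. rewrite <- Cmean_minus by auto with continuity.
      apply Cmean_ext_in. intros t Ht. rewrite (proj1 (Hquot t Ht)), Cpow_S, Cmult_conj.
      transitivity (g t * Cconj (eith t ^ m) * (Cconj (eith t) * eith t)
        - g t * (Cconj (eith t) * Cconj (eith t ^ m)))%C; [ring|]. rewrite eith_conj_mult. ring. }
    rewrite peval_S, re_plus, Hterm. unfold Cminus. rewrite re_plus, re_opp. lra.
Qed.

Lemma is_lim_seq_Re_peval_szego_coef (V : R -> R) (x : R) :
  Rcontinuous V -> periodic V -> ex_derive V x ->
  is_lim_seq (fun m => 2 * Re (peval (szego_coef V) m (eith x))) (V x).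
Proof.
  intros HV Hper [l Hl].
  assert (HVx : Rcontinuous (fun t => V (t + x)))
    by (apply (Rcontinuous_comp (fun t => t + x) V); auto with continuity).
  destruct (divide_by_eith_minus_1 (fun t => V (t + x) - V x)) as (g & Hg & Hquot).
  - auto with continuity.
  - rewrite Rplus_0_l. ring.
  - exists l. auto_derive.
    + rewrite Rplus_0_l. now exists l.
    + rewrite Rplus_0_l, (is_derive_unique (fun x : R => V x) x l Hl). ring.
  - apply (is_lim_seq_ext (fun m => V x + - 2 * Re (coef g m))).
    { intro m. rewrite <- (Re_peval_szego_coef V x g m) by assumption. ring. }
    replace (Finite (V x)) with (Finite (V x + - 2 * 0)) by (f_equal; ring).
    apply is_lim_seq_plus'; [apply is_lim_seq_const|].
    apply (is_lim_seq_scal_l (fun m => Re (coef g m)) (- 2) 0).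
    apply is_lim_seq_abs_0, (is_lim_seq_le_le (fun _ => 0) _ (fun m => Cmod (coef g m))).
    + intro m. split; [apply Rabs_pos | apply re_le_Cmod].
    + apply is_lim_seq_const.
    + now apply Riemann_Lebesgue.
Qed.

Lemma sobolev_szego_coef (k : nat) (V : R -> R) (A : R) :
  sobolev_le (S k) (coef (fun t => RtoC (V t))) A -> sobolev_le (S k) (szego_coef V) A.
Proof.
  intros HV N. rewrite (sum_eq _ (fun j => (INR j ^ S k * Cmod (coef (fun t => RtoC (V t)) j)) ^ 2)).
  - apply HV.
  - intros [|j] _; [simpl; ring | reflexivity].
Qed.

Lemma sum_inv_sqr_le (N : nat) : sum_f_R0 (fun j => / INR (S j) ^ 2) N <= 2.
Proof.
  enough (Htel : sum_f_R0 (fun j => / INR (S j) ^ 2) N <= 2 - / INR (S N)).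
  { assert (Hpos : 0 < / INR (S N)) by (apply Rinv_0_lt_compat, lt_0_INR; lia). lra. }
  induction N as [|N IHN]; [simpl; lra|].
  rewrite tech5. assert (HN : 0 < INR (S N)) by (apply lt_0_INR; lia). rewrite (S_INR (S N)).
  assert (Hterm : / (INR (S N) + 1) ^ 2 <= / INR (S N) - / (INR (S N) + 1)); [|lra].
  replace (/ INR (S N) - / (INR (S N) + 1)) with (/ (INR (S N) * (INR (S N) + 1))) by (field; lra).
  apply Rinv_le_contravar; nra.
Qed.

Lemma summable_derived_coef (k : nat) (a : nat -> C) (A : R) : (2 <= k)%nat -> sobolev_le k a A ->
  summable (derived_coef a).
Proof.
  intros Hk HA. unfold summable, derived_coef.
  apply (ex_series_incr_1 (fun j => Cmod (RtoC (INR j) * a j))).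
  apply (ex_series_of_bounded_partial_sums _ (A / 2 + 1)); [intro j; apply Cmod_ge_0|].
  intro N. set (x := fun j => INR (S j) ^ k * Cmod (a (S j))).
  assert (Hshift : sum_f_R0 (fun j => x j ^ 2) N <= A).
  { eapply Rle_trans; [|apply (HA (S N))]. rewrite (decomp_sum _ (S N)) by lia. cbn [pred]. unfold x.
    assert (Hterm0 := pow2_ge_0 (INR 0 ^ k * Cmod (a 0%nat))). lra. }
  apply Rle_trans with (sum_f_R0 (fun j => x j ^ 2 * / 2 + / INR (S j) ^ 2 * / 2) N).
  - apply sum_Rle. intros j _.
    assert (HSj : 1 <= INR (S j)) by (rewrite S_INR; assert (Hj := pos_INR j); lra).
    assert (Hpow : INR (S j) ^ 2 <= INR (S j) ^ k) by (apply Rle_pow; [assumption | lia]).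
    assert (Ha := Cmod_ge_0 (a (S j))). rewrite Cmod_mult, Cmod_RtoC_nonneg by lra.
    assert (Hle : INR (S j) * Cmod (a (S j)) <= x j * / INR (S j)).
    { unfold x. apply (Rle_div_r _ _ (INR (S j))); [lra|].
      replace (INR (S j) * Cmod (a (S j)) * INR (S j)) with (INR (S j) ^ 2 * Cmod (a (S j))) by ring.
      now apply Rmult_le_compat_r. }
    assert (Hsqr := pow2_ge_0 (x j - / INR (S j))).
    rewrite <- pow_inv. nra.
  - rewrite sum_plus, <- !scal_sum. assert (Hinv := sum_inv_sqr_le N). lra.
Qed.

Section SzegoExponent.

Variables (k : nat) (V : R -> R) (A : R).
Hypothesis k_ge_2 : (2 <= k)%nat.
Hypothesis V_smooth : CmLip (k - 1) V.
Hypothesis V_sobolev : sobolev_le k (szego_coef V) A.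

Let a := szego_coef V.
Let a' := derived_coef a.

Lemma summable_szego_coef : summable a.
Proof. now apply summable_of_derived_coef, (summable_derived_coef k a A). Qed.

Lemma potential_eq_Re_circle_series (t : R) : V t = 2 * Re (circle_series a t).
Proof.
  assert (HV := is_lim_seq_Re_peval_szego_coef V t (CmLip_Rcontinuous (k - 1) V 0 V_smooth ltac:(lia))
            (proj1 V_smooth) (proj1 (proj2 V_smooth) 1%nat t ltac:(lia))).
  assert (Hseries := is_lim_seq_scal_l _ 2 _ (is_lim_seq_Re_peval a t summable_szego_coef)).
  apply is_lim_seq_unique in HV. apply is_lim_seq_unique in Hseries.
  unfold a in Hseries. rewrite HV in Hseries. now injection Hseries.
Qed.

Lemma fourier_opp (j : nat) : fourier V (- Z.of_nat j) = Cconj (coef (fun t => RtoC (V t)) j).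
Proof.
  assert (HV := CmLip_Rcontinuous (k - 1) V 0 V_smooth ltac:(lia)). unfold coef.
  rewrite <- Cmean_conj by auto with continuity. apply Cmean_ext. intro t.
  rewrite Cmult_conj, Cconj_conj, Cconj_RtoC, eith_pow, INR_IZR_INZ, <- opp_IZR, Z.opp_involutive.
  reflexivity.
Qed.

Lemma kappa_eq_Im_circle_series (t : R) : kappa V t = t - 2 * Im (circle_series a t).
Proof.
  unfold kappa, Omega. cbn [circle_series Im snd].
  rewrite (Series_incr_1 (fun j => Im (a j * eith t ^ j)))
    by exact (ex_series_circle_part Im a t im_le_Cmod summable_szego_coef).
  rewrite (Series_ext _ (fun j => - Im (a (S j) * eith t ^ S j))).
  - rewrite Series_opp. simpl (Im (a 0%nat * eith t ^ 0)). ring.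
  - intro j. rewrite fourier_opp, <- eith_pow_conj, <- Cmult_conj, im_conj. reflexivity.
Qed.

Lemma kappa_derivative_bounded_below :
  (forall t, exists d, is_derive (kappa V) t d /\ 0 < d) ->
  exists c, 0 < c /\ forall t, c <= 1 - 2 * Re (circle_series a' t).
Proof.
  intro Hkappa. assert (Ha' := summable_derived_coef k a A k_ge_2 V_sobolev).
  apply periodic_positive_bounded_below.
  - assert (Hcont := disc_algebra_Ccontinuous _ (disc_algebra_circle_series a' Ha')).
    auto 7 with continuity.
  - intro t. now rewrite circle_series_periodic.
  - intro t. destruct (Hkappa t) as (d & Hd & Hpos).
    assert (Hd' : is_derive (kappa V) t (1 - 2 * Re (circle_series a' t))).
    { apply (is_derive_ext (fun t => t - 2 * Im (circle_series a t)));
        [intro x; symmetry; apply kappa_eq_Im_circle_series|].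
      apply (is_derive_minus (V := R_NormedModule)); [apply (is_derive_id (K := R_AbsRing))|].
      apply is_derive_scal, is_derive_Im_circle_series, Ha'. }
    apply is_derive_unique in Hd. apply is_derive_unique in Hd'. rewrite <- Hd', Hd. assumption.
Qed.

End SzegoExponent.

(** * Bounds for the phase *)

Lemma hankel_le_weaken (u : R -> C) (d d' : R) : hankel_le u d -> d <= d' -> hankel_le u d'.
Proof.
  intros Hu Hd f g Hf Hg. eapply Rle_trans; [now apply Hu|].
  apply Rmult_le_compat_r; [|assumption]. apply Rmult_le_pos; apply L2norm_ge_0.
Qed.

Lemma nonpositive_le_weaken (u : R -> C) (e e' : R) :
  nonpositive_le u e -> e <= e' -> nonpositive_le u e'.
Proof.
  intros Hu He f Hf. eapply Rle_trans; [now apply Hu|].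
  apply Rmult_le_compat_r; [apply L2norm_ge_0 | assumption].
Qed.

Lemma Cmod_phase_minus_le (n : nat) (f g : R -> C) (t : R) :
  Cmod (phase n f t - phase n g t) <= 2 * Cmod (f t - g t).
Proof.
  unfold phase. replace (eith t ^ n * eith (2 * Im (f t)) - eith t ^ n * eith (2 * Im (g t)))%C
    with (eith t ^ n * (eith (2 * Im (f t)) - eith (2 * Im (g t))))%C by ring.
  rewrite Cmod_mult, Cmod_eith_pow, Rmult_1_l. eapply Rle_trans; [apply eith_lipschitz|].
  rewrite <- Rmult_minus_distr_l, Rabs_mult, Rabs_pos_eq by lra.
  apply Rmult_le_compat_l; [lra | apply Rabs_Im_minus_le].
Qed.

(* The Laurent polynomial that equals - 2 i n Im (peval a M) on the unit circle. *)
Definition phase_exponent (n : nat) (a : nat -> C) (M : nat) (z : C) : C :=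
  (RtoC (INR n) * Cconj (peval a M (Cconj (/ z))) + RtoC (- INR n) * peval a M z)%C.

Lemma laurent_phase_exponent (n : nat) (a : nat -> C) (M : nat) : laurent (phase_exponent n a M).
Proof.
  assert (HG := polynomial_peval a M).
  apply laurent_plus; [|now apply laurent_polynomial, polynomial_scal].
  exact (laurent_polynomial_inv _ (polynomial_scal _ _ (polynomial_conj _ HG))).
Qed.

Lemma phase_peval_eq (n : nat) (a : nat -> C) (M : nat) (t : R) :
  phase n (fun t => RtoC (- INR n) * peval a M (eith t))%C t =
  (cexp (phase_exponent n a M (eith t)) * eith t ^ n)%C.
Proof.
  unfold phase, phase_exponent. rewrite eith_inv, Cconj_conj, (eith_cexp (2 * _)), Cmult_comm.
  do 2 f_equal. destruct (peval a M (eith t)) as [x y].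
  unfold Cconj, Cmult, Cplus, RtoC, Im; simpl. f_equal; ring.
Qed.

Lemma Cmod_cexp_phase_exponent (n : nat) (a : nat -> C) (M : nat) (eta t : R) :
  Cmod (cexp (phase_exponent n a M (RtoC (exp (- eta)) * eith t)) * (RtoC (exp (- eta)) * eith t) ^ n) =
  exp (INR n * (Re (peval a M (RtoC (exp eta) * eith t))
                - Re (peval a M (RtoC (exp (- eta)) * eith t)) - eta)).
Proof.
  assert (Hpos := exp_pos (- eta)). unfold phase_exponent. rewrite circle_inv, Cconj_conj by lra.
  rewrite Cmod_mult, Cmod_cexp, Cmod_pow, Cmod_mult, Cmod_eith, Rmult_1_r, Cmod_RtoC_nonneg by lra.
  rewrite <- exp_INR_mult, <- exp_plus, re_plus, !re_scal_l, re_conj, <- exp_Ropp, Ropp_involutive.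
  f_equal. ring.
Qed.

(* Cauchy's theorem moves the mean to the circle of radius exp (- eta). *)
Lemma hankel_le_phase_peval (a : nat -> C) (M n : nat) (eta del : R) : 0 <= eta ->
  (forall t, exp (INR n * (Re (peval a M (RtoC (exp eta) * eith t))
                           - Re (peval a M (RtoC (exp (- eta)) * eith t)) - eta)) <= del) ->
  hankel_le (phase n (fun t => RtoC (- INR n) * peval a M (eith t))%C) del.
Proof.
  intros Heta Hdel f g Hf Hg. set (r := exp (- eta)). set (W := phase_exponent n a M).
  assert (Hr : 0 < r) by apply exp_pos. assert (Hr0 : r <> 0) by lra.
  assert (Hr1 : 0 <= r <= 1) by (split; [lra | unfold r; rewrite <- exp_0; apply exp_le; lra]).
  assert (HW : laurent W) by apply laurent_phase_exponent.
  assert (Hh : laurent (fun z => z ^ n * (f z * g z))%C)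
    by exact (laurent_polynomial _
         (polynomial_mult _ _ (polynomial_monomial n) (polynomial_mult f g Hf Hg))).
  rewrite (Cmean_ext _ (fun t => cexp (W (eith t)) * (eith t ^ n * (f (eith t) * g (eith t))))%C)
    by (intro t; rewrite phase_peval_eq; unfold W; ring).
  rewrite <- (Cmean_circle_cexp_laurent W _ r Hr0 HW Hh).
  set (u := fun t => (cexp (W (RtoC r * eith t)) * (RtoC r * eith t) ^ n)%C).
  assert (Hu : Ccontinuous u).
  { apply Ccontinuous_mult; [|auto with continuity].
    now apply Ccontinuous_cexp, Ccontinuous_laurent. }
  assert (Hule : forall t, Cmod (u t) <= del)
    by (intro t; unfold u, W, r; rewrite Cmod_cexp_phase_exponent; apply Hdel).
  assert (Hdel0 := Rle_trans _ _ _ (Cmod_ge_0 _) (Hule 0)).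
  rewrite (Cmean_ext _ (fun t => u t * f (RtoC r * eith t) * g (RtoC r * eith t))%C)
    by (intro t; unfold u; ring).
  eapply Rle_trans;
    [apply (Cauchy_Schwarz (fun t => u t * f (RtoC r * eith t))%C); auto with continuity|].
  rewrite <- Rmult_assoc.
  apply Rmult_le_compat; [apply L2norm_ge_0 | apply L2norm_ge_0 | | now apply L2norm_circle_le].
  eapply Rle_trans; [apply (L2norm_mult_le u _ del); auto with continuity|].
  apply Rmult_le_compat_l; [assumption | now apply L2norm_circle_le].
Qed.

Lemma exp_taylor_le (x : R) : Rabs (exp x - 1 - x) <= x ^ 2 * exp (Rabs x).
Proof.
  assert (Htaylor := cexp_taylor_le (RtoC x)). rewrite cexp_RtoC, Cmod_R, pow2_abs in Htaylor.
  now rewrite <- !RtoC_minus, Cmod_R in Htaylor.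
Qed.

Lemma two_sinh_taylor_le (x : R) : 0 <= x -> Rabs (exp x - exp (- x) - 2 * x) <= 2 * x ^ 2 * exp x.
Proof.
  intro Hx. assert (Hpos := exp_taylor_le x). assert (Hneg := exp_taylor_le (- x)).
  rewrite Rabs_Ropp, (Rabs_pos_eq x Hx) in *. replace ((- x) ^ 2) with (x ^ 2) in Hneg by ring.
  replace (exp x - exp (- x) - 2 * x) with (exp x - 1 - x + - (exp (- x) - 1 - - x)) by ring.
  eapply Rle_trans; [apply Rabs_triang|]. rewrite (Rabs_Ropp (exp (- x) - 1 - - x)). lra.
Qed.

Lemma Re_peval_shift_le (a : nat -> C) (M : nat) (eta t : R) : 0 <= eta ->
  Re (peval a M (RtoC (exp eta) * eith t)) - Re (peval a M (RtoC (exp (- eta)) * eith t)) <=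
  2 * eta * Re (peval (derived_coef a) M (eith t))
  + 2 * eta ^ 2 * exp (INR M * eta) * sum_f_R0 (fun j => INR j ^ 2 * Cmod (a j)) M.
Proof.
  intro Heta.
  set (s := fun j => exp (INR j * eta) - exp (- (INR j * eta)) - 2 * (INR j * eta)).
  assert (Hdiff : (peval a M (RtoC (exp eta) * eith t) - peval a M (RtoC (exp (- eta)) * eith t)
            - RtoC (2 * eta) * peval (derived_coef a) M (eith t))%C
          = peval (fun j => RtoC (s j) * a j)%C M (eith t)).
  { rewrite !peval_dilate, <- peval_scal. unfold Cminus.
    rewrite <- (Cmult_1_l (peval (fun j => _ * derived_coef a _)%C M _)).
    transitivity (peval (fun j => RtoC (exp eta) ^ j * a j + (-(1)) * (RtoC (exp (- eta)) ^ j * a j)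
      + (-(1)) * (RtoC (2 * eta) * derived_coef a j))%C M (eith t)).
    - rewrite !peval_plus, !peval_scal. ring.
    - apply peval_ext. intros j _. unfold s, derived_coef. rewrite <- !RtoC_pow, <- !exp_INR_mult.
      rewrite !RtoC_minus, !RtoC_mult, <- Ropp_mult_distr_r. ring. }
  assert (Hbound : Cmod (peval (fun j => RtoC (s j) * a j)%C M (eith t)) <=
            2 * eta ^ 2 * exp (INR M * eta) * sum_f_R0 (fun j => INR j ^ 2 * Cmod (a j)) M).
  { eapply Rle_trans; [apply Cmod_peval_le|]. rewrite scal_sum. apply sum_Rle. intros j Hj.
    assert (Hj0 := pos_INR j). assert (Ha := Cmod_ge_0 (a j)). rewrite Cmod_mult, Cmod_R.
    replace (INR j ^ 2 * Cmod (a j) * (2 * eta ^ 2 * exp (INR M * eta)))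
      with (2 * (INR j * eta) ^ 2 * exp (INR M * eta) * Cmod (a j)) by ring.
    apply Rmult_le_compat_r; [assumption|].
    eapply Rle_trans; [apply two_sinh_taylor_le; nra|].
    apply Rmult_le_compat_l; [assert (Hsqr := pow2_ge_0 (INR j * eta)); lra|].
    apply exp_le, Rmult_le_compat_r, le_INR; assumption. }
  rewrite <- Hdiff in Hbound.
  assert (Hre := Rle_trans _ _ _ (Rle_abs _) (Rle_trans _ _ _ (re_le_Cmod _) Hbound)).
  unfold Cminus in Hre. rewrite !re_plus, !re_opp, re_scal_l in Hre. lra.
Qed.

Lemma sum_sqr_le (x : nat -> R) (N : nat) :
  sum_f_R0 x N ^ 2 <= INR (S N) * sum_f_R0 (fun j => x j ^ 2) N.
Proof.
  induction N as [|N IHN]; [simpl; lra|]. rewrite !tech5, (S_INR (S N)).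
  set (X := sum_f_R0 x N) in *. set (Q := sum_f_R0 (fun j => x j ^ 2) N) in *.
  set (m := INR (S N)) in *. assert (Hm : 0 < m) by (apply lt_0_INR; lia).
  assert (HQ : X ^ 2 / m <= Q) by (apply Rle_div_l; lra).
  assert (Hsqr : 0 <= (X - m * x (S N)) ^ 2 / m)
    by (apply Rdiv_le_0_compat; [apply pow2_ge_0 | assumption]).
  replace ((X - m * x (S N)) ^ 2 / m) with (X ^ 2 / m - 2 * X * x (S N) + m * x (S N) ^ 2) in Hsqr
    by (field; lra).
  nra.
Qed.

Lemma sobolev_sum_sqr_weight_le (k : nat) (a : nat -> C) (A : R) (M : nat) : (2 <= k)%nat ->
  sobolev_le k a A -> sum_f_R0 (fun j => INR j ^ 2 * Cmod (a j)) M <= sqrt (INR (S M)) * sqrt A.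
Proof.
  intros Hk HA.
  assert (Hterm : forall j, 0 <= INR j ^ 2 * Cmod (a j) <= INR j ^ k * Cmod (a j)).
  { intro j. assert (Ha := Cmod_ge_0 (a j)). assert (Hj := pow2_ge_0 (INR j)).
    split; [now apply Rmult_le_pos|]. apply Rmult_le_compat_r; [assumption|].
    destruct j as [|j]; [rewrite !pow_i by lia; lra|].
    apply Rle_pow; [rewrite S_INR; assert (Hj' := pos_INR j); lra | assumption]. }
  rewrite <- sqrt_mult_alt by apply pos_INR.
  rewrite <- (sqrt_pow2 (sum_f_R0 _ M)) by (apply cond_pos_sum; apply Hterm). apply sqrt_le_1_alt.
  eapply Rle_trans; [apply sum_sqr_le|]. apply Rmult_le_compat_l; [apply pos_INR|].
  eapply Rle_trans; [|apply (HA M)]. apply sum_Rle. intros j _. now apply pow_incr.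
Qed.

Lemma L2norm_peval_tail_le (k : nat) (a : nat -> C) (A : R) (M N : nat) :
  sobolev_le k a A -> (M <= N)%nat ->
  L2norm (fun t => peval a N (eith t) - peval a M (eith t))%C <= sqrt A / INR (S M) ^ k.
Proof.
  intros HA HMN. set (b := fun j => if Nat.leb j M then RtoC 0 else a j).
  assert (Hb : forall z, (peval a N z - peval a M z)%C = peval b N z).
  { intro z. induction HMN as [|N HMN IHN].
    - rewrite (peval_ext b (fun j => 0 * a j)%C), peval_scal; [ring|].
      intros j Hj. unfold b. destruct (Nat.leb_spec j M); [ring | lia].
    - rewrite (peval_S b), <- IHN, peval_S. unfold b. destruct (Nat.leb_spec (S N) M); [lia | ring]. }
  rewrite (L2norm_ext _ _ (fun t => Hb (eith t))). unfold L2norm. rewrite sqnorm_peval.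
  assert (HM : 0 < INR (S M) ^ k) by (apply pow_lt, lt_0_INR; lia).
  rewrite <- (sqrt_pow2 (INR (S M) ^ k)), <- sqrt_div_alt by (lra || now apply pow_lt).
  apply sqrt_le_1_alt. apply Rle_div_r; [now apply pow_lt|].
  rewrite Rmult_comm, scal_sum. eapply Rle_trans; [|apply (HA N)]. apply sum_Rle. intros j _.
  rewrite <- Rpow_mult_distr. unfold b. destruct (Nat.leb_spec j M) as [Hj | Hj].
  - rewrite Cmod_0, Rmult_0_l, pow_i by lia. apply pow2_ge_0.
  - assert (Ha := Cmod_ge_0 (a j)). apply pow_incr. split; [apply Rmult_le_pos; lra|].
    rewrite Rmult_comm. apply Rmult_le_compat_r; [assumption|].
    apply pow_incr. split; [apply pos_INR | apply le_INR; lia].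
Qed.

Lemma L2norm_circle_series_minus_peval_le (k : nat) (a : nat -> C) (A : R) (M : nat) :
  summable a -> sobolev_le k a A ->
  L2norm (fun t => circle_series a t - peval a M (eith t))%C <= sqrt A / INR (S M) ^ k.
Proof.
  intros Ha HA. apply le_epsilon. intros eps Heps.
  destruct (eventually_tail_le a eps Ha Heps) as [N0 HN0]. set (N := max N0 M).
  assert (HF := disc_algebra_circle_series a Ha).
  rewrite (L2norm_ext _ (fun t => peval a N (eith t) - peval a M (eith t)
    + (circle_series a t - peval a N (eith t)))%C) by (intro; ring).
  eapply Rle_trans; [apply L2norm_triangle; auto with continuity|]. apply Rplus_le_compat.
  - apply L2norm_peval_tail_le; [assumption | lia].
  - apply L2norm_le_sup; [auto with continuity | lra|]. intro t.
    eapply Rle_trans; [now apply Cmod_circle_series_minus_peval_le | apply HN0; lia].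
Qed.

Lemma tail_le_tail_derived_coef (a : nat -> C) (M : nat) : summable (derived_coef a) ->
  tail a M <= tail (derived_coef a) M / INR (S M).
Proof.
  intro Ha'. assert (HM : 0 < INR (S M)) by (apply lt_0_INR; lia).
  unfold tail, Rdiv, derived_coef. rewrite <- Series_scal_r. apply Series_le.
  - intro j. split; [apply Cmod_ge_0|]. rewrite Cmod_mult, Cmod_RtoC_nonneg by apply pos_INR.
    apply Rle_div_r; [assumption|]. rewrite Rmult_comm. apply Rmult_le_compat_r; [apply Cmod_ge_0|].
    apply le_INR. lia.
  - apply ex_series_scal_r. now apply (ex_series_incr_n (fun j => Cmod (RtoC (INR j) * a j))).
Qed.

Lemma mult_exp_neg_quarter_le (x : R) : 0 < x -> x * exp (- (x / 4)) <= 64 / x.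
Proof.
  intro Hx. apply (Rle_div_r _ _ x); [assumption|]. rewrite exp_Ropp.
  replace (x * / exp (x / 4) * x) with (x ^ 2 / exp (x / 4)) by (field; apply Rgt_not_eq, exp_pos).
  apply Rle_div_l; [apply exp_pos|].
  replace (x / 4) with (x / 8 + x / 8) by field. rewrite exp_plus.
  assert (Hexp := exp_ineq1_le (x / 8)). nra.
Qed.

Lemma eventually_ln_ge (x : R) : eventually (fun n => x <= ln (INR n)).
Proof.
  destruct (nfloor_ex (exp x)) as (N & _ & HN); [left; apply exp_pos|].
  exists (S N). intros n Hn. rewrite <- (ln_exp x). apply Rcomplements.ln_le; [apply exp_pos|].
  apply le_INR in Hn. rewrite S_INR in Hn. lra.
Qed.

Section PhaseAsymptotics.

Variables (k : nat) (a : nat -> C) (A c : R) (q : nat).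
Let a' := derived_coef a.
Let F := circle_series a.

Hypothesis k_ge_2 : (2 <= k)%nat.
Hypothesis a_sobolev : sobolev_le k a A.
Hypothesis c_pos : 0 < c.
Hypothesis phase_derivative_ge : forall t, c <= 1 - 2 * Re (circle_series a' t).

(* Moving the contour by [shift n] gains exp (- n (shift n) c / 2) = n^(- k); truncating at the frequency
   [cutoff n] keeps exp (cutoff n * shift n) below n^(1/4). *)
Let B := 2 * INR k / c.
Let shift (n : nat) := B * ln (INR n) / INR n.
Let cutoff (n : nat) := (n / q)%nat.

Hypothesis q_ge_2 : (2 <= q)%nat.
Hypothesis q_ge_4B : 4 * B <= INR q.

Let truncation (n : nat) (t : R) : C := peval a (cutoff n) (eith t).
Let full_phase (n : nat) : R -> C := phase n (fun t => RtoC (- INR n) * F t)%C.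
Let truncated_phase (n : nat) : R -> C := phase n (fun t => RtoC (- INR n) * truncation n t)%C.

Lemma B_pos : 0 < B.
Proof.
  apply Rdiv_lt_0_compat; [|assumption]. apply Rmult_lt_0_compat; [lra | apply lt_0_INR; lia].
Qed.

Lemma q_pos : 0 < INR q.
Proof. apply lt_0_INR. lia. Qed.

Lemma eventually_cutoff (P : nat -> Prop) : eventually P -> eventually (fun n => P (cutoff n)).
Proof.
  intros [N HN]. exists (q * N)%nat. intros n Hn. apply HN, Nat.div_le_lower_bound; lia.
Qed.

Lemma INR_cutoff_mult_le (n : nat) : INR (cutoff n) * INR q <= INR n.
Proof. rewrite <- mult_INR, Nat.mul_comm. apply le_INR, Nat.Div0.mul_div_le. Qed.

Lemma INR_le_S_cutoff_mult (n : nat) : INR n <= INR (S (cutoff n)) * INR q.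
Proof.
  rewrite <- mult_INR, Nat.mul_comm. apply le_INR, Nat.lt_le_incl, Nat.mul_succ_div_gt. lia.
Qed.

Lemma cutoff_lt (n : nat) : (0 < n)%nat -> (S (cutoff n) <= n)%nat.
Proof. intro Hn. apply Nat.div_lt; lia. Qed.

Lemma cutoff_mult_shift_le (n : nat) : 1 <= INR n -> 0 <= ln (INR n) ->
  INR (cutoff n) * shift n <= ln (INR n) / 4.
Proof.
  intros Hn Hln. assert (HB := B_pos). assert (Hcut := INR_cutoff_mult_le n).
  assert (Hratio : INR (cutoff n) / INR n <= / INR q).
  { apply Rle_div_l; [lra|]. rewrite Rmult_comm. apply (Rle_div_r _ _ (INR q)); lra. }
  assert (HBq : B * / INR q <= 1 / 4) by (apply (Rle_div_l _ _ (INR q)); lra).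
  assert (HBratio : B * (INR (cutoff n) / INR n) <= 1 / 4) by nra.
  unfold shift. replace (INR (cutoff n) * (B * ln (INR n) / INR n))
    with (B * (INR (cutoff n) / INR n) * ln (INR n)) by (field; lra).
  nra.
Qed.

Lemma eventually_shift_error_le : eventually (fun n =>
  2 * shift n * exp (INR (cutoff n) * shift n)
  * sum_f_R0 (fun j => INR j ^ 2 * Cmod (a j)) (cutoff n) <= c / 4).
Proof.
  assert (HB := B_pos). assert (HA0 := sqrt_pos A).
  apply (filter_imp (fun n => (1 <= n)%nat /\ 1 <= ln (INR n) /\ 512 * B * sqrt A / c <= ln (INR n))).
  - intros n (Hn & Hl1 & Hl). assert (Hn1 := le_INR 1 n Hn). simpl in Hn1.
    set (l := ln (INR n)) in *. assert (Hexp : exp l = INR n) by (apply exp_ln; lra).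
    assert (Hexp2 : sqrt (INR n) = exp (l / 2)).
    { rewrite <- Hexp. replace l with (l / 2 + l / 2) at 1 by field. rewrite exp_plus.
      apply sqrt_square. left. apply exp_pos. }
    assert (Hsum : sum_f_R0 (fun j => INR j ^ 2 * Cmod (a j)) (cutoff n) <= exp (l / 2) * sqrt A).
    { eapply Rle_trans; [now apply (sobolev_sum_sqr_weight_le k)|].
      apply Rmult_le_compat_r; [assumption|].
      rewrite <- Hexp2. apply sqrt_le_1_alt, le_INR, cutoff_lt. lia. }
    assert (Hgrowth : exp (INR (cutoff n) * shift n) <= exp (l / 4))
      by (apply exp_le, cutoff_mult_shift_le; unfold l in *; lra).
    assert (Hshift : 0 <= 2 * shift n).
    { unfold shift. fold l. apply Rmult_le_pos; [lra|]. apply Rdiv_le_0_compat; nra. }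
    apply Rle_trans with (2 * shift n * exp (l / 4) * (exp (l / 2) * sqrt A)).
    { apply Rmult_le_compat; [| | |assumption].
      - apply Rmult_le_pos; [assumption | left; apply exp_pos].
      - apply cond_pos_sum. intro j. apply Rmult_le_pos; [apply pow2_ge_0 | apply Cmod_ge_0].
      - now apply Rmult_le_compat_l. }
    replace (2 * shift n * exp (l / 4) * (exp (l / 2) * sqrt A))
      with (2 * B * sqrt A * (l * exp (- (l / 4)))).
    2:{ unfold shift. fold l. rewrite <- Hexp. replace l with (l / 4 + l / 2 + l / 4) at 4 by field.
        rewrite !exp_plus, exp_Ropp. field. split; apply Rgt_not_eq, exp_pos. }
    apply Rle_trans with (2 * B * sqrt A * (64 / l)).
    { apply Rmult_le_compat_l; [nra | apply mult_exp_neg_quarter_le; lra]. }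
    apply Rle_div_l in Hl; [|assumption].
    replace (2 * B * sqrt A * (64 / l)) with (128 * B * sqrt A / l) by (field; lra).
    apply Rle_div_l; nra.
  - apply filter_and; [now exists 1%nat|]. apply filter_and; apply eventually_ln_ge.
Qed.

Lemma derived_coef_summable : summable a'.
Proof. now apply (summable_derived_coef k a A). Qed.

Lemma eventually_shifted_exponent_le : eventually (fun n => forall t,
  Re (peval a (cutoff n) (RtoC (exp (shift n)) * eith t))
  - Re (peval a (cutoff n) (RtoC (exp (- shift n)) * eith t)) <= shift n * (1 - c / 2)).
Proof.
  assert (HB := B_pos).
  apply (filter_imp (fun n => (2 * shift n * exp (INR (cutoff n) * shift n)
    * sum_f_R0 (fun j => INR j ^ 2 * Cmod (a j)) (cutoff n) <= c / 4) /\
    tail a' (cutoff n) <= c / 8 /\ 1 <= ln (INR n) /\ (1 <= n)%nat)).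
  - intros n (Herr & Htail & Hln & Hn) t. assert (Hn1 := le_INR 1 n Hn). simpl in Hn1.
    assert (Hshift : 0 <= shift n) by (unfold shift; apply Rdiv_le_0_compat; nra).
    eapply Rle_trans; [now apply Re_peval_shift_le|]. fold a'.
    assert (Hre := Rle_trans _ _ _ (Rabs_Re_minus_le _ _)
      (Cmod_circle_series_minus_peval_le a' (cutoff n) t derived_coef_summable)).
    apply Rabs_le_between in Hre. assert (Hc := phase_derivative_ge t).
    assert (Hmain : 2 * Re (peval a' (cutoff n) (eith t)) <= 1 - c + c / 4) by lra.
    replace (2 * shift n ^ 2 * exp (INR (cutoff n) * shift n)
      * sum_f_R0 (fun j => INR j ^ 2 * Cmod (a j)) (cutoff n))
      with (shift n * (2 * shift n * exp (INR (cutoff n) * shift n)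
      * sum_f_R0 (fun j => INR j ^ 2 * Cmod (a j)) (cutoff n))) by ring.
    replace (2 * shift n * Re (peval a' (cutoff n) (eith t)))
      with (shift n * (2 * Re (peval a' (cutoff n) (eith t)))) by ring.
    rewrite <- Rmult_plus_distr_l. apply Rmult_le_compat_l; lra.
  - apply filter_and; [apply eventually_shift_error_le|].
    apply filter_and.
    { apply (eventually_cutoff (fun M => tail a' M <= c / 8)), eventually_tail_le;
        [apply derived_coef_summable | lra]. }
    apply filter_and; [apply eventually_ln_ge | now exists 1%nat].
Qed.

Lemma eventually_hankel_le_truncated_phase : eventually (fun n =>
  hankel_le (truncated_phase n) (/ INR n ^ k)).
Proof.
  assert (HB := B_pos).
  apply (filter_imp (fun n => (forall t,
    Re (peval a (cutoff n) (RtoC (exp (shift n)) * eith t))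
    - Re (peval a (cutoff n) (RtoC (exp (- shift n)) * eith t)) <= shift n * (1 - c / 2)) /\
    1 <= ln (INR n) /\ (1 <= n)%nat)).
  - intros n (Hexponent & Hln & Hn). assert (Hn1 := le_INR 1 n Hn). simpl in Hn1.
    apply (hankel_le_phase_peval a (cutoff n) n (shift n)).
    + unfold shift. apply Rdiv_le_0_compat; nra.
    + intro t. specialize (Hexponent t).
      replace (/ INR n ^ k) with (exp (- (INR k * ln (INR n))))
        by (rewrite exp_Ropp, exp_INR_mult, exp_ln by lra; reflexivity).
      apply exp_le.
      replace (- (INR k * ln (INR n))) with (INR n * (shift n * (1 - c / 2) - shift n))
        by (unfold shift, B; field; split; lra).
      apply Rmult_le_compat_l; lra.
  - apply filter_and; [apply eventually_shifted_exponent_le|].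
    apply filter_and; [apply eventually_ln_ge | now exists 1%nat].
Qed.

Lemma Cmod_full_phase_minus_truncated_phase_le (n : nat) (t : R) :
  Cmod (full_phase n t - truncated_phase n t)
  <= 2 * INR n * Cmod (F t - truncation n t).
Proof.
  eapply Rle_trans; [apply Cmod_phase_minus_le|]. right.
  replace (RtoC (- INR n) * F t - RtoC (- INR n) * truncation n t)%C
    with (RtoC (- INR n) * (F t - truncation n t))%C by ring.
  rewrite Cmod_mult, Cmod_R, Rabs_Ropp, Rabs_pos_eq by apply pos_INR. ring.
Qed.

Lemma eventually_uniform_truncation_error_le :
  eventually (fun n => forall t, 2 * INR n * Cmod (F t - truncation n t) <= / 4).
Proof.
  assert (Hq := q_pos). assert (Ha' := derived_coef_summable).
  apply (filter_imp (fun n => tail a' (cutoff n) <= / (8 * INR q))).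
  - intros n Htail t. set (M := cutoff n) in *. assert (HM : 0 < INR (S M)) by (apply lt_0_INR; lia).
    assert (HF : Cmod (F t - truncation n t) <= / (8 * INR q) / INR (S M)).
    { eapply Rle_trans; [apply Cmod_circle_series_minus_peval_le; now apply summable_of_derived_coef|].
      eapply Rle_trans; [now apply tail_le_tail_derived_coef|].
      apply Rmult_le_compat_r; [left; now apply Rinv_0_lt_compat | exact Htail]. }
    assert (Hn := INR_le_S_cutoff_mult n). fold M in Hn. assert (Hn0 := pos_INR n).
    apply Rle_trans with (2 * (INR (S M) * INR q) * (/ (8 * INR q) / INR (S M))).
    + apply Rmult_le_compat; [lra | apply Cmod_ge_0 | lra | assumption].
    + right. field. split; lra.
  - apply (eventually_cutoff (fun M => tail a' M <= / (8 * INR q))), eventually_tail_le; [assumption|].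
    apply Rinv_0_lt_compat. lra.
Qed.

Lemma Ccontinuous_full_phase (n : nat) : Ccontinuous (full_phase n).
Proof.
  assert (HF := disc_algebra_circle_series a (summable_of_derived_coef a derived_coef_summable)).
  apply Ccontinuous_phase. auto with continuity.
Qed.

Lemma Ccontinuous_truncated_phase (n : nat) : Ccontinuous (truncated_phase n).
Proof. apply Ccontinuous_phase. unfold truncation. auto with continuity. Qed.

Lemma L2norm_full_phase_minus_truncated_phase_le (n : nat) : (1 <= n)%nat ->
  L2norm (fun t => full_phase n t - truncated_phase n t)%C <=
  2 * sqrt A * INR q ^ k / INR n ^ (k - 1).
Proof.
  intro Hn. assert (Hn1 := le_INR 1 n Hn). simpl in Hn1. assert (Hn0 := pos_INR n).
  assert (Ha := summable_of_derived_coef a derived_coef_summable).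
  assert (HF := disc_algebra_circle_series a Ha).
  assert (Hphase := Ccontinuous_full_phase n). assert (Htrunc := Ccontinuous_truncated_phase n).
  assert (HTcont : Ccontinuous (truncation n)) by (unfold truncation; auto with continuity).
  apply Rle_trans with (2 * INR n * L2norm (fun t => F t - truncation n t)%C).
  { rewrite <- (Cmod_RtoC_nonneg (2 * INR n)) by lra. rewrite <- L2norm_scal by auto with continuity.
    apply L2norm_le; auto with continuity. intro t.
    rewrite Cmod_mult, Cmod_RtoC_nonneg by lra. apply Cmod_full_phase_minus_truncated_phase_le. }
  assert (Hnorm := L2norm_circle_series_minus_peval_le k a A (cutoff n) Ha a_sobolev).
  fold F in Hnorm. assert (Hcut := INR_le_S_cutoff_mult n). assert (HA := sqrt_pos A).
  set (m := INR (S (cutoff n))) in *.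
  assert (Hm : 0 < m) by (apply lt_0_INR; lia).
  assert (Hmk : 0 < m ^ k) by now apply pow_lt.
  assert (Hnk : 0 < INR n ^ (k - 1)) by (apply pow_lt; lra).
  apply Rle_trans with (2 * INR n * (sqrt A / m ^ k)); [apply Rmult_le_compat_l; [lra | exact Hnorm]|].
  apply (Rle_div_r _ _ (INR n ^ (k - 1))); [assumption|].
  replace (2 * INR n * (sqrt A / m ^ k) * INR n ^ (k - 1)) with (2 * sqrt A * INR n ^ k / m ^ k).
  2:{ replace k with (S (k - 1)) at 1 by lia. simpl. field. lra. }
  apply (Rle_div_l _ _ (m ^ k)); [assumption|].
  replace (2 * sqrt A * INR q ^ k * m ^ k) with (2 * sqrt A * (m * INR q) ^ k)
    by (rewrite Rpow_mult_distr; ring).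
  apply Rmult_le_compat_l; [lra | now apply pow_incr].
Qed.

Lemma eventually_full_phase_bounds : eventually (fun n =>
  hankel_le (full_phase n) (/ 2) /\
  nonpositive_le (full_phase n)
    ((1 + 2 * sqrt A * INR q ^ k) / INR n ^ (k - 1))).
Proof.
  apply (filter_imp (fun n =>
    hankel_le (truncated_phase n) (/ INR n ^ k) /\
    (forall t, 2 * INR n * Cmod (F t - truncation n t) <= / 4) /\ (4 <= n)%nat)).
  - intros n (Hhankel & Herror & Hn).
    assert (Hn4 := le_INR 4 n Hn). replace (INR 4) with 4 in Hn4 by (simpl; ring).
    assert (Hpow : INR n ^ k = INR n * INR n ^ (k - 1))
      by (rewrite tech_pow_Rmult; f_equal; lia).
    assert (Hpow1 : 1 <= INR n ^ (k - 1)) by (apply pow_R1_Rle; lra).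
    assert (Hphase := Ccontinuous_full_phase n). assert (Htrunc := Ccontinuous_truncated_phase n).
    split.
    + apply (hankel_le_weaken _ (/ INR n ^ k + / 4)).
      * apply (hankel_le_perturb _ _ _ _ Hphase Htrunc); [lra | assumption|]. intro t.
        eapply Rle_trans; [apply Cmod_full_phase_minus_truncated_phase_le | apply Herror].
      * assert (Hinv : / INR n ^ k <= / 4) by (apply Rinv_le_contravar; nra). lra.
    + apply (nonpositive_le_weaken _ (/ INR n ^ k + 2 * sqrt A * INR q ^ k / INR n ^ (k - 1))).
      * apply (nonpositive_le_perturb _ _ _ _ Hphase Htrunc).
        -- now apply hankel_le_nonpositive_le.
        -- apply L2norm_full_phase_minus_truncated_phase_le. lia.
      * unfold Rdiv. rewrite Rmult_plus_distr_r, Rmult_1_l. apply Rplus_le_compat_r.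
        apply Rinv_le_contravar; nra.
  - apply filter_and; [apply eventually_hankel_le_truncated_phase|].
    apply filter_and; [apply eventually_uniform_truncation_error_le | now exists 4%nat].
Qed.

End PhaseAsymptotics.

Lemma phase_bounds (k : nat) (a : nat -> C) (A c : R) : (2 <= k)%nat -> sobolev_le k a A -> 0 < c ->
  (forall t, c <= 1 - 2 * Re (circle_series (derived_coef a) t)) ->
  exists K, 0 < K /\ eventually (fun n =>
    hankel_le (phase n (fun t => RtoC (- INR n) * circle_series a t)%C) (/ 2) /\
    nonpositive_le (phase n (fun t => RtoC (- INR n) * circle_series a t)%C) (K / INR n ^ (k - 1))).
Proof.
  intros Hk HA Hc Hderiv.
  assert (HB : 0 <= 4 * (2 * INR k / c))
    by (assert (Hk0 := pos_INR k); apply Rmult_le_pos; [lra | apply Rdiv_le_0_compat; lra]).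
  destruct (nfloor_ex _ HB) as (q & _ & Hq). rewrite <- S_INR in Hq.
  exists (1 + 2 * sqrt A * INR (S (S q)) ^ k). split.
  - assert (HA0 := sqrt_pos A). assert (Hpow : 0 <= INR (S (S q)) ^ k) by apply pow_le, pos_INR. nra.
  - apply (eventually_full_phase_bounds k a A c (S (S q))); auto; [lia|]. rewrite (S_INR (S q)). lra.
Qed.

Lemma leading_coefficient_asymptotics (k : nat) (V : R -> R) : (2 <= k)%nat -> CmLip (k - 1) V ->
  (forall t, exists d, is_derive (kappa V) t d /\ 0 < d) ->
  exists K, 0 < K /\ eventually (fun n => forall P,
    orthonormal_system (fun t => exp (- INR n * V t)) P ->
    Rabs (Re (P (n - 1)%nat (n - 1)%nat) ^ 2 * exp (- INR n * V0 V) - 1) <= K / INR n ^ (2 * (k - 1))).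
Proof.
  intros Hk HV Hkappa. destruct (CmLip_sobolev (k - 1) V HV) as [A HA].
  apply sobolev_szego_coef in HA. replace (S (k - 1)) with k in HA by lia.
  destruct (kappa_derivative_bounded_below k V A Hk HV HA Hkappa) as (c & Hc & Hderiv).
  destruct (phase_bounds k (szego_coef V) A c Hk HA Hc Hderiv) as (K & HK & N & HN).
  assert (Hsummable := summable_szego_coef k V A Hk HA).
  assert (HF := disc_algebra_circle_series (szego_coef V) Hsummable).
  exists (4 * K ^ 2). split; [nra|]. exists (S N). intros [|d] Hn P HP; [lia|].
  destruct (HN (S d) ltac:(lia)) as [Hhankel Hnonpos].
  replace (S d - 1)%nat with d by lia. assert (Hd : 0 < INR (S d)) by (apply lt_0_INR; lia).
  assert (Hpow : 0 < INR (S d) ^ (k - 1)) by now apply pow_lt.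
  assert (Hdefect := leading_coefficient_defect _ P
            (fun t => RtoC (- INR (S d)) * circle_series (szego_coef V) t)%C d HP
            (disc_algebra_scal _ _ HF)).
  rewrite Cmean_scal, Cmean_circle_series in Hdefect by auto with continuity.
  replace (2 * Re (RtoC (- INR (S d)) * szego_coef V 0)) with (- INR (S d) * V0 V) in Hdefect
    by (rewrite re_scal_l; simpl szego_coef; rewrite re_RtoC; field).
  assert (Hfactor : forall t, exp (- INR (S d) * V t)
            = exp (2 * Re (RtoC (- INR (S d)) * circle_series (szego_coef V) t))).
  { intro t. rewrite (potential_eq_Re_circle_series k V A Hk HV HA t) at 1. rewrite re_scal_l.
    f_equal. ring. }
  destruct (Hdefect Hfactor _ Hhankel Hnonpos) as [Hge Hle]; [apply Rdiv_le_0_compat; lra|].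
  rewrite Rabs_minus_sym, Rabs_pos_eq by assumption. eapply Rle_trans; [exact Hle|]. right.
  rewrite Nat.mul_comm, pow_mult. field. lra.
Qed.

Theorem theorem4p7 (k : nat) (V : R -> R) :
  (2 <= k)%nat ->
  CmLip (k - 1) V ->
  (forall t, exists d, is_derive (kappa V) t d /\ 0 < d) ->
  exists K : R, 0 < K /\
    exists N : nat, forall n : nat, (N <= n)%nat ->
      forall P : nat -> nat -> C,
        orthonormal_system (fun t => exp (- INR n * V t)) P ->
        Rabs ((Re (P (n - 1)%nat (n - 1)%nat)) ^ 2 * exp (- INR n * V0 V) - 1)
          <= K * ln (INR n) / INR n ^ (2 * (k - 1)).
Proof.
  intros Hk HV Hkappa.
  destruct (leading_coefficient_asymptotics k V Hk HV Hkappa) as (K & HK & Hasymp).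
  exists K. split; [assumption|].
  destruct (filter_and _ _ Hasymp (eventually_ln_ge 1)) as [N HN].
  exists (S N). intros n Hn P HP. destruct (HN n ltac:(lia)) as [Hbound Hln].
  eapply Rle_trans; [now apply Hbound|].
  apply Rmult_le_compat_r; [left; apply Rinv_0_lt_compat, pow_lt, lt_0_INR; lia|].
  rewrite <- (Rmult_1_r K) at 1. apply Rmult_le_compat_l; lra.
Qed.
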